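(* For every word $w\in\mathcal D_n^*$ there is a unique orthogonal tableau $P^D(w)$ of type $D$ with $\mathrm w(P^D(w))\sim w$, and for any two words $w_1,w_2\in\mathcal D_n^*$: $$w_1\sim w_2\iff w_1\equiv^D w_2\iff P^D(w_1)=P^D(w_2).$$
   Context: Fix $n\ge2$. $\mathcal D_n=\{1\prec\cdots\prec n-1\prec n,\bar n\prec\overline{n-1}\prec\cdots\prec\bar1\}$ with $n,\bar n$ incomparable; $\bar{\bar k}=k$; $x$ unbarred iff $x\preceq n$. Vector crystal: arrows $i\xrightarrow{i}i+1$, $\overline{i+1}\xrightarrow{i}\bar i$ ($1\le i<n$), $n-1\xrightarrow{n}\bar n$, $n\xrightarrow{n}\overline{n-1}$ ($a\xrightarrow{i}b$ means $\tilde f_ia=b$). Tensor rule: $\tilde f_i(u\otimes v)=\tilde f_iu\otimes v$ if $\varphi_i(u)>\varepsilon_i(v)$, else $u\otimes\tilde f_iv$; $\tilde e_i(u\otimes v)=u\otimes\tilde e_iv$ if $\varphi_i(u)<\varepsilon_i(v)$, else $\tilde e_iu\otimes v$. $G_n^D$ is the crystal on $\mathcal D_n^*$ identifying $u_1\cdots u_l$ with $u_1\otimes\cdots\otimes u_l$. $w_1\sim w_2$ means: the components of $w_1,w_2$ are isomorphic as colored graphs and there are $i_1,\dots,i_r$ with $w_j=\tilde f_{i_1}\cdots\tilde f_{i_r}w_j^0$ ($j=1,2$), $w_j^0$ the highest weight vertex of the component of $w_j$. Columns of type $D$: sequences $x_1,\dots,x_l$ of letters of $\mathcal D_n$ with $x_{i+1}\not\preceq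 x_i$; reading $x_1\cdots x_l$. $N(z)$ ($z\preceq n$) is the number of letters $x$ of $C$ with $x\preceq z$ or $x\succeq\bar z$. Admissible: $h(C)\le n$ and for every $z=x_p$, $\bar z=x_q$ with $z\preceq n$, $|q-p|\ge h(C)-z+1$. Tabloid $T=C_1\cdots C_r$ with $h(C_1)\ge\cdots\ge h(C_r)$ (shape $Y$), reading $\mathrm w(C_r)\cdots\mathrm w(C_1)$; $T_Y$ fills each column of height $k$ with $1,\dots,k$, and $T_Y^-$ is $T_Y$ with each column of height $n$ filled with $1,\dots,n-1,\bar n$; $T$ is an orthogonal tableau of type $D$ if $\mathrm w(T)$ lies in the component of $G_n^D$ containing $\mathrm w(T_Y)$ or that containing $\mathrm w(T_Y^-)$. $\equiv^D$ is the smallest congruence on $\mathcal D_n^*$ containing: (R1) $yzx\equiv yxz$ for $x\preceq y\prec z$, $x\ne\bar z$, and $xzy\equiv zxy$ for $x\prec y\preceq z$, $x\neq\bar z$; (R2) for $1\prec x\prec n$ and $x\preceq y\preceq\bar x$: $y\,\overline{x-1}\,(x-1)\equiv y\,x\,\bar x$ and $x\,\bar x\,y\equiv\overline{x-1}\,(x-1)\,y$; (R3) for $x\preceq n-1$: $\bar n\,\bar x\,n\equiv\bar x\,\bar n\,n$, $n\,\bar x\,\bar n\equiv\bar x\,n\,\bar n$, $\bar n\,n\,x\equiv\bar n\,x\,n$, $n\,\bar n\,x\equiv n\,x\,\bar n$; (R4) $n\bar n\bar n\equiv\overline{n-1}\,(n-1)\,\bar n$, $\bar nnn\equiv\overline{n-1}\,(n-1)\,n$,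 $\bar n\,\overline{n-1}\,(n-1)\equiv\bar n\bar nn$, $n\,\overline{n-1}\,(n-1)\equiv nn\bar n$; (R5) if $w=\mathrm w(C)$ is the reading of a non-admissible column $C$ of type $D$ all of whose proper factors are admissible column readings, let $z$ be the lowest unbarred letter with $z,\bar z\in C$ and $N(z)>z$; let $\tilde w$ be $w$ with $z$ and $\bar z$ erased if $z\prec n$, and $w$ with a pair of consecutive letters $n,\bar n$ (in either order) erased if $z=n$; then $w\equiv\tilde w$. *)

(* Defs.v *)
From mathcomp Require Import all_boot.

Set Implicit Arguments.
Unset Strict Implicit.
Unset Printing Implicit Defensive.

Section TypeD.
Variable n : nat.

(* A letter of D_n: (j, false) is the unbarred letter j+1, (j, true) is the
   barred letter \overline{j+1}, for j : 'I_n. *)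
Definition letter := ('I_n * bool)%type.
Definition word := seq letter.

Definition lv (a : letter) : nat := (nat_of_ord a.1).+1.
Definition lbar (a : letter) : letter := (a.1, ~~ a.2).
Definition isU (k : nat) (a : letter) : bool := ~~ a.2 && (lv a == k).
Definition isB (k : nat) (a : letter) : bool := a.2 && (lv a == k).

(* the order 1 < ... < n-1 < n, \bar n < \bar{n-1} < ... < \bar 1,
   with n and \bar n incomparable *)
Definition rk (a : letter) : nat := if a.2 then (2 * n).+1 - lv a else lv a.
Definition incomp (a b : letter) : bool :=
  [&& lv a == n, lv b == n & a.2 != b.2].
Definition ltD (a b : letter) : bool := (rk a < rk b) && ~~ incomp a b.
Definition leD (a b : letter) : bool := (a == b) || ltD a b.

Definition mkl (k : nat) (b : bool) : option letter :=
  if k is k'.+1 then omap (fun o : 'I_n => (o, b)) (insub k') else None.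

Definition color (i : nat) : bool := 0 < i <= n.

Definition fL (i : nat) (a : letter) : option letter :=
  if 0 < i < n then
    if isU i a then mkl i.+1 false
    else if isB i.+1 a then mkl i true else None
  else if i == n then
    if isU n.-1 a then mkl n true
    else if isU n a then mkl n.-1 true else None
  else None.

Definition eL (i : nat) (a : letter) : option letter :=
  if 0 < i < n then
    if isU i.+1 a then mkl i false
    else if isB i a then mkl i.+1 true else None
  else if i == n then
    if isB n a then mkl n.-1 false
    else if isB n.-1 a then mkl n false else None
  else None.

(* string lengths in the vector crystal (all strings have length <= 1) *)
Definition phiL (i : nat) (a : letter) : nat := fL i a != None.
Definition epsL (i : nat) (a : letter) : nat := eL i a != None.

(* x1 x2 ... xl = x1 (x) (x2 (x) ... (x) xl): the tensor rule with
   u = x1, v = x2...xl; eps_i of a tensor product by the usual formula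
   eps_i(u (x) v) = eps_i(u) + max(0, eps_i(v) - phi_i(u)) for this rule. *)
Fixpoint epsW (i : nat) (w : word) : nat :=
  if w is x :: w' then epsL i x + (epsW i w' - phiL i x) else 0.

Fixpoint fW (i : nat) (w : word) : option word :=
  if w is x :: w' then
    if epsW i w' < phiL i x then omap (fun y => y :: w') (fL i x)
    else omap (cons x) (fW i w')
  else None.

Fixpoint eW (i : nat) (w : word) : option word :=
  if w is x :: w' then
    if phiL i x < epsW i w' then omap (cons x) (eW i w')
    else omap (fun y => y :: w') (eL i x)
  else None.

Inductive conn : word -> word -> Prop :=
| conn_refl w : conn w w
| conn_f w1 w2 w3 i : color i -> fW i w1 = Some w2 -> conn w2 w3 -> conn w1 w3
| conn_e w1 w2 w3 i : color i -> fW i w2 = Some w1 -> conn w2 w3 -> conn w1 w3.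

Definition highest (w : word) : Prop := forall i, color i -> eW i w = None.

Definition comp_iso (w1 w2 : word) : Prop :=
  exists (g h : word -> word),
    (forall x, conn w1 x -> conn w2 (g x) /\ h (g x) = x) /\
    (forall y, conn w2 y -> conn w1 (h y) /\ g (h y) = y) /\
    (forall x i, conn w1 x -> color i -> fW i (g x) = omap g (fW i x)).

Definition fseq (s : seq nat) (w : word) : option word :=
  foldr (fun i ow => obind (fW i) ow) (Some w) s.

Definition sim (w1 w2 : word) : Prop :=
  comp_iso w1 w2 /\
  exists (s : seq nat) (w01 w02 : word),
    all color s /\ conn w1 w01 /\ highest w01 /\ conn w2 w02 /\ highest w02 /\
    fseq s w01 = Some w1 /\ fseq s w02 = Some w2.

Definition is_col (w : word) : bool := sorted (fun a b => ~~ leD b a) w.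

Definition admissible (w : word) : Prop :=
  size w <= n /\
  forall (u v t : word) (a : letter),
    w = u ++ a :: v ++ lbar a :: t -> size w - lv a + 1 <= size v + 1.

Definition NN (z : letter) (w : word) : nat :=
  count (fun x => leD x z || leD (lbar z) x) w.

Definition Pz (w : word) (z : letter) : bool :=
  [&& ~~ z.2, z \in w, lbar z \in w & lv z < NN z w].

Definition R1 (x y : word) : Prop :=
  exists a b c : letter,
    ([&& leD a b, ltD b c & a != lbar c] /\
       x = [:: b; c; a] /\ y = [:: b; a; c]) \/
    ([&& ltD a b, leD b c & a != lbar c] /\
       x = [:: a; c; b] /\ y = [:: c; a; b]).

Definition R2 (x y : word) : Prop :=
  exists a b p q : letter,
    [&& ~~ a.2, 1 < lv a, lv a < n, leD a b, leD b (lbar a),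
        isB (lv a).-1 p & isU (lv a).-1 q] /\
    ((x = [:: b; p; q] /\ y = [:: b; a; lbar a]) \/
     (x = [:: a; lbar a; b] /\ y = [:: p; q; b])).

Definition R3 (x y : word) : Prop :=
  exists c a b : letter,
    [&& ~~ c.2, lv c <= n.-1, isU n a & isB n b] /\
    ((x = [:: b; lbar c; a] /\ y = [:: lbar c; b; a]) \/
     (x = [:: a; lbar c; b] /\ y = [:: lbar c; a; b]) \/
     (x = [:: b; a; c] /\ y = [:: b; c; a]) \/
     (x = [:: a; b; c] /\ y = [:: a; c; b])).

Definition R4 (x y : word) : Prop :=
  exists a b c d : letter,
    [&& isU n a, isB n b, isB n.-1 c & isU n.-1 d] /\
    ((x = [:: a; b; b] /\ y = [:: c; d; b]) \/
     (x = [:: b; a; a] /\ y = [:: c; d; a]) \/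
     (x = [:: b; c; d] /\ y = [:: b; b; a]) \/
     (x = [:: a; c; d] /\ y = [:: a; a; b])).

Definition R5 (x y : word) : Prop :=
  is_col x /\ ~ admissible x /\
  (forall u : word, infix u x -> u != x -> admissible u) /\
  exists z : letter,
    Pz x z /\ (forall z', Pz x z' -> lv z <= lv z') /\
    ((lv z < n /\ y = filter (fun a => lv a != lv z) x) \/
     (lv z = n /\ exists (u v : word) (a b : letter),
        incomp a b /\ x = u ++ a :: b :: v /\ y = u ++ v)).

Definition elemD (x y : word) : Prop := R1 x y \/ R2 x y \/ R3 x y \/ R4 x y \/ R5 x y.

Inductive congD : word -> word -> Prop :=
| congD_base (u v x y : word) : elemD x y -> congD (u ++ x ++ v) (u ++ y ++ v)
| congD_refl w : congD w w
| congD_sym w1 w2 : congD w1 w2 -> congD w2 w1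
| congD_trans w1 w2 w3 : congD w1 w2 -> congD w2 w3 -> congD w1 w3.

Definition reading (T : seq word) : word := flatten (rev T).

Definition tabloid (T : seq word) : bool :=
  [&& all is_col T, all (fun C => 0 < size C) T & sorted geq (map size T)].

Definition colY (k : nat) : word := pmap (fun j => mkl j false) (iota 1 k).
Definition colYm (k : nat) : word :=
  if k == n then pmap (fun j => mkl j (j == n)) (iota 1 n) else colY k.

Definition TY (Y : seq nat) : seq word := map colY Y.
Definition TYm (Y : seq nat) : seq word := map colYm Y.

Definition ortho (T : seq word) : Prop :=
  tabloid T /\ all (fun C => size C <= n) T /\
  (conn (reading (TY (map size T))) (reading T) \/
   conn (reading (TYm (map size T))) (reading T)).

Definition is_PD (w : word) (T : seq word) : Prop :=
  ortho T /\ sim (reading T) w.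

End TypeD.

(* Main.v *)
(* The congruence is compatible with the crystal operators: each defining
   relation relates words with the same eps_i and phi_i, and f_i sends it to
   another defining relation.  For (R5) the point is that a column is admissible
   iff N(m) <= m for every m, so that the columns of (R5) are those with
   max_m (N(m) - m) = 1, and that f_i changes only N(i) when i < n; the color n
   is reduced to n-1 by the diagram automorphism.  A connected component has a
   unique highest weight vertex: by Newman's lemma this is a local question on
   two colors, which for adjacent colors is settled by row insertion on words
   in {1,2,3}.  Finally a highest weight word is congruent to the reading of
   some T_Y or T_Y^-, by induction on its last letter.  Hence two congruent words
   of the same component are equal, and raising to the highest weight vertex
   turns congruence into an isomorphism of components and conversely. *)

Require Import Defs.
From mathcomp Require Import all_boot zify.

Set Implicit Arguments.
Unset Strict Implicit.
Unset Printing Implicit Defensive.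

(** * The tensor rule *)

Section Basics.
Variable n : nat.
Implicit Types (a b x y : letter n) (u v w : word n) (i : nat).

(** Uniqueness of the highest weight vertex is usually a consequence of the representation theory of
    the quantum group; here it has to come from the words alone. Termination of raising is cheap, as
    it lowers the sum of the ranks, so the weight lies on joining two raisings of one word. Colors
    not joined in the Dynkin diagram close up to a square; for adjacent ones a letter or its bar
    becomes a column of type A_2, and all prefixes are inserted, not only the whole word. Letters
    are handled through their ranks 1, ..., 2n, with the bar r -> 2n+1-r. The incomparable pair is
    then the single exception (n, n+1) to the order of integers, and each case of a relation and of
    its image under f_i is a system of linear inequalities. That canonical words can be told apart
    rests on the phi_i: they recover Y and, as soon as Y has a column of height n, also the choice
    between T_Y and T_Y^-, through the colors n-1 and n. *)

Lemma lv_bounds a : 0 < lv a <= n.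
Proof. by rewrite /lv /=. Qed.

Lemma letter_eq a b : lv a = lv b -> a.2 = b.2 -> a = b.
Proof.
case: a b => [a s] [b t]; rewrite /lv /= => -[] e ->.
by congr pair; apply: val_inj.
Qed.

Lemma mklE k s a : mkl n k s = Some a <-> lv a = k /\ a.2 = s.
Proof.
rewrite /mkl; case: k => [|k]; first by split=> // -[].
case: insubP => [o lt_k eqo|nlt] /=; split=> //.
- by case=> <-; rewrite /lv /= eqo.
- by move=> -[[eqa] eqs]; congr Some; apply: letter_eq; rewrite /lv /= ?eqo ?eqa.
- by move=> -[[eqa] _]; rewrite -eqa ltn_ord in nlt.
Qed.

Lemma letter_exists k s : 0 < k <= n -> exists a, lv a = k /\ a.2 = s.
Proof.
case: k => [//|k] lt_k.
by exists (Ordinal lt_k, s); rewrite /lv.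
Qed.

Lemma isUE k a : isU k a = ~~ a.2 && (lv a == k). Proof. by []. Qed.
Lemma isBE k a : isB k a = a.2 && (lv a == k). Proof. by []. Qed.

Definition arrow i a b : bool :=
  (0 < i < n) && (isU i a && isU i.+1 b || isB i.+1 a && isB i b) ||
  (i == n) && (isU n.-1 a && isB n b || isU n a && isB n.-1 b).

Lemma fLE i a b : fL i a = Some b <-> arrow i a b.
Proof.
have := lv_bounds a; have := lv_bounds b.
rewrite /fL /arrow !isUE !isBE => lb la.
case: ifP => hi; last case: ifP => hi2 //=; case: ifP => h1; try case: ifP => h2 //;
  rewrite ?mklE; split=> //; try (by lia); by case: (a.2) (b.2) h1 => [] []; lia.
Qed.

Lemma eLE i a b : eL i b = Some a <-> arrow i a b.
Proof.
have := lv_bounds a; have := lv_bounds b.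
rewrite /eL /arrow !isUE !isBE => lb la.
case: ifP => hi; last case: ifP => hi2 //=; case: ifP => h1; try case: ifP => h2 //;
  rewrite ?mklE; split=> //; try (by lia); by case: (a.2) (b.2) h1 => [] []; lia.
Qed.

Lemma fL_eL i a b : fL i a = Some b <-> eL i b = Some a.
Proof. by rewrite fLE eLE. Qed.

(** No letter is both source and target of arrows of one color, so the strings of the vector crystal
    have length at most 1. *)
Lemma fL_eps0 i a b : fL i a = Some b -> epsL i a = 0.
Proof.
rewrite /epsL; case E: (eL i a) => [c|] //; move: E; rewrite eLE fLE /arrow !isUE !isBE.
have := lv_bounds a; have := lv_bounds b; have := lv_bounds c.
by case: (a.2) (b.2) (c.2) => [] [] []; lia.
Qed.

Lemma eL_phi0 i a b : eL i a = Some b -> phiL i a = 0.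
Proof.
rewrite /phiL; case E: (fL i a) => [c|] // Eb.
by move: (fL_eps0 E); rewrite /epsL Eb.
Qed.

Lemma fL_phi1 i a b : fL i a = Some b -> phiL i a = 1.
Proof. by rewrite /phiL => ->. Qed.

Lemma eL_eps1 i a b : eL i a = Some b -> epsL i a = 1.
Proof. by rewrite /epsL => ->. Qed.

Lemma phiL_le1 i a : phiL i a <= 1. Proof. exact: leq_b1. Qed.
Lemma epsL_le1 i a : epsL i a <= 1. Proof. exact: leq_b1. Qed.

(** The formula dual to [epsW]: the phi of the left factor are cancelled by the epsilon of the right
    one, and truncated subtraction counts what survives. *)
Fixpoint phiW i w : nat :=
  if w is x :: w' then phiW i w' + (phiL i x - epsW i w') else 0.

Lemma epsW_cat i u v : epsW i (u ++ v) = epsW i u + (epsW i v - phiW i u).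
Proof. by elim: u => [|x u IH] /=; lia. Qed.

Lemma phiW_cat i u v : phiW i (u ++ v) = phiW i v + (phiW i u - epsW i v).
Proof. by elim: u => [|x u IH] /=; rewrite ?IH ?epsW_cat; lia. Qed.

Lemma fW_cat i u v :
  fW i (u ++ v) = if epsW i v < phiW i u then omap (cat^~ v) (fW i u)
                  else omap (cat u) (fW i v).
Proof.
elim: u => [|x u IH] /=; first by case: (fW i v).
rewrite epsW_cat IH; have := phiL_le1 i x => lx.
case: (ltnP (epsW i u + (epsW i v - phiW i u)) (phiL i x)) => h1.
  by rewrite !ifT; [case: (fL i x)| lia | lia].
case: (ltnP (epsW i v) (phiW i u)) => h2.
  by rewrite ifT; [rewrite ifF; [case: (fW i u) | lia] | lia].
by rewrite ifF; [case: (fW i v) | lia].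
Qed.

(** The signature rule. Each phi cancels an epsilon to its right, and f_i acts on the leftmost phi
    that survives: no phi survives in the prefix before it and no epsilon in the suffix after it.
    This form is symmetric under reversal combined with the exchange of phi and epsilon. *)
Lemma fW_pivot i w w' : fW i w = Some w' <->
  exists u x y v, [/\ w = u ++ x :: v, w' = u ++ y :: v, fL i x = Some y,
                      phiW i u = 0 & epsW i v = 0].
Proof.
split.
  elim: w w' => [//|x w IH] w' /=; have := phiL_le1 i x => lx.
  case: ifP => h.
    case E: (fL i x) => [y|] //= -[<-].
    by exists [::], x, y, w; split=> //=; lia.
  case Ew: (fW i w) => [w1|] //= -[<-].
  have [u [p [q [v [ew -> fpq pu ev]]]]] := IH _ Ew.
  exists (x :: u), p, q, v; split=> //=; first by rewrite ew.
  move: h; rewrite ew epsW_cat /= ev pu (fL_eps0 fpq); lia.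
move=> [u [x [y [v [-> -> fxy pu ev]]]]].
by rewrite fW_cat pu ltn0 /= ev (fL_phi1 fxy) fxy.
Qed.

Lemma eW_pivot i w w' : eW i w = Some w' <->
  exists u x y v, [/\ w = u ++ x :: v, w' = u ++ y :: v, eL i x = Some y,
                      phiW i u = 0 & epsW i v = 0].
Proof.
split.
  elim: w w' => [//|x w IH] w' /=; have := phiL_le1 i x => lx.
  case: ifP => h.
    case Ew: (eW i w) => [w1|] //= -[<-].
    have [u [p [q [v [ew -> epq pu ev]]]]] := IH _ Ew.
    exists (x :: u), p, q, v; split=> //=; first by rewrite ew.
    move: h; rewrite ew epsW_cat /= ev pu (eL_eps1 epq); lia.
  case E: (eL i x) => [y|] //= -[<-].
  exists [::], x, y, w; split=> //=; move: h; rewrite (eL_phi0 E); lia.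
move=> [u [x [y [v [-> -> exy pu ev]]]]].
elim: u pu => [|z u IH] /=; first by rewrite ev ltn0 exy.
rewrite epsW_cat /= ev (eL_eps1 exy) => h.
rewrite IH; last by lia.
by rewrite ifT //; lia.
Qed.

(** The pivot conditions bear only on the prefix and the suffix and are the same for e_i and f_i;
    reversing the arrow at the pivot exchanges the two. *)
Lemma eW_fW i w w' : eW i w = Some w' <-> fW i w' = Some w.
Proof.
rewrite eW_pivot fW_pivot; split=> -[u [x [y [v [-> -> e pu ev]]]]];
  by exists u, y, x, v; split=> //; move: e; rewrite fL_eL.
Qed.

Lemma fW_eps i w w' : fW i w = Some w' -> epsW i w' = (epsW i w).+1.
Proof.
rewrite fW_pivot => -[u [x [y [v [-> -> e pu ev]]]]].
rewrite !epsW_cat /= (fL_eps0 e) ev; move/fL_eL/eL_eps1: e => ->; lia.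
Qed.

Lemma fW_phi i w w' : fW i w = Some w' -> phiW i w = (phiW i w').+1.
Proof.
rewrite fW_pivot => -[u [x [y [v [-> -> e pu ev]]]]].
rewrite !phiW_cat /= (fL_phi1 e) ev; move/fL_eL/eL_phi0: e => ->; lia.
Qed.

Lemma fW_None i w : fW i w = None <-> phiW i w = 0.
Proof.
split; last by case E: (fW i w) => [w1|] //; rewrite (fW_phi E).
elim: w => [//|x w IH] /=; case: ifP => h.
  by move: h; rewrite /phiL; case: (fL i x).
by case: (fW i w) IH => //= /(_ erefl) -> _; lia.
Qed.

Lemma eW_None i w : eW i w = None <-> epsW i w = 0.
Proof.
split; last by case E: (eW i w) => [w1|] //; move/eW_fW/fW_eps: E => ->.
elim: w => [//|x w IH] /=; have := phiL_le1 i x => lx; case: ifP => h.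
  by case: (eW i w) IH => //= /(_ erefl) e _; lia.
by rewrite /epsL; case E: (eL i x) => //= _; lia.
Qed.

Lemma fW_ex i w : 0 < phiW i w -> exists w', fW i w = Some w'.
Proof.
case E: (fW i w) => [w'|] h; first by exists w'.
by move/fW_None: E h => ->.
Qed.

Lemma eW_ex i w : 0 < epsW i w -> exists w', eW i w = Some w'.
Proof.
case E: (eW i w) => [w'|] h; first by exists w'.
by move/eW_None: E h => ->.
Qed.

Lemma fW_size i w w' : fW i w = Some w' -> size w' = size w.
Proof. by rewrite fW_pivot => -[u [x [y [v [-> -> _ _ _]]]]]; rewrite !size_cat. Qed.

(* Reversing and barring exchanges f_i and e_i. *)
Definition star w : word n := rev (map (@lbar n) w).

Lemma lbarK a : lbar (lbar a) = a.
Proof. by case: a => a s; rewrite /lbar /= negbK. Qed.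

Lemma starK w : star (star w) = w.
Proof. by rewrite /star map_rev revK -map_comp map_id_in // => a _ /=; exact: lbarK. Qed.

Lemma star_cat u v : star (u ++ v) = star v ++ star u.
Proof. by rewrite /star map_cat rev_cat. Qed.

Lemma arrow_lbar i a b : arrow i (lbar b) (lbar a) = arrow i a b.
Proof. 
rewrite /arrow !isUE !isBE /= /lv /=; case: (a.2) (b.2) => [] [] /=; lia.
Qed.

Lemma fL_lbar i a b : fL i (lbar b) = Some (lbar a) <-> fL i a = Some b.
Proof. by rewrite !fLE arrow_lbar. Qed.

Lemma phiL_lbar i a : phiL i (lbar a) = epsL i a.
Proof.
rewrite /phiL /epsL; case E: (eL i a) => [b|].
  by move/fL_eL/fL_lbar: E => ->.
case F: (fL i (lbar a)) => [c|] //.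
by move: F; rewrite -[c]lbarK fL_lbar fL_eL E.
Qed.

Lemma epsL_lbar i a : epsL i (lbar a) = phiL i a.
Proof. by rewrite -phiL_lbar lbarK. Qed.

Lemma star_cons a w : star (a :: w) = star w ++ [:: lbar a].
Proof. by rewrite /star /= rev_cons cats1. Qed.

Lemma epsW_star i w : epsW i (star w) = phiW i w /\ phiW i (star w) = epsW i w.
Proof.
elim: w => [//|a w [IH1 IH2]].
rewrite star_cons epsW_cat phiW_cat IH1 IH2 /= phiL_lbar epsL_lbar; lia.
Qed.

Lemma fW_star i w w' : fW i (star w') = Some (star w) <-> fW i w = Some w'.
Proof.
have aux : forall w w', fW i w = Some w' -> fW i (star w') = Some (star w).
  move=> {}w {}w'; rewrite !fW_pivot => -[u [x [y [v [-> -> e pu ev]]]]].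
  exists (star v), (lbar y), (lbar x), (star u).
  rewrite !star_cat !star_cons -!catA; split=> //; first by rewrite fL_lbar.
    by have [_ ->] := epsW_star i v.
  by have [-> _] := epsW_star i u.
split; last exact: aux.
by move/aux; rewrite !starK.
Qed.

(* The diagram automorphism: it exchanges n and \bar n, and the colors n-1 and n. *)
Definition swL a : letter n := if lv a == n then lbar a else a.
Definition swc i := if i == n then n.-1 else if i == n.-1 then n else i.
Definition sw w : word n := map swL w.

Lemma swLK a : swL (swL a) = a.
Proof.
rewrite /swL; case h: (lv a == n); last by rewrite h.
by have -> : lv (lbar a) = lv a by []; rewrite h lbarK.
Qed.

Lemma swK w : sw (sw w) = w.
Proof. by rewrite /sw -map_comp map_id_in // => a _ /=; exact: swLK. Qed.

Lemma sw_cat u v : sw (u ++ v) = sw u ++ sw v.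
Proof. exact: map_cat. Qed.

Hypothesis hn : 1 < n.

Lemma swcK i : swc (swc i) = i.
Proof.
rewrite /swc; have h : (n.-1 == n) = false by lia.
by case h1: (i == n); [rewrite h eqxx; lia | case h2: (i == n.-1); rewrite ?eqxx ?h1 ?h2 ?h //; lia].
Qed.

Lemma swc_color i : color n (swc i) = color n i.
Proof. by rewrite /swc /color; case h1: (i == n); [|case h2: (i == n.-1) => //]; lia. Qed.

Lemma lv_swL a : lv (swL a) = lv a.
Proof. by rewrite /swL; case: ifP. Qed.

Lemma sg_swL a : (swL a).2 = (lv a == n) (+) a.2.
Proof. by rewrite /swL; case: ifP. Qed.

Lemma arrow_sw i a b : arrow (swc i) (swL a) (swL b) = arrow i a b.
Proof.
rewrite /arrow !isUE !isBE !sg_swL !lv_swL /swc.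
have := lv_bounds a; have := lv_bounds b.
case: (a.2) (b.2) => [] [] /=; repeat case: ifP => ?; lia.
Qed.

Lemma fL_sw i a b : fL (swc i) (swL a) = Some (swL b) <-> fL i a = Some b.
Proof. by rewrite !fLE arrow_sw. Qed.

Lemma phiL_sw i a : phiL (swc i) (swL a) = phiL i a.
Proof.
rewrite /phiL; case E: (fL i a) => [b|].
  by move/fL_sw: E => ->.
case F: (fL (swc i) (swL a)) => [c|] //.
by move: F; rewrite -[c]swLK fL_sw E.
Qed.

Lemma epsL_sw i a : epsL (swc i) (swL a) = epsL i a.
Proof.
rewrite -!phiL_lbar -[RHS]phiL_sw; congr phiL.
by rewrite /swL; have -> : lv (lbar a) = lv a by []; case: ifP.
Qed.

Lemma epsW_sw i w : epsW (swc i) (sw w) = epsW i w.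
Proof. by elim: w => [//|a w IH] /=; rewrite IH phiL_sw epsL_sw. Qed.

Lemma phiW_sw i w : phiW (swc i) (sw w) = phiW i w.
Proof. by elim: w => [//|a w IH] /=; rewrite IH phiL_sw epsW_sw. Qed.

Lemma fW_sw i w w' : fW (swc i) (sw w) = Some (sw w') <-> fW i w = Some w'.
Proof.
have aux : forall i w w', fW i w = Some w' -> fW (swc i) (sw w) = Some (sw w').
  move=> {}i {}w {}w'; rewrite !fW_pivot => -[u [x [y [v [-> -> e pu ev]]]]].
  exists (sw u), (swL x), (swL y), (sw v).
  by rewrite !sw_cat; split=> //; rewrite ?fL_sw ?phiW_sw ?epsW_sw.
split; last exact: aux.
by move/aux; rewrite !swK swcK.
Qed.

End Basics.

(** * The relations (R1)-(R4) *)

Section Rank.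
Variable n : nat.
Implicit Types (a b : letter n) (x y u v w : word n) (i : nat).

Lemma congD_ctx u v x y : congD x y -> congD (u ++ x ++ v) (u ++ y ++ v).
Proof.
elim=> {x y} [u1 v1 x y xy|w|w1 w2 _ IH|w1 w2 w3 _ IH1 _ IH2].
- by rewrite -!catA !(catA u); apply: congD_base.
- exact: congD_refl.
- exact: congD_sym.
- exact: congD_trans IH1 IH2.
Qed.

Lemma congD_catl u x y : congD x y -> congD (u ++ x) (u ++ y).
Proof. by move=> /(congD_ctx u [::]); rewrite !cats0. Qed.

Lemma congD_catr v x y : congD x y -> congD (x ++ v) (y ++ v).
Proof. exact: (congD_ctx [::]). Qed.

Lemma congD_elem x y : elemD x y -> congD x y.
Proof. by move=> /(congD_base [::] [::]); rewrite !cats0. Qed.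

Lemma rk_bounds a : 0 < rk a <= 2 * n.
Proof. by rewrite /rk; have := lv_bounds a; case: (a.2); lia. Qed.

Lemma rk_inj : injective (@rk n).
Proof.
move=> a b; rewrite /rk; have := lv_bounds a; have := lv_bounds b.
move=> ha hb e; apply: letter_eq; move: e; case: (a.2) (b.2) => [] []; lia.
Qed.

Lemma rk_eq a b : (a == b) = (rk a == rk b).
Proof. by rewrite (inj_eq rk_inj). Qed.

Lemma rk_lbar a : rk (lbar a) = (2 * n).+1 - rk a.
Proof. by rewrite /rk /=; have := lv_bounds a; rewrite /lv /=; case: (a.2) => /=; lia. Qed.

Lemma rk_exists r : 0 < r <= 2 * n -> exists a, rk a = r.
Proof.
move=> hr; case: (leqP r n) => h.
  have [|a [la sa]] := @letter_exists n r false; first by lia.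
  by exists a; rewrite /rk sa la.
have [|a [la sa]] := @letter_exists n ((2 * n).+1 - r) true; first by lia.
by exists a; rewrite /rk sa la; lia.
Qed.

Lemma isU_rk k a : k <= n -> isU k a = (rk a == k).
Proof. by rewrite isUE /rk; have := lv_bounds a; case: (a.2); lia. Qed.

Lemma isB_rk k a : k <= n -> isB k a = (rk a == (2 * n).+1 - k).
Proof. by rewrite isBE /rk; have := lv_bounds a; case: (a.2); lia. Qed.

Definition ltR r s := (r < s) && ~~ ((r == n) && (s == n.+1)).
Definition leR r s := (r <= s) && ~~ ((r == n) && (s == n.+1)).

Lemma ltD_rk a b : ltD a b = ltR (rk a) (rk b).
Proof.
rewrite /ltD /ltR /incomp /rk.
have := lv_bounds a; have := lv_bounds b; case: (a.2) (b.2) => [] [] /=; lia.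
Qed.

Lemma leD_rk a b : leD a b = leR (rk a) (rk b).
Proof. by rewrite /leD ltD_rk rk_eq /ltR /leR; lia. Qed.

Lemma neg_rk a : ~~ a.2 = (rk a <= n).
Proof. by rewrite /rk; have := lv_bounds a; case: (a.2) => /=; lia. Qed.

Lemma lv_rk a : lv a = if rk a <= n then rk a else (2 * n).+1 - rk a.
Proof. by rewrite -neg_rk /rk; have := lv_bounds a; case: (a.2) => /=; lia. Qed.

Lemma arrow_rk i a b : 0 < i < n ->
  arrow i a b = (rk b == (rk a).+1) && ((rk a == i) || (rk a == 2 * n - i)).
Proof.
move=> hi; rewrite /arrow !isUE !isBE /rk.
have := lv_bounds a; have := lv_bounds b; case: (a.2) (b.2) => [] []; lia.
Qed.

Lemma lv_unbar a : rk a <= n -> lv a = rk a.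
Proof. by rewrite lv_rk => ->. Qed.

(** For a color i < n the ranks fall into two sources, two targets and three intervals that the
    color ignores. One case analysis replaces [fL], [phiL] and [epsL] simultaneously and leaves
    linear conditions on the rank. *)
Variant color_spec i a : option (letter n) -> nat -> nat -> Prop :=
| ColorF1 a' of rk a' = i.+1 & rk a = i : color_spec i a (Some a') 1 0
| ColorF2 a' of rk a' = (2 * n - i).+1 & rk a = 2 * n - i : color_spec i a (Some a') 1 0
| ColorE1 of rk a = i.+1 : color_spec i a None 0 1
| ColorE2 of rk a = (2 * n - i).+1 : color_spec i a None 0 1
| ColorN1 of rk a < i : color_spec i a None 0 0
| ColorN2 of i.+1 < rk a < 2 * n - i : color_spec i a None 0 0
| ColorN3 of (2 * n - i).+1 < rk a : color_spec i a None 0 0.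

Lemma colorP i a : 0 < i < n -> color_spec i a (fL i a) (phiL i a) (epsL i a).
Proof.
move=> hi; have ha := rk_bounds a.
case E: (fL i a) => [b|].
  rewrite (fL_phi1 E) (fL_eps0 E); move: E.
  rewrite fLE arrow_rk // => /andP[/eqP eb /orP[]] /eqP ea.
    by apply: ColorF1; lia.
  by apply: ColorF2; lia.
have -> : phiL i a = 0 by rewrite /phiL E.
have h1 : ~~ ((rk a == i) || (rk a == 2 * n - i)).
  apply/negP => h; have [|b eb] := @rk_exists (rk a).+1; first by lia.
  have : arrow i a b by rewrite arrow_rk // eb eqxx.
  by rewrite -fLE E.
rewrite /epsL; case F: (eL i a) => [b|] /=.
  move: F; rewrite eLE arrow_rk // => /andP[/eqP ea /orP[]] /eqP eb.
    by apply: ColorE1; lia.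
  by apply: ColorE2; lia.
have h2 : ~~ ((rk a == i.+1) || (rk a == (2 * n - i).+1)).
  apply/negP => h; have [|b eb] := @rk_exists (rk a).-1; first by lia.
  have : arrow i b a by rewrite arrow_rk // eb; lia.
  by rewrite -eLE F.
case: (ltnP (rk a) i) => h3; first exact: ColorN1.
case: (ltnP (rk a) (2 * n - i)) => h4; first by apply: ColorN2; lia.
by apply: ColorN3; lia.
Qed.

End Rank.

Section RelRank.
Variable n : nat.
Hypothesis hn : 1 < n.
Local Notation N := (2 * n).+1.
Local Notation rk := (@rk n).

(* The relations on ranks, where the bar is r |-> 2n+1-r and n, \bar n have
   ranks n, n+1. *)
Definition r1a (x1 x2 x3 y1 y2 y3 : nat) :=
  [&& y1 == x1, y2 == x3, y3 == x2, leR n x3 x1, ltR n x1 x2 & x3 + x2 != N].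
Definition r1b (x1 x2 x3 y1 y2 y3 : nat) :=
  [&& y1 == x2, y2 == x1, y3 == x3, ltR n x1 x3, leR n x3 x2 & x1 + x2 != N].
Definition r2a (x1 x2 x3 y1 y2 y3 : nat) :=
  [&& y1 == x1, 1 < y2, y2 < n, y3 == N - y2, x3 == y2.-1, x2 == N - y2.-1,
      leR n y2 x1 & leR n x1 y3].
Definition r2b (x1 x2 x3 y1 y2 y3 : nat) :=
  [&& y3 == x3, 1 < x1, x1 < n, x2 == N - x1, y2 == x1.-1, y1 == N - x1.-1,
      leR n x1 x3 & leR n x3 x2].
Definition r3a (x1 x2 x3 y1 y2 y3 : nat) :=
  [&& x1 == n.+1, n.+1 < x2, x3 == n, y1 == x2, y2 == x1 & y3 == x3].
Definition r3b (x1 x2 x3 y1 y2 y3 : nat) :=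
  [&& x1 == n, n.+1 < x2, x3 == n.+1, y1 == x2, y2 == x1 & y3 == x3].
Definition r3c (x1 x2 x3 y1 y2 y3 : nat) :=
  [&& x1 == n.+1, x2 == n, x3 < n, y1 == x1, y2 == x3 & y3 == x2].
Definition r3d (x1 x2 x3 y1 y2 y3 : nat) :=
  [&& x1 == n, x2 == n.+1, x3 < n, y1 == x1, y2 == x3 & y3 == x2].
Definition r4a (x1 x2 x3 y1 y2 y3 : nat) :=
  [&& x1 == n, x2 == n.+1, x3 == n.+1, y1 == n.+2, y2 == n.-1 & y3 == n.+1].
Definition r4b (x1 x2 x3 y1 y2 y3 : nat) :=
  [&& x1 == n.+1, x2 == n, x3 == n, y1 == n.+2, y2 == n.-1 & y3 == n].
Definition r4c (x1 x2 x3 y1 y2 y3 : nat) :=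
  [&& x1 == n.+1, x2 == n.+2, x3 == n.-1, y1 == n.+1, y2 == n.+1 & y3 == n].
Definition r4d (x1 x2 x3 y1 y2 y3 : nat) :=
  [&& x1 == n, x2 == n.+2, x3 == n.-1, y1 == n, y2 == n & y3 == n.+1].

Definition rel3 (x1 x2 x3 y1 y2 y3 : nat) : bool :=
  [|| r1a x1 x2 x3 y1 y2 y3, r1b x1 x2 x3 y1 y2 y3,
      r2a x1 x2 x3 y1 y2 y3, r2b x1 x2 x3 y1 y2 y3,
      r3a x1 x2 x3 y1 y2 y3, r3b x1 x2 x3 y1 y2 y3,
      r3c x1 x2 x3 y1 y2 y3, r3d x1 x2 x3 y1 y2 y3,
      r4a x1 x2 x3 y1 y2 y3, r4b x1 x2 x3 y1 y2 y3,
      r4c x1 x2 x3 y1 y2 y3 | r4d x1 x2 x3 y1 y2 y3].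

Definition R14 (x y : word n) := R1 x y \/ R2 x y \/ R3 x y \/ R4 x y.

Lemma rel3_R14 (x1 x2 x3 y1 y2 y3 : letter n) :
  rel3 (rk x1) (rk x2) (rk x3) (rk y1) (rk y2) (rk y3) ->
  R14 [:: x1; x2; x3] [:: y1; y2; y3].
Proof.
have b1 := rk_bounds x1; have b2 := rk_bounds x2; have b3 := rk_bounds x3.
have c1 := rk_bounds y1; have c2 := rk_bounds y2; have c3 := rk_bounds y3.
rewrite /rel3 => /orP[|].
  case/and5P => /eqP/rk_inj -> /eqP/rk_inj -> /eqP/rk_inj -> h1 /andP[h2 h3].
  left; exists x3, x1, x2; left; split=> //.
  by rewrite leD_rk ltD_rk h1 h2 rk_eq rk_lbar; lia.
case/orP.
  case/and5P => /eqP/rk_inj -> /eqP/rk_inj -> /eqP/rk_inj -> h1 /andP[h2 h3].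
  left; exists x1, x3, x2; right; split=> //.
  by rewrite leD_rk ltD_rk h1 h2 rk_eq rk_lbar; lia.
case/orP.
  case/and5P => /eqP/rk_inj -> h1 h2 /eqP h3 /and4P[/eqP h4 /eqP h5 h6 h7].
  have -> : y3 = lbar y2 by apply: rk_inj; rewrite rk_lbar.
  right; left; exists y2, x1, x2, x3; split; last by left.
  have e : lv y2 = rk y2 by apply: lv_unbar; lia.
  by rewrite neg_rk e !leD_rk rk_lbar -h3 h6 h7 isU_rk ?isB_rk; lia.
case/orP.
  case/and5P => /eqP/rk_inj -> h1 h2 /eqP h3 /and4P[/eqP h4 /eqP h5 h6 h7].
  have -> : x2 = lbar x1 by apply: rk_inj; rewrite rk_lbar.
  right; left; exists x1, x3, y1, y2; split; last by right.
  have e : lv x1 = rk x1 by apply: lv_unbar; lia.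
  by rewrite neg_rk e !leD_rk rk_lbar -h3 h6 h7 isU_rk ?isB_rk; lia.
move=> H.
have key : r3a (rk x1) (rk x2) (rk x3) (rk y1) (rk y2) (rk y3) ||
  r3b (rk x1) (rk x2) (rk x3) (rk y1) (rk y2) (rk y3) ||
  r3c (rk x1) (rk x2) (rk x3) (rk y1) (rk y2) (rk y3) ||
  r3d (rk x1) (rk x2) (rk x3) (rk y1) (rk y2) (rk y3) ||
  (r4a (rk x1) (rk x2) (rk x3) (rk y1) (rk y2) (rk y3) ||
  r4b (rk x1) (rk x2) (rk x3) (rk y1) (rk y2) (rk y3) ||
  r4c (rk x1) (rk x2) (rk x3) (rk y1) (rk y2) (rk y3) ||
  r4d (rk x1) (rk x2) (rk x3) (rk y1) (rk y2) (rk y3)) by move: H; rewrite !orbA.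
move: key {H} => /orP[H|H].
  have H3 : forall c a b, rk c < n -> rk a = n -> rk b = n.+1 ->
    [&& ~~ c.2, lv c <= n.-1, isU n a & isB n b].
    by move=> c a b hc ha hb; have := rk_bounds c; rewrite neg_rk isU_rk // isB_rk // lv_unbar; lia.
  right; right; left; move: H; rewrite -!orbA => /or4P[] /and5P[/eqP h1 h2 h3 /eqP h4 /andP[/eqP h5 /eqP h6]].
  - exists (lbar x2), x3, x1; split; first by apply: H3; rewrite ?rk_lbar; lia.
    by left; rewrite lbarK (rk_inj h4) (rk_inj h5) (rk_inj h6).
  - exists (lbar x2), x1, x3; split; first by apply: H3; rewrite ?rk_lbar; lia.
    by right; left; rewrite lbarK (rk_inj h4) (rk_inj h5) (rk_inj h6).
  - exists x3, x2, x1; split; first by apply: H3; lia.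
    by right; right; left; rewrite (rk_inj h4) (rk_inj h5) (rk_inj h6).
  - exists x3, x1, x2; split; first by apply: H3; lia.
    by right; right; right; rewrite (rk_inj h4) (rk_inj h5) (rk_inj h6).
have H4 : forall a b c d, rk a = n -> rk b = n.+1 -> rk c = n.+2 -> rk d = n.-1 ->
    [&& isU n a, isB n b, isB n.-1 c & isU n.-1 d].
  by move=> a b c d ha hb hc hd; rewrite !isU_rk ?isB_rk; lia.
right; right; right; move: H; rewrite -!orbA => /or4P[] /and5P[/eqP h1 /eqP h2 /eqP h3 /eqP h4 /andP[/eqP h5 /eqP h6]].
- exists x1, x2, y1, y2; split; first exact: H4.
  have -> : x3 = x2 by apply: rk_inj; lia. 
  have -> : y3 = x2 by apply: rk_inj; lia.
  by left.
- exists x2, x1, y1, y2; split; first exact: H4.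
  have -> : x3 = x2 by apply: rk_inj; lia. 
  have -> : y3 = x2 by apply: rk_inj; lia.
  by right; left.
- exists y3, x1, x2, x3; split; first exact: H4.
  have -> : y1 = x1 by apply: rk_inj; lia. 
  have -> : y2 = x1 by apply: rk_inj; lia.
  by right; right; left.
- exists x1, y3, x2, x3; split; first exact: H4.
  have -> : y1 = x1 by apply: rk_inj; lia. 
  have -> : y2 = x1 by apply: rk_inj; lia.
  by right; right; right.
Qed.

Lemma R14_rel3 (x y : word n) : R14 x y ->
  exists x1 x2 x3 y1 y2 y3, [/\ x = [:: x1; x2; x3], y = [:: y1; y2; y3] &
  rel3 (rk x1) (rk x2) (rk x3) (rk y1) (rk y2) (rk y3)].
Proof.
case=> [[a [b [c]]]|[]].
- case=> [] [H [-> ->]]; (do 6 eexists); split; try reflexivity;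
  move: H; rewrite leD_rk ltD_rk rk_eq rk_lbar => /and3P[h1 h2 h3];
  have b1 := rk_bounds a; have b2 := rk_bounds c;
  rewrite /rel3 /r1a /r1b h1 h2 !eqxx /=; (have -> : rk a + rk c != N by lia);
  by rewrite ?orbT.
- move=> [a [b [p [q [H]]]]].
  have b1 := rk_bounds a; have b2 := rk_bounds b.
  have e : lv a = rk a by case/andP: H; rewrite neg_rk => /lv_unbar.
  move: H; rewrite e neg_rk !leD_rk rk_lbar => /and5P[h1 h2 h3 h4 /and3P[h5 h6 h7]].
  rewrite isB_rk in h6; last by lia. 
  rewrite isU_rk in h7; last by lia.
  by case=> [] [-> ->]; (do 6 eexists); split; try reflexivity;
    rewrite /rel3 /r2a /r2b rk_lbar h2 h3 h4 h5 h6 h7 !eqxx /= ?orbT.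
- case=> [[c [a [b []]]]|[a [b [c [d []]]]]].
    rewrite isU_rk // isB_rk // neg_rk => /and4P[h0]; rewrite lv_unbar // => h1 h2 h3.
    have b1 := rk_bounds c.
    case=> [[-> ->]|[[-> ->]|[[-> ->]|[-> ->]]]]; (do 6 eexists); split; try reflexivity;
      rewrite /rel3 ?rk_lbar.
    - by rewrite (_ : r3a _ _ _ _ _ _) ?orbT // /r3a; lia.
    - by rewrite (_ : r3b _ _ _ _ _ _) ?orbT // /r3b; lia.
    - by rewrite (_ : r3c _ _ _ _ _ _) ?orbT // /r3c; lia.
    - by rewrite (_ : r3d _ _ _ _ _ _) ?orbT // /r3d; lia.
  rewrite !isU_rk ?isB_rk; try by lia.
  move=> H.
  case=> [[-> ->]|[[-> ->]|[[-> ->]|[-> ->]]]]; (do 6 eexists); split; try reflexivity;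
    rewrite /rel3.
  - by rewrite (_ : r4a _ _ _ _ _ _) ?orbT // /r4a; lia.
  - by rewrite (_ : r4b _ _ _ _ _ _) ?orbT // /r4b; lia.
  - by rewrite (_ : r4c _ _ _ _ _ _) ?orbT // /r4c; lia.
  - by rewrite (_ : r4d _ _ _ _ _ _) ?orbT // /r4d; lia.
Qed.

End RelRank.

(** * Compatibility of (R1)-(R4) with f_i for i < n *)

Section Rel3.
Variable n : nat.
Hypothesis hn : 1 < n.
Variable i : nat.
Hypothesis hi : 0 < i < n.
Local Notation rk := (@rk n).

Definition rel3_compat (x y : word n) :=
  [/\ epsW i x = epsW i y, phiW i x = phiW i y &
   forall x' y', fW i x = Some x' -> fW i y = Some y' -> congD x' y'].

Lemma rel3_cong (x1 x2 x3 y1 y2 y3 : letter n) :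
  rel3 n (rk x1) (rk x2) (rk x3) (rk y1) (rk y2) (rk y3) ->
  congD [:: x1; x2; x3] [:: y1; y2; y3].
Proof.
move=> /(rel3_R14 hn) h; apply: congD_elem; rewrite /elemD.
by move: h; rewrite /R14 => -[|[|[|]]]; auto.
Qed.

Ltac leaf := 
  let H := fresh in
  split; [by [] | by [] | 
    move=> x' y' /=; repeat (case: ifP => // _); move=> -[<-] -[<-]].

Let r1a_cong x1 x2 x3 y1 y2 y3 : r1a n (rk x1) (rk x2) (rk x3) (rk y1) (rk y2) (rk y3) ->
  congD [:: x1; x2; x3] [:: y1; y2; y3].
Proof. by move=> h; apply: rel3_cong; rewrite /rel3 h ?orbT. Qed.
Let r1b_cong x1 x2 x3 y1 y2 y3 : r1b n (rk x1) (rk x2) (rk x3) (rk y1) (rk y2) (rk y3) ->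
  congD [:: x1; x2; x3] [:: y1; y2; y3].
Proof. by move=> h; apply: rel3_cong; rewrite /rel3 h ?orbT. Qed.
Let r2a_cong x1 x2 x3 y1 y2 y3 : r2a n (rk x1) (rk x2) (rk x3) (rk y1) (rk y2) (rk y3) ->
  congD [:: x1; x2; x3] [:: y1; y2; y3].
Proof. by move=> h; apply: rel3_cong; rewrite /rel3 h ?orbT. Qed.
Let r2b_cong x1 x2 x3 y1 y2 y3 : r2b n (rk x1) (rk x2) (rk x3) (rk y1) (rk y2) (rk y3) ->
  congD [:: x1; x2; x3] [:: y1; y2; y3].
Proof. by move=> h; apply: rel3_cong; rewrite /rel3 h ?orbT. Qed.
Let r3a_cong x1 x2 x3 y1 y2 y3 : r3a n (rk x1) (rk x2) (rk x3) (rk y1) (rk y2) (rk y3) ->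
  congD [:: x1; x2; x3] [:: y1; y2; y3].
Proof. by move=> h; apply: rel3_cong; rewrite /rel3 h ?orbT. Qed.
Let r3b_cong x1 x2 x3 y1 y2 y3 : r3b n (rk x1) (rk x2) (rk x3) (rk y1) (rk y2) (rk y3) ->
  congD [:: x1; x2; x3] [:: y1; y2; y3].
Proof. by move=> h; apply: rel3_cong; rewrite /rel3 h ?orbT. Qed.
Let r3c_cong x1 x2 x3 y1 y2 y3 : r3c n (rk x1) (rk x2) (rk x3) (rk y1) (rk y2) (rk y3) ->
  congD [:: x1; x2; x3] [:: y1; y2; y3].
Proof. by move=> h; apply: rel3_cong; rewrite /rel3 h ?orbT. Qed.
Let r3d_cong x1 x2 x3 y1 y2 y3 : r3d n (rk x1) (rk x2) (rk x3) (rk y1) (rk y2) (rk y3) ->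
  congD [:: x1; x2; x3] [:: y1; y2; y3].
Proof. by move=> h; apply: rel3_cong; rewrite /rel3 h ?orbT. Qed.
Let r4a_cong x1 x2 x3 y1 y2 y3 : r4a n (rk x1) (rk x2) (rk x3) (rk y1) (rk y2) (rk y3) ->
  congD [:: x1; x2; x3] [:: y1; y2; y3].
Proof. by move=> h; apply: rel3_cong; rewrite /rel3 h ?orbT. Qed.
Let r4b_cong x1 x2 x3 y1 y2 y3 : r4b n (rk x1) (rk x2) (rk x3) (rk y1) (rk y2) (rk y3) ->
  congD [:: x1; x2; x3] [:: y1; y2; y3].
Proof. by move=> h; apply: rel3_cong; rewrite /rel3 h ?orbT. Qed.
Let r4d_cong x1 x2 x3 y1 y2 y3 : r4d n (rk x1) (rk x2) (rk x3) (rk y1) (rk y2) (rk y3) ->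
  congD [:: x1; x2; x3] [:: y1; y2; y3].
Proof. by move=> h; apply: rel3_cong; rewrite /rel3 h ?orbT. Qed.

Ltac rel_lia l := apply: l;
  rewrite /r1a /r1b /r2a /r2b /r3a /r3b /r3c /r3d /r4a /r4b /r4c /r4d /leR /ltR;
  (repeat (apply/andP; split)); lia.
Ltac split3 x1 x2 x3 :=
  rewrite /rel3_compat /=;
  have b1 := rk_bounds x1; have b2 := rk_bounds x2; have b3 := rk_bounds x3;
  case: (colorP x1 hi) => [a1 e1 c1|a1 e1 c1|c1|c1|c1|c1|c1]; try lia;
  case: (colorP x2 hi) => [a2 e2 c2|a2 e2 c2|c2|c2|c2|c2|c2]; try lia;
  case: (colorP x3 hi) => [a3 e3 c3|a3 e3 c3|c3|c3|c3|c3|c3]; try lia; (try by []); leaf.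
Ltac split5 x1 x2 x3 x4 x5 :=
  rewrite /rel3_compat /=;
  have b1 := rk_bounds x1; have b2 := rk_bounds x2; have b3 := rk_bounds x3;
  have b4 := rk_bounds x4; have b5 := rk_bounds x5;
  case: (colorP x1 hi) => [a1 e1 c1|a1 e1 c1|c1|c1|c1|c1|c1]; try lia;
  case: (colorP x2 hi) => [a2 e2 c2|a2 e2 c2|c2|c2|c2|c2|c2]; try lia;
  case: (colorP x3 hi) => [a3 e3 c3|a3 e3 c3|c3|c3|c3|c3|c3]; try lia;
  case: (colorP x4 hi) => [a4 e4 c4|a4 e4 c4|c4|c4|c4|c4|c4]; try lia;
  case: (colorP x5 hi) => [a5 e5 c5|a5 e5 c5|c5|c5|c5|c5|c5]; try lia; (try by []); leaf.
Ltac split4 x1 x2 x3 x4 :=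
  rewrite /rel3_compat /=;
  have b1 := rk_bounds x1; have b2 := rk_bounds x2; have b3 := rk_bounds x3;
  have b4 := rk_bounds x4; 
  case: (colorP x1 hi) => [a1 e1 c1|a1 e1 c1|c1|c1|c1|c1|c1]; try lia;
  case: (colorP x2 hi) => [a2 e2 c2|a2 e2 c2|c2|c2|c2|c2|c2]; try lia;
  case: (colorP x3 hi) => [a3 e3 c3|a3 e3 c3|c3|c3|c3|c3|c3]; try lia;
  case: (colorP x4 hi) => [a4 e4 c4|a4 e4 c4|c4|c4|c4|c4|c4]; try lia; (try by []); leaf.

(** If f_i hits different letters on the two sides, the form of (R1) may change: i (i+1) i and i i
    (i+1) become i (i+1) (i+1) and (i+1) i (i+1). An image leaves (R1) when it creates the excluded
    pair z = \bar x, which gives (R2), or the incomparable pair n, \bar n, which gives (R3). The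
    color i = n-1, whose arrows touch n and \bar n, is treated apart. *)
Lemma r1a_compat (x1 x2 x3 y1 y2 y3 : letter n) :
  r1a n (rk x1) (rk x2) (rk x3) (rk y1) (rk y2) (rk y3) ->
  rel3_compat [:: x1; x2; x3] [:: y1; y2; y3].
Proof.
rewrite /r1a /leR /ltR; have [En|En] := eqVneq i.+1 n; [|have {}En : i.+1 < n by lia].
all: case/and5P => /eqP/rk_inj -> /eqP/rk_inj -> /eqP/rk_inj -> /andP[h1 h1'] /andP[/andP[h2 h2'] h3].
all: split3 x1 x2 x3.
all: first [rel_lia r1a_cong | rel_lia r1b_cong | rel_lia r2a_cong | rel_lia r3d_cong | exfalso; lia].
Qed.

(** Here (R4) appears too: for i = n-1 the words (n-1) \bar n \bar n and \bar n (n-1) \bar n go to n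
    \bar n \bar n and \overline{n-1} (n-1) \bar n. *)
Lemma r1b_compat (x1 x2 x3 y1 y2 y3 : letter n) :
  r1b n (rk x1) (rk x2) (rk x3) (rk y1) (rk y2) (rk y3) ->
  rel3_compat [:: x1; x2; x3] [:: y1; y2; y3].
Proof.
rewrite /r1b /leR /ltR; have [En|En] := eqVneq i.+1 n; [|have {}En : i.+1 < n by lia].
all: case/and5P => /eqP/rk_inj -> /eqP/rk_inj -> /eqP/rk_inj -> /andP[h1 h1'] /andP[/andP[h2 h2'] h3].
all: split3 x1 x2 x3.
all: first [rel_lia r1b_cong | rel_lia r2b_cong | rel_lia r3b_cong | rel_lia r4a_cong | exfalso; lia].
Qed.

Lemma r2a_compat (x1 x2 x3 y1 y2 y3 : letter n) :
  r2a n (rk x1) (rk x2) (rk x3) (rk y1) (rk y2) (rk y3) ->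
  rel3_compat [:: x1; x2; x3] [:: y1; y2; y3].
Proof.
rewrite /r2a /leR /ltR; have [En|En] := eqVneq i.+1 n; [|have {}En : i.+1 < n by lia].
all: case/andP => /eqP/rk_inj -> /and5P[h1 h2 /eqP h3 /eqP h4 /and3P[/eqP h5 h6 h7]].
all: split5 y2 y3 x3 x2 x1.
all: first [rel_lia r1a_cong | rel_lia r2a_cong | exfalso; lia].
Qed.

Lemma r2b_compat (x1 x2 x3 y1 y2 y3 : letter n) :
  r2b n (rk x1) (rk x2) (rk x3) (rk y1) (rk y2) (rk y3) ->
  rel3_compat [:: x1; x2; x3] [:: y1; y2; y3].
Proof.
rewrite /r2b /leR /ltR; have [En|En] := eqVneq i.+1 n; [|have {}En : i.+1 < n by lia].
all: case/andP => /eqP/rk_inj -> /and5P[h1 h2 /eqP h3 /eqP h4 /and3P[/eqP h5 h6 h7]].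
all: split5 x1 x2 y2 y1 x3.
all: first [rel_lia r1b_cong | rel_lia r2b_cong | exfalso; lia].
Qed.

Lemma r3a_compat (x1 x2 x3 y1 y2 y3 : letter n) :
  r3a n (rk x1) (rk x2) (rk x3) (rk y1) (rk y2) (rk y3) ->
  rel3_compat [:: x1; x2; x3] [:: y1; y2; y3].
Proof.
rewrite /r3a /leR /ltR; have [En|En] := eqVneq i.+1 n; [|have {}En : i.+1 < n by lia].
all: case/and5P => h1 h2 h3 /eqP/rk_inj -> /andP[/eqP/rk_inj -> /eqP/rk_inj ->].
all: split3 x1 x2 x3.
all: first [rel_lia r3a_cong | exfalso; lia].
Qed.

Lemma r3b_compat (x1 x2 x3 y1 y2 y3 : letter n) :
  r3b n (rk x1) (rk x2) (rk x3) (rk y1) (rk y2) (rk y3) ->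
  rel3_compat [:: x1; x2; x3] [:: y1; y2; y3].
Proof.
rewrite /r3b /leR /ltR; have [En|En] := eqVneq i.+1 n; [|have {}En : i.+1 < n by lia].
all: case/and5P => h1 h2 h3 /eqP/rk_inj -> /andP[/eqP/rk_inj -> /eqP/rk_inj ->].
all: split3 x1 x2 x3.
all: first [rel_lia r1b_cong | rel_lia r3b_cong | exfalso; lia].
Qed.

Lemma r3c_compat (x1 x2 x3 y1 y2 y3 : letter n) :
  r3c n (rk x1) (rk x2) (rk x3) (rk y1) (rk y2) (rk y3) ->
  rel3_compat [:: x1; x2; x3] [:: y1; y2; y3].
Proof.
rewrite /r3c /leR /ltR; have [En|En] := eqVneq i.+1 n; [|have {}En : i.+1 < n by lia].
all: case/and5P => h1 h2 h3 /eqP/rk_inj -> /andP[/eqP/rk_inj -> /eqP/rk_inj ->].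
all: split3 x1 x2 x3.
all: first [rel_lia r3c_cong | rel_lia r4b_cong | exfalso; lia].
Qed.

Lemma r3d_compat (x1 x2 x3 y1 y2 y3 : letter n) :
  r3d n (rk x1) (rk x2) (rk x3) (rk y1) (rk y2) (rk y3) ->
  rel3_compat [:: x1; x2; x3] [:: y1; y2; y3].
Proof.
rewrite /r3d /leR /ltR; have [En|En] := eqVneq i.+1 n; [|have {}En : i.+1 < n by lia].
all: case/and5P => h1 h2 h3 /eqP/rk_inj -> /andP[/eqP/rk_inj -> /eqP/rk_inj ->].
all: split3 x1 x2 x3.
all: first [rel_lia r1a_cong | rel_lia r3d_cong | rel_lia r4d_cong | exfalso; lia].
Qed.

Lemma r4a_compat (x1 x2 x3 y1 y2 y3 : letter n) :
  r4a n (rk x1) (rk x2) (rk x3) (rk y1) (rk y2) (rk y3) ->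
  rel3_compat [:: x1; x2; x3] [:: y1; y2; y3].
Proof.
rewrite /r4a /leR /ltR; have [En|En] := eqVneq i.+1 n; [|have {}En : i.+1 < n by lia].
all: move=> h; have -> : x3 = x2 by apply: rk_inj; lia.
all: have -> : y3 = x2 by apply: rk_inj; lia.
all: move: h => /and5P[h1 h2 h3 h4 h5].
all: split4 x1 x2 y1 y2.
all: first [rel_lia r3b_cong | exfalso; lia].
Qed.

(** No f_i with i < n is defined on either side, as every phi is cancelled: for i = n-1 that of \bar
    n or of n-1 by the n after it, for i = n-2 that of \overline{n-1} by the n-1 after it. *)
Lemma r4b_compat (x1 x2 x3 y1 y2 y3 : letter n) :
  r4b n (rk x1) (rk x2) (rk x3) (rk y1) (rk y2) (rk y3) ->
  rel3_compat [:: x1; x2; x3] [:: y1; y2; y3].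
Proof.
rewrite /r4b /leR /ltR; have [En|En] := eqVneq i.+1 n; [|have {}En : i.+1 < n by lia].
all: move=> h; have -> : x3 = x2 by apply: rk_inj; lia.
all: have -> : y3 = x2 by apply: rk_inj; lia.
all: move: h => /and5P[h1 h2 h3 h4 h5].
all: split4 x1 x2 y1 y2.
all: first [exfalso; lia].
Qed.

Lemma r4c_compat (x1 x2 x3 y1 y2 y3 : letter n) :
  r4c n (rk x1) (rk x2) (rk x3) (rk y1) (rk y2) (rk y3) ->
  rel3_compat [:: x1; x2; x3] [:: y1; y2; y3].
Proof.
rewrite /r4c /leR /ltR; have [En|En] := eqVneq i.+1 n; [|have {}En : i.+1 < n by lia].
all: move=> h; have -> : y1 = x1 by apply: rk_inj; lia.
all: have -> : y2 = x1 by apply: rk_inj; lia.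
all: move: h => /and5P[h1 h2 h3 h4 h5].
all: split4 x1 x2 x3 y3.
all: first [rel_lia r3a_cong | exfalso; lia].
Qed.

Lemma r4d_compat (x1 x2 x3 y1 y2 y3 : letter n) :
  r4d n (rk x1) (rk x2) (rk x3) (rk y1) (rk y2) (rk y3) ->
  rel3_compat [:: x1; x2; x3] [:: y1; y2; y3].
Proof.
rewrite /r4d /leR /ltR; have [En|En] := eqVneq i.+1 n; [|have {}En : i.+1 < n by lia].
all: move=> h; have -> : y1 = x1 by apply: rk_inj; lia.
all: have -> : y2 = x1 by apply: rk_inj; lia.
all: move: h => /and5P[h1 h2 h3 h4 h5].
all: split4 x1 x2 x3 y3.
all: first [rel_lia r1a_cong | exfalso; lia].
Qed.

Lemma R14_compat (x y : word n) : R14 x y -> rel3_compat x y.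
Proof.
move=> /(R14_rel3 hn)[x1 [x2 [x3 [y1 [y2 [y3 [-> -> ]]]]]]].
rewrite /rel3.
case/orP => [|]; first exact: r1a_compat.
case/orP => [|]; first exact: r1b_compat.
case/orP => [|]; first exact: r2a_compat.
case/orP => [|]; first exact: r2b_compat.
case/orP => [|]; first exact: r3a_compat.
case/orP => [|]; first exact: r3b_compat.
case/orP => [|]; first exact: r3c_compat.
case/orP => [|]; first exact: r3d_compat.
case/orP => [|]; first exact: r4a_compat.
case/orP => [|]; first exact: r4b_compat.
case/orP => [|]; first exact: r4c_compat.
exact: r4d_compat.
Qed.
End Rel3.

(** * Columns and the relation (R5) *)

Section Columns.
Variable n : nat.
Hypothesis hn : 1 < n.
Implicit Types (a b z : letter n) (x y u v w t : word n) (i m : nat).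
Local Notation rk := (@rk n).

Lemma lv_rkP a : (rk a <= n /\ lv a = rk a) \/ (n < rk a /\ lv a = (2 * n).+1 - rk a).
Proof. by rewrite lv_rk; case: leqP; [left|right]. Qed.

(* On ranks: x_{i+1} is not below x_i; [colR_weak] is its transitive closure. *)
Definition colR r s := (r < s) || ((r == n.+1) && (s == n)).
Definition colR_weak r s := (r < s) || [&& n <= r, r <= n.+1, n <= s & s <= n.+1].

Lemma is_col_rk w : is_col w = sorted colR (map rk w).
Proof.
rewrite /is_col sorted_map; apply: eq_sorted => a b /=.
rewrite leD_rk /leR /colR; lia.
Qed.

(** [colR] is not transitive, since n and \bar n may alternate in a column; only its closure
    [colR_weak] holds between letters at a distance. *)
Lemma col_split u a t : is_col (u ++ a :: t) ->
  (forall b, b \in u -> colR_weak (rk b) (rk a)) /\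
  (forall b, b \in t -> colR_weak (rk a) (rk b)).
Proof.
rewrite is_col_rk => h.
have {h} : sorted colR_weak (map rk (u ++ a :: t)).
  by apply: sub_sorted h => r s; rewrite /colR /colR_weak; lia.
rewrite sorted_pairwise; last by move=> r s k; rewrite /colR_weak; lia.
rewrite map_cat pairwise_cat => /and3P[h1 _ /= /andP[h2 _]]; split=> b hb.
  by move/allrelP: h1; apply; rewrite ?map_f //= inE eqxx.
by move/allP: h2; apply; rewrite map_f.
Qed.

Lemma col_infix u v t : is_col (u ++ v ++ t) -> is_col v.
Proof. by rewrite /is_col => /cat_sorted2[_ /cat_sorted2[]]. Qed.

(** N as a function of an integer, defined also at levels absent from the word, which allows
    induction on the level; see [NN_lvcount]. *)
Definition lvcount m w := count (fun a => lv a <= m) w.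

Lemma lvcount_cat m u v : lvcount m (u ++ v) = lvcount m u + lvcount m v.
Proof. exact: count_cat. Qed.

Lemma lvcount_cons m a w : lvcount m (a :: w) = (lv a <= m) + lvcount m w.
Proof. by []. Qed.

Lemma lvcount_n m w : n <= m -> lvcount m w = size w.
Proof.
move=> hm; apply/eqP; rewrite -all_count; apply/allP => a _.
have := lv_bounds a; lia.
Qed.

Lemma lvcountS m w : lvcount m.+1 w = lvcount m w + count (fun a => lv a == m.+1) w.
Proof. by clear hn; rewrite /lvcount; elim: w => //= a w ->; have := ltngtP (lv a) m.+1; case=> h; lia. Qed.

Lemma lvcount0 w : lvcount 0 w = 0.
Proof. by rewrite /lvcount; elim: w => //= a w ->; have := lv_bounds a; lia. Qed.

Lemma mem_split (T : eqType) (a : T) s : a \in s -> exists s1 s2, s = s1 ++ a :: s2.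
Proof. by case/splitPr => s1 s2; exists s1, s2. Qed.

(** Below level n the letters of a column do not repeat, so two letters of the same level would be a
    letter and its bar. *)
Lemma count_lv_le1 w m : is_col w -> 0 < m < n ->
  (forall a, lv a = m -> ~~ ((a \in w) && (lbar a \in w))) ->
  count (fun a => lv a == m) w <= 1.
Proof.
move=> hw hm h; case E: (has (fun a => lv a == m) w); last by rewrite has_count in E; lia.
case/hasP: E => a /mem_split[u [t ew]] /eqP ea.
have [h1 h2] : (forall b, b \in u -> colR_weak (rk b) (rk a)) /\
  (forall b, b \in t -> colR_weak (rk a) (rk b)) by apply: col_split; rewrite -ew.
have ha : lbar a \notin w.
  by move: (h a ea); rewrite ew mem_cat inE eqxx orbT.
have aux : forall s, {subset s <= w} -> (a \notin s) -> count (fun a => lv a == m) s = 0.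
  move=> s sub nas; apply/eqP; rewrite -leqn0 leqNgt -has_count; apply/hasPn => b hb.
  apply/eqP => eb; case E: (a.2 == b.2).
    by case/negP: nas; rewrite (letter_eq _ (eqP E)) ?ea ?eb.
  case/negP: ha; rewrite (_ : lbar a = b) ?sub //.
  by apply: letter_eq; [rewrite eb -ea|move: E => /=; case: (a.2) (b.2) => [] []].
rewrite ew count_cat /= aux ?aux; first by case: eqP.
- by move=> b hb; rewrite ew mem_cat inE hb !orbT.
- by apply/negP => /h2; rewrite /colR_weak; have := lv_rkP a; lia.
- by move=> b hb; rewrite ew mem_cat hb.
- by apply/negP => /h1; rewrite /colR_weak; have := lv_rkP a; lia.
Qed.

Lemma lv_lbar a : lv (lbar a) = lv a. Proof. by []. Qed.

Lemma lvcount_all m w : (forall a, a \in w -> lv a <= m) -> lvcount m w = size w.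
Proof. by move=> h; apply/eqP; rewrite -all_count; apply/allP. Qed.

Lemma lvcount_none m w : (forall a, a \in w -> m < lv a) -> lvcount m w = 0.
Proof.
move=> h; apply/eqP; rewrite -leqn0 leqNgt -has_count; apply/hasPn => b /h.
by rewrite ltnNge.
Qed.

(* In a column the pair condition on z, \bar z at distance |q-p| says exactly N(z) <= z. *)
Lemma col_pair_count u v t a : is_col (u ++ a :: v ++ lbar a :: t) -> lv a < n ->
  [/\ rk a = lv a, forall b, b \in v -> lv a < lv b,
      (forall b, b \in u ++ t -> lv b < lv a) &
      lvcount (lv a) (u ++ a :: v ++ lbar a :: t) = size u + size t + 2].
Proof.
move=> hw la.
have [h1 h2] := col_split hw.
have [h3 h4] : (forall b, b \in u ++ a :: v -> colR_weak (rk b) (rk (lbar a))) /\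
  (forall b, b \in t -> colR_weak (rk (lbar a)) (rk b)).
  by apply: col_split; rewrite -catA.
have ra : rk a = lv a.
  have := h2 (lbar a); rewrite mem_cat inE eqxx orbT => /(_ isT).
  rewrite /colR_weak rk_lbar; have := lv_rkP a; have := rk_bounds a; lia.
have hv : forall b, b \in v -> lv a < lv b.
  move=> b hb; have := h2 b; rewrite mem_cat hb => /(_ isT).
  have := h3 b; rewrite mem_cat inE hb !orbT => /(_ isT).
  rewrite /colR_weak rk_lbar; have := lv_rkP b; have := rk_bounds a; lia.
have hut : forall b, b \in u ++ t -> lv b < lv a.
  move=> b; rewrite mem_cat => /orP[/h1|/h4];
  rewrite /colR_weak ?rk_lbar; have := lv_rkP b; have := rk_bounds a; have := rk_bounds b; lia.
split=> //.
rewrite !(lvcount_cat, lvcount_cons) (lvcount_none hv) lv_lbar leqnn.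
rewrite (@lvcount_all _ u) ?(@lvcount_all _ t); first by lia.
  by move=> b hb; apply: ltnW; apply: hut; rewrite mem_cat hb orbT.
by move=> b hb; apply: ltnW; apply: hut; rewrite mem_cat hb.
Qed.

Lemma col_pair_ex w a : is_col w -> lv a < n -> rk a = lv a -> a \in w -> lbar a \in w ->
  exists u v t, w = u ++ a :: v ++ lbar a :: t.
Proof.
move=> hw la ra /mem_split[u [s ew]]; rewrite ew mem_cat inE.
have [h1 h2] : (forall b, b \in u -> colR_weak (rk b) (rk a)) /\
  (forall b, b \in s -> colR_weak (rk a) (rk b)) by apply: col_split; rewrite -ew.
case/or3P => [/h1|/eqP e|/mem_split[v [t es]]].
- by rewrite /colR_weak rk_lbar; have := rk_bounds a; lia.
- by have := congr1 snd e => /=; case: (a.2).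
- by exists u, v, t; rewrite es.
Qed.

(** By induction on m. Level m+1 contributes at most one letter unless it carries a pair, and for a
    pair the distance condition is N(m+1) <= m+1 by [col_pair_count]; at m = n the bound is the one
    on the height. *)
Lemma admissibleP w : is_col w -> (admissible w <-> forall m, m <= n -> lvcount m w <= m).
Proof.
move=> hw; split.
  move=> [sz adm]; elim=> [|m IH] hm; first by rewrite lvcount0.
  case: (eqVneq m.+1 n) => [en|hne]; first by rewrite lvcount_n en.
  have {}IH : lvcount m w <= m by apply: IH; lia.
  case E: (has (fun a => [&& lv a == m.+1, rk a <= n, a \in w & lbar a \in w]) w).
    case/hasP: E => a _ /and4P[/eqP la ra aw baw].
    have rla : rk a = lv a by have := lv_rkP a; lia.
    have [|u [v [t ew]]] := col_pair_ex hw _ rla aw baw; first by lia.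
    have [||_ _ _] := @col_pair_count u v t a; [by rewrite -ew| by lia|].
    rewrite -ew la => ->; have := adm u v t a ew; rewrite la ew !size_cat /= size_cat /=; lia.
  rewrite lvcountS; suff : count (fun a => lv a == m.+1) w <= 1 by lia.
  apply: count_lv_le1 => // [|a la]; first by lia.
  apply/negP => /andP[aw baw]; move/negP: E; apply.
  case: (leqP (rk a) n) => ra.
    by apply/hasP; exists a => //; rewrite la eqxx ra aw baw.
  apply/hasP; exists (lbar a) => //.
  by rewrite lv_lbar la eqxx lbarK aw baw rk_lbar andbT; lia.
move=> h; split; first by have := h n (leqnn n); rewrite lvcount_n.
move=> u v t a ew; have := h n (leqnn n); rewrite lvcount_n // => sz.
have la := lv_bounds a.
case: (ltnP (lv a) n) => lan; last by lia.
have [||_ _ _] := @col_pair_count u v t a; [by rewrite -ew| by lia|].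
have := h (lv a); rewrite -ew => h1 h2; have {h1}: size u + size t + 2 <= lv a.
  by rewrite -h2; apply: h1; lia.
by rewrite ew !size_cat /= size_cat /=; lia.
Qed.

Lemma NN_lvcount z w : ~~ z.2 -> NN z w = lvcount (lv z) w.
Proof.
move=> hz; apply: eq_count => a; rewrite !leD_rk /leR rk_lbar.
move: hz; rewrite neg_rk => hz.
have := rk_bounds a; have := lv_rkP a; have := lv_rkP z; have := rk_bounds z; lia.
Qed.

(* The relation (R5), see [R5_contracts] and [contracts_R5]; for z = n the pair
   n, \bar n may occur in either order, so z may be barred. *)
Definition contracts x y := exists u v t z,
  [/\ x = u ++ z :: v ++ lbar z :: t /\ y = u ++ v ++ t, is_col x,
      forall m, lvcount m x <= m + (lv z <= m),
      lvcount (lv z) x = (lv z).+1 &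
      lv z = n -> v = [::]].

Lemma lvcount_infix m u v t : lvcount m v <= lvcount m (u ++ v ++ t).
Proof. by rewrite !lvcount_cat; lia. Qed.

Lemma filter_lv u v t z : is_col (u ++ z :: v ++ lbar z :: t) -> lv z < n ->
  filter (fun a => lv a != lv z) (u ++ z :: v ++ lbar z :: t) = u ++ v ++ t.
Proof.
move=> hw lz; have [_ hv hut _] := col_pair_count hw lz.
rewrite filter_cat /= eqxx /= filter_cat /= lv_lbar eqxx /=.
have idf : forall s, (forall a, a \in s -> lv a != lv z) -> [seq a <- s | lv a != lv z] = s.
  by move=> s hs; apply/all_filterP/allP.
rewrite !idf //.
- by move=> a ha; have := hut a; rewrite mem_cat ha orbT => /(_ isT); lia.
- by move=> a /hv; lia.
- by move=> a ha; have := hut a; rewrite mem_cat ha => /(_ isT); lia.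
Qed.

Lemma R5_contracts x y : R5 x y -> contracts x y.
Proof.
move=> [hx [nadm [hprop [z [hz [zmin hy]]]]]].
have [hz2 zx bzx hN] := and4P hz.
rewrite (NN_lvcount _ hz2) in hN.
have rz : rk z = lv z by have := lv_rkP z; move: hz2; rewrite neg_rk; lia.
have lz := lv_bounds z.
(* Without its first letter the column is admissible, and one letter adds at most 1 to N(m). *)
have le1 m : lvcount m x <= m.+1.
  suff H : forall m, m <= n -> lvcount m x <= m.+1.
    case: (leqP m n) => hm; first exact: H.
    by have := H n (leqnn n); rewrite !lvcount_n; lia.
  case: x hx nadm hprop hz zmin hy zx bzx hN => [//|a x] hx _ hprop _ _ _ _ _ _ {}m hm.
  have hx' : is_col x by move: hx; rewrite -[a :: x]cat1s -[x]cats0 => /col_infix; rewrite cats0.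
  have /(admissibleP hx') /(_ m hm) : admissible x.
    apply: hprop; last by apply/eqP => e; have := congr1 size e => /=; lia.
    by apply/infixP; exists [:: a], [::]; rewrite cats0.
  by rewrite /lvcount /=; lia.
(* Were the bound to fail first at m+1, this level would hold two letters, hence a pair with N(m+1)
   > m+1, against the minimality of [z]. *)
have lt m : m < lv z -> lvcount m x <= m.
  elim: m => [|m IH] hm; first by rewrite lvcount0.
  have {}IH : lvcount m x <= m by apply: IH; lia.
  rewrite leqNgt; apply/negP => hgt.
  move: (hgt); rewrite lvcountS ltnNge => /negP; apply.
  suff : count (fun a => lv a == m.+1) x <= 1 by lia.
  apply: count_lv_le1 => // [|a la]; first by lia.
  apply/negP => /andP[ax bax].
  have H b : lv b = m.+1 -> ~~ b.2 -> b \in x -> lbar b \in x -> False.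
    move=> lb hb bx bbx; have : Pz x b by rewrite /Pz hb bx bbx NN_lvcount // lb.
    by move=> /zmin; rewrite lb; move: hm; case: (lv z) => // ?; rewrite ltnS => h1 h2; have := leq_trans h2 h1; rewrite ltnn.
  case hs: (a.2); last by apply: (H a) => //; rewrite hs.
  by apply: (H (lbar a)); rewrite ?lbarK //= hs.
case: hy => [[lzn ->]|[lzn [u [v [a [b [hab [ex ->]]]]]]]].
  have [u [v [t ex]]] := col_pair_ex hx lzn rz zx bzx.
  exists u, v, t, z; rewrite {2}ex filter_lv // -?ex //; split=> //.
  - move=> m; case: (leqP (lv z) m) => h; first by have := le1 m; lia.
    by rewrite addn0; apply: lt.
  - by have := le1 (lv z); lia.
  - by lia.
have [la lb ab] := and3P hab; move/eqP: la => la; move/eqP: lb => lb.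
have eb : b = lbar a.
  by apply: letter_eq; rewrite ?lv_lbar ?la ?lb //=; case: (a.2) (b.2) ab => [] [].
have e : lv a = lv z by rewrite la lzn.
exists u, [::], v, a; rewrite e /= -eb; split=> //.
- move=> m; case: (leqP (lv z) m) => h; first by have := le1 m; lia.
  by rewrite addn0; apply: lt.
- by have := le1 (lv z); lia.
Qed.

Lemma contracts_R5 x y : contracts x y -> R5 x y.
Proof.
move=> [u [v [t [z [[ex ey] hx hb hN hv]]]]].
have lz := lv_bounds z.
split=> //; split; first by move/(admissibleP hx)/(_ (lv z)); lia.
have hz0 : exists z', [/\ lv z' = lv z, ~~ z'.2, z' \in x & lbar z' \in x].
  case hs: (z.2); [exists (lbar z)|exists z]; rewrite ?lbarK ?lv_lbar /= hs;
    by split; rewrite // ex ?(mem_cat, inE) eqxx ?orbT.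
have rkz : lv z < n -> rk z = lv z.
  by move=> h; have [] := @col_pair_count u v t z; rewrite -?ex.
split.
  move=> w /infixP[p [s exw]] hne.
  have hw : is_col w by apply: (@col_infix p w s); rewrite -exw.
  apply/(admissibleP hw) => m hm.
  have := hb m; case: (leqP (lv z) m) => h; last first.
    by rewrite addn0; apply: leq_trans; rewrite exw lvcount_infix.
  suff : 0 < lvcount m p + lvcount m s by rewrite {1}exw !lvcount_cat; lia.
  (* A proper factor omits the first or the last letter of the column. Both have level at most that
     of [z], so from this level on N loses the one unit by which it may exceed the bound. *)
  have low b : b \in x -> colR_weak (rk b) (rk z) || (b == z) || colR_weak (rk (lbar z)) (rk b)
       || (b == lbar z) -> lv b <= m.
    move=> _ hbz; apply: leq_trans h; case: (ltnP (lv z) n) => lzn; last first.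
      by have := lv_bounds b; lia.
    move: hbz; rewrite /colR_weak !rk_eq rk_lbar (rkz lzn).
    by have := lv_rkP b; have := rk_bounds b; lia.
  case: p s exw => [|b p] s exw.
    case: (lastP s) exw => [|{}s b] exw; first by rewrite exw cats0 eqxx in hne.
    rewrite -cats1 !lvcount_cat /lvcount /=; suff -> : lv b <= m by lia.
    have bx : b \in x by rewrite exw /= mem_cat mem_rcons inE eqxx orbT.
    apply: low => //.
    have : b \in lbar z :: t.
      have <- : last z x = b by rewrite exw /= last_cat last_rcons.
      by rewrite ex last_cat /= last_cat /= mem_last.
    rewrite inE => /orP[->|bt]; first by rewrite !orbT.
    have [_ /(_ b bt) -> ] : (forall b, b \in u ++ z :: v -> colR_weak (rk b) (rk (lbar z))) /\
      (forall b, b \in t -> colR_weak (rk (lbar z)) (rk b)).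
      by apply: col_split; rewrite -catA /= -ex.
    by rewrite !orbT.
  rewrite /lvcount /=; suff -> : lv b <= m by lia.
  have bx : b \in x by rewrite exw inE eqxx.
  apply: low => //.
  have : b = head z x by rewrite exw.
  move: hx; rewrite ex; case: (u) => [|b' u'] /= hx ->; first by rewrite eqxx !orbT.
  have [h1 _] := @col_split (b' :: u') _ _ hx.
  by rewrite (h1 b') // inE eqxx.
have [z' [ez nz zx bzx]] := hz0.
exists z'; split; first by rewrite /Pz nz zx bzx NN_lvcount // ez hN /= ltnSn.
split.
  move=> b /and4P[nb _ _]; rewrite (NN_lvcount x nb) ez => hgt.
  by have := hb (lv b); lia.
rewrite ez; case: (ltnP (lv z) n) => lzn; [left|right]; split=> //.
- by rewrite ey ex filter_lv // -ex.
- by lia.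
- exists u, t, z, (lbar z); have lzn' : lv z = n by lia.
  rewrite ex ey (hv lzn') /incomp lv_lbar lzn' eqxx /=; split=> //.
  by case: (z.2).
Qed.

End Columns.

(** * Compatibility of (R5) with f_i for i < n *)

Section ColumnCrystal.
Variable n : nat.
Hypothesis hn : 1 < n.
Variable i : nat.
Hypothesis hi : 0 < i < n.
Implicit Types (a b c z : letter n) (x y u v w t : word n) (m : nat).
Local Notation rk := (@rk n).

Lemma phiL_rk a : phiL i a = (rk a == i) || (rk a == 2 * n - i).
Proof. by case: (colorP a hi) => *; lia. Qed.

Lemma epsL_rk a : epsL i a = (rk a == i.+1) || (rk a == (2 * n - i).+1).
Proof. by case: (colorP a hi) => *; lia. Qed.

Lemma fL_rk a b : fL i a = Some b -> rk b = (rk a).+1 /\ (rk a = i \/ rk a = 2 * n - i).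
Proof. rewrite fLE arrow_rk //; lia. Qed.

Lemma epsW_mem w : 0 < epsW i w -> exists2 c, c \in w & epsL i c = 1.
Proof.
elim: w => [//|a w IH] /=; have := epsL_le1 i a; case: (posnP (epsL i a)) => ea la h.
  by case: IH => [|c cw ec]; [lia | exists c; rewrite // inE cw orbT].
by exists a; rewrite ?inE ?eqxx //; lia.
Qed.

Lemma phiW_mem w : 0 < phiW i w -> exists2 c, c \in w & phiL i c = 1.
Proof.
elim: w => [//|a w IH] /=; have := phiL_le1 i a; case: (posnP (phiL i a)) => ea la h.
  by case: IH => [|c cw ec]; [lia | exists c; rewrite // inE cw orbT].
by exists a; rewrite ?inE ?eqxx //; lia.
Qed.

Definition inert a := (phiL i a == 0) && (epsL i a == 0).

Lemma inert_lv a : inert a = (lv a != i) && (lv a != i.+1).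
Proof.
rewrite /inert phiL_rk epsL_rk; have := lv_rkP a; have := rk_bounds a.
lia.
Qed.

Lemma inert_eps w : all inert w -> epsW i w = 0 /\ phiW i w = 0.
Proof. by elim: w => //= a w IH /andP[/andP[/eqP-> /eqP->] /IH[-> ->]]. Qed.

Lemma inert_cons a w : inert a ->
  [/\ epsW i (a :: w) = epsW i w, phiW i (a :: w) = phiW i w &
      fW i (a :: w) = omap (cons a) (fW i w)].
Proof. by move=> /andP[/eqP pa /eqP ea] /=; rewrite pa ea ltn0; split=> //; lia. Qed.

(** The rank of the pivot grows by 1, so the column condition can fail only against the next letter.
    That letter would be a target of color i, which the vanishing epsilon_i of the suffix
    excludes. *)
Lemma col_fW w w' : is_col w -> fW i w = Some w' -> is_col w'.
Proof.
move=> hw /fW_pivot[u [a [b [v [ew -> fab pu ev]]]]].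
have [rb ra] := fL_rk fab.
move: hw; rewrite ew !(is_col_rk hn) !map_cat /= !sorted_cat_cons => /andP[hu hv].
apply/andP; split.
  case: (map rk u) hu => //= l s; rewrite !rcons_path => /andP[-> /=]; rewrite /colR; lia.
case: v {ew} ev hv => [//|c v] /= ec /andP[hac ->]; rewrite andbT.
move: hac; have : epsL i c = 0 by lia.
rewrite epsL_rk /colR; have := rk_bounds c; lia.
Qed.

Lemma lvcount_f w w' : fW i w = Some w' ->
  (forall m, m != i -> lvcount m w' = lvcount m w) /\
  exists u a b v, [/\ w = u ++ a :: v, w' = u ++ b :: v, phiW i u = 0, epsW i v = 0 &
    (rk a = i /\ lvcount i w = (lvcount i w').+1) \/
    (rk a = 2 * n - i /\ lvcount i w' = (lvcount i w).+1)].
Proof.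
move=> /fW_pivot[u [a [b [v [-> -> fab pu ev]]]]].
have [rb ra] := fL_rk fab; have := lv_rkP a; have := lv_rkP b.
have := rk_bounds a => ba lb la.
split=> [m hm|]; first by rewrite !lvcount_cat !lvcount_cons; lia.
exists u, a, b, v; split=> //; rewrite !lvcount_cat !lvcount_cons.
case: ra => ra; [left|right]; lia.
Qed.

Lemma lvcount_f_no_next w w' : fW i w = Some w' ->
  count (fun a => lv a == i.+1) w = 0 -> lvcount i w' <= lvcount i w.
Proof.
move=> /lvcount_f[_ [u [a [b [v [-> _ _ _]]]]]]; rewrite count_cat /=.
have := lv_rkP a; have := rk_bounds a; lia.
Qed.

(* If f_i turned \bar{i+1} into \bar i, a letter of level i in the column would
   have cancelled or preceded it. *)
Lemma lvcount_f_le w w' : is_col w -> fW i w = Some w' ->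
  count (fun a => lv a == i.+1) w <= 1 -> 0 < count (fun a => lv a == i) w ->
  lvcount i w' <= lvcount i w.
Proof.
move=> hw /lvcount_f[_ [u [a [b [v [ew _ pu ev [[_ h]|[ra _]]]]]]]]; first by lia.
have [h1 h2] : (forall b, b \in u -> colR_weak n (rk b) (rk a)) /\
  (forall b, b \in v -> colR_weak n (rk a) (rk b)) by apply: (col_split hn); rewrite -ew.
rewrite ew !count_cat /= => c1; have la := lv_rkP a; have ba := rk_bounds a.
have {c1} [cu cv] : count (fun a => lv a == i.+1) u = 0 /\ count (fun a => lv a == i.+1) v = 0 by lia.
have no s c : count (fun a => lv a == i.+1) s = 0 -> c \in s -> lv c != i.+1.
  by move=> cs cin; apply/negP => ec; move: cs; apply/eqP; rewrite -lt0n -has_count; apply/hasP; exists c.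
rewrite addn_gt0 => /orP[|]; last first.
  case: eqP => [|_]; first by lia.
  rewrite add0n -has_count => /hasP[c /mem_split[v1 [v2 ev12]] lc].
  have rc : rk c = (2 * n - i).+1.
    have := h2 c; rewrite ev12 mem_cat inE eqxx orbT => /(_ isT).
    by rewrite /colR_weak; have := lv_rkP c; have := rk_bounds c; lia.
  have : epsL i c = 1 by rewrite epsL_rk rc eqxx orbT.
  move: ev; rewrite ev12 epsW_cat /= => ev ec.
  have [|d dv1] := @phiW_mem v1; first by lia.
  have dv : d \in v by rewrite ev12 mem_cat dv1.
  have := no v d cv dv; have := h2 d dv; rewrite phiL_rk /colR_weak.
  by have := lv_rkP d; have := rk_bounds d; lia.
rewrite -has_count => /hasP[c /mem_split[u1 [u2 eu12]] lc].
have rc : rk c = i.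
  have := h1 c; rewrite eu12 mem_cat inE eqxx orbT => /(_ isT).
  by rewrite /colR_weak; have := lv_rkP c; have := rk_bounds c; lia.
have : phiL i c = 1 by rewrite phiL_rk rc eqxx.
move: pu; rewrite eu12 phiW_cat /= => pu ec.
have [|d du2] := @epsW_mem u2; first by lia.
have du : d \in u by rewrite eu12 mem_cat inE du2 !orbT.
have := no u d cu du; have := h1 d du; rewrite epsL_rk /colR_weak.
by have := lv_rkP d; have := rk_bounds d; lia.
Qed.

Definition contracts_ok x y :=
  [/\ epsW i x = epsW i y, phiW i x = phiW i y &
      forall x' y', fW i x = Some x' -> fW i y = Some y' -> contracts x' y'].

Lemma contracts_ok0 x y : epsW i x = epsW i y -> phiW i x = 0 -> phiW i y = 0 -> contracts_ok x y.
Proof. by move=> e px py; split=> [//||x' y']; rewrite ?px ?py //; move/fW_None: px => ->. Qed.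

(** The pair is invisible to the color i, so f_i acts at the same place of both words; what has to
    be checked is that N(i) keeps its bound. *)
Lemma contracts_far u v t z :
  lv z != i -> lv z != i.+1 -> let x := u ++ z :: v ++ lbar z :: t in
  is_col x -> (forall m, lvcount m x <= m + (lv z <= m)) -> lvcount (lv z) x = (lv z).+1 ->
  (lv z = n -> v = [::]) -> contracts_ok x (u ++ v ++ t).
Proof.
move=> z1 z2 x hx hb hN hv.
have iz : inert z by rewrite inert_lv z1 z2.
have ibz : inert (lbar z) by rewrite inert_lv lv_lbar z1 z2.
have [e1 p1 f1] := inert_cons (v ++ lbar z :: t) iz.
have [e2 p2 f2] := inert_cons t ibz.
have ee : epsW i (z :: v ++ lbar z :: t) = epsW i (v ++ t).
  by rewrite e1 !epsW_cat e2.
have pp : phiW i (z :: v ++ lbar z :: t) = phiW i (v ++ t).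
  by rewrite p1 !phiW_cat e2 p2.
split; [by rewrite /x !(epsW_cat _ u) ee| by rewrite /x !(phiW_cat _ u) ee pp|].
move=> x' y' fx fy.
have hx' := col_fW hx fx.
have [hm _] := lvcount_f fx.
(* N(i) can only break a bound that it had attained. Then the bounds at i-1 and i+1, which carry the
   same correction because [z] has neither level i nor i+1, force a letter of level i and at most
   one of level i+1. *)
have hi' : lvcount i x' <= i + (lv z <= i).
  have h0 := hb i; have h1 := hb i.-1; have h2 := hb i.+1.
  have := lvcountS i.-1 x; rewrite prednK; last by lia. 
  have := lvcountS i x => c2 c1.
  case: (ltnP (lvcount i x) (i + (lv z <= i))) => hlt.
    case/lvcount_f: fx => _ [? [? [? [? [_ _ _ _ ?]]]]]; lia.
  by apply: leq_trans h0; apply: lvcount_f_le => //; lia.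
suff : exists u' v' t', [/\ x' = u' ++ z :: v' ++ lbar z :: t, y' = u' ++ v' ++ t &
  v = [::] -> v' = [::]] \/ x' = u ++ z :: v ++ lbar z :: t' /\ y' = u ++ v ++ t'.
  move=> [u' [v' [t' H]]].
  have H1 : forall m, lvcount m x' <= m + (lv z <= m).
    by move=> m; case: (eqVneq m i) => [->//|/hm ->].
  have H2 : lvcount (lv z) x' = (lv z).+1 by rewrite hm // hN.
  case: H => [[e3 e4 hv']|[e3 e4]].
    by exists u', v', t, z; split=> // /hv.
  by exists u, v, t', z; split.
move: fx fy; rewrite /x !fW_cat ee; case: ifP => _.
  case: (fW i u) => // u' [<-] [<-]; exists u', v, t; left; split=> //.
rewrite f1 !fW_cat e2; case: ifP => _.
  case Ev: (fW i v) => [v'|] //= -[<-] [<-]; exists u, v', t; left; split=> // e.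
  by move: Ev; rewrite e.
rewrite f2; case: (fW i t) => // t' [<-] [<-]; exists u, v, t'; by right.
Qed.

Ltac crys := rewrite /= ?(epsW_cat, phiW_cat) /= ?(epsW_cat, phiW_cat) /=
  ?(epsW_cat, phiW_cat) /= ?(epsW_cat, phiW_cat) /=.

Lemma all_inert w : (forall a, a \in w -> lv a != i /\ lv a != i.+1) -> all inert w.
Proof. by move=> h; apply/allP => a /h[h1 h2]; rewrite inert_lv h1 h2. Qed.

Lemma count0_notin m w : count (fun a => lv a == m) w = 0 -> forall a, a \in w -> lv a != m.
Proof.
move=> c a aw; apply/negP => e; move: c; apply/eqP; rewrite -lt0n -has_count.
by apply/hasP; exists a.
Qed.

(** Between i and \bar i there is at most one letter of level i+1, and only \overline{i+1} leaves a
    phi uncancelled. It then stands just before \bar i; f_i turns i into i+1 in the long word and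
    \overline{i+1} into \bar i in the short one, and the contracted pair moves to level i+1. *)
Lemma contracts_at u v t z : lv z = i -> let x := u ++ z :: v ++ lbar z :: t in
  is_col x -> (forall m, lvcount m x <= m + (lv z <= m)) -> lvcount (lv z) x = (lv z).+1 ->
  contracts_ok x (u ++ v ++ t).
Proof.
move=> lz x hx hb hN; have zn : lv z < n by lia.
have [rz hv hut _] := col_pair_count hn hx zn; rewrite lz in rz hv hut hb hN.
have [hu ht] : all inert u /\ all inert t.
  by split; apply: all_inert => a ha; have := hut a; rewrite mem_cat ha ?orbT => /(_ isT); lia.
have [eu pu] := inert_eps hu; have [et pt] := inert_eps ht.
have rbz : rk (lbar z) = (2 * n - i).+1 by rewrite rk_lbar rz; lia.
have [pz ez] : phiL i z = 1 /\ epsL i z = 0 by rewrite phiL_rk epsL_rk rz; lia.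
have [pbz ebz] : phiL i (lbar z) = 0 /\ epsL i (lbar z) = 1.
  by rewrite phiL_rk epsL_rk rbz; lia.
have cx : count (fun a => lv a == i.+1) x <= 1.
  by have := hb i.+1; rewrite lvcountS hN; lia.
have cv : count (fun a => lv a == i.+1) v <= 1.
  by move: cx; rewrite /x count_cat /= count_cat /=; lia.
case: (posnP (count (fun a => lv a == i.+1) v)) => [/count0_notin cv0|].
  have iv : all inert v by apply: all_inert => a av; have := hv a av; have := cv0 a av; lia.
  have [ev pv] := inert_eps iv.
  by apply: contracts_ok0; rewrite /x; crys; rewrite ?(pz, ez, pbz, ebz, eu, pu, et, pt, ev, pv).
rewrite -has_count => /hasP[c /mem_split[v1 [v2 ev12]] /eqP lc].
rewrite ev12 count_cat /= lc eqxx in cv.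
have [/count0_notin c1 /count0_notin c2] : count (fun a => lv a == i.+1) v1 = 0 /\
   count (fun a => lv a == i.+1) v2 = 0 by lia.
have iv1 : all inert v1.
  by apply: all_inert => a av; have := hv a; rewrite ev12 mem_cat av => /(_ isT); have := c1 a av; lia.
have iv2 : all inert v2.
  by apply: all_inert => a av; have := hv a; rewrite ev12 mem_cat inE av !orbT => /(_ isT); have := c2 a av; lia.
have [e1 p1] := inert_eps iv1; have [e2 p2] := inert_eps iv2.
have := lv_rkP c; rewrite lc => -[[_ rc]|[_ rc]].
  have [pc ec] : phiL i c = 0 /\ epsL i c = 1 by rewrite phiL_rk epsL_rk -rc; lia.
  by apply: contracts_ok0; rewrite /x ev12; crys; rewrite ?(pz, ez, pbz, ebz, pc, ec, eu, pu, et, pt, e1, p1, e2, p2).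
have {}rc : rk c = 2 * n - i by have := rk_bounds c; lia.
have [pc ec] : phiL i c = 1 /\ epsL i c = 0 by rewrite phiL_rk epsL_rk rc; lia.
split; try (by rewrite /x ev12; crys; rewrite ?(pz, ez, pbz, ebz, pc, ec, eu, pu, et, pt, e1, p1, e2, p2)).
move=> x' y' fx fy.
have fz : fL i z = Some (lbar c).
  by rewrite fLE arrow_rk // rk_lbar rz rc eqxx; lia.
have fc : fL i c = Some (lbar z) by rewrite fLE arrow_rk // rbz rc !eqxx orbT.
have v20 : v2 = [::].
  case: v2 ev12 {cv c2 iv2 e2 p2} (c2) => [//|d v2] ev12 c2.
  have [_ /(_ d)] : (forall b, b \in u ++ z :: v1 -> colR_weak n (rk b) (rk c)) /\
    (forall b, b \in d :: v2 ++ lbar z :: t -> colR_weak n (rk c) (rk b)).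
    by apply: (col_split hn); move: hx; rewrite /x ev12 -?catA /= -?catA.
  rewrite inE eqxx => /(_ isT).
  have [/(_ d) + _] : (forall b, b \in u ++ z :: v -> colR_weak n (rk b) (rk (lbar z))) /\
    (forall b, b \in t -> colR_weak n (rk (lbar z)) (rk b)).
    by apply: (col_split hn); rewrite -catA.
  rewrite ev12 !(mem_cat, inE) eqxx !orbT => /(_ isT).
  by have := c2 d; rewrite inE eqxx => /(_ isT); have := lv_rkP d; rewrite /colR_weak; lia.
move: ev12 fx fy hx hb hN; rewrite {}v20 => ev12 fx fy hx hb hN.
have ex' : x' = u ++ lbar c :: v1 ++ c :: lbar z :: t.
  have : fW i x = Some (u ++ lbar c :: v1 ++ c :: lbar z :: t).
    apply/fW_pivot; exists u, z, (lbar c), (v ++ lbar z :: t); split=> //; rewrite ev12 -?catA //.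
    by rewrite !epsW_cat /= pbz ebz ec pc; lia.
  by rewrite fx => -[].
have ey' : y' = u ++ v1 ++ lbar z :: t.
  have : fW i (u ++ v ++ t) = Some (u ++ v1 ++ lbar z :: t).
    apply/fW_pivot; exists (u ++ v1), c, (lbar z), t; split; rewrite ?ev12 -?catA //.
    by rewrite phiW_cat; lia.
  by rewrite fy => -[].
have [hm _] := lvcount_f fx.
exists u, v1, (lbar z :: t), (lbar c); rewrite lbarK lv_lbar lc; split=> //.
- exact: col_fW fx.
- have N2 : lvcount i x' = i.
    have := hb i.+1; have : 0 < count (fun a => lv a == i.+1) x.
      by rewrite /x ev12 -has_count; apply/hasP; exists c; rewrite ?(mem_cat, inE) ?eqxx ?orbT ?lc.
    have := col_fW hx fx.
    have -> : lvcount i x' = lvcount i x - 1.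
      by rewrite ex' /x ev12 -catA /= !(lvcount_cat, lvcount_cons) !lv_lbar lc lz; lia.
    by rewrite hN; lia.
  move=> m; case: (eqVneq m i) => [->|hmi]; first by rewrite N2; lia.
  by rewrite hm //; have := hb m; lia.
- rewrite hm; last by lia.
  have := hb i.+1; rewrite lvcountS hN.
  have : 0 < count (fun a => lv a == i.+1) x.
    by rewrite /x ev12 -has_count; apply/hasP; exists c; rewrite ?(mem_cat, inE) ?eqxx ?orbT ?lc.
  by lia.
(* If i+1 = n, a letter between the members of the new pair would have level n too, and [v] contains
   only one letter of this level. *)
move=> eqn; case: v1 ev12 {cv c1 iv1 e1 p1 ex' ey'} (c1) => [//|d v1] ev12 c1.
have [_ /(_ d)] := col_split hn hx; rewrite ev12 inE eqxx => /(_ isT).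
have [/(_ d) + _] : (forall b, b \in u ++ z :: d :: v1 -> colR_weak n (rk b) (rk c)) /\
  (forall b, b \in lbar z :: t -> colR_weak n (rk c) (rk b)).
  by apply: (col_split hn); move: hx; rewrite /x ev12 -?catA /= -?catA.
rewrite !(mem_cat, inE) eqxx !orbT => /(_ isT).
by have := c1 d; rewrite inE eqxx => /(_ isT); have := lv_rkP d; rewrite /colR_weak; lia.
Qed.

(** As only the pair has level i+1, N(i) = i, while N(i-1) <= i-1; so level i occurs, as i at the
    end of [u] or \bar i at the start of [t]. If \bar i occurs, phi_i vanishes on both words.
    Otherwise f_i turns \overline{i+1} into \bar i in the long word and i into i+1 in the short one,
    and the contracted pair moves to level i. *)
Lemma contracts_next u v t z : lv z = i.+1 -> rk z = i.+1 ->
  let x := u ++ z :: v ++ lbar z :: t in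
  is_col x -> (forall m, lvcount m x <= m + (lv z <= m)) -> lvcount (lv z) x = (lv z).+1 ->
  count (fun a => lv a == i.+1) x <= 2 -> contracts_ok x (u ++ v ++ t).
Proof.
move=> lz rz x hx hb hN cx; rewrite lz in hb hN.
have rbz : rk (lbar z) = 2 * n - i by rewrite rk_lbar rz; lia.
have [h1 h2] := col_split hn hx.
have [h3 h4] : (forall b, b \in u ++ z :: v -> colR_weak n (rk b) (rk (lbar z))) /\
    (forall b, b \in t -> colR_weak n (rk (lbar z)) (rk b)).
  by apply: (col_split hn); rewrite -catA.
have [pz ez] : phiL i z = 0 /\ epsL i z = 1 by rewrite phiL_rk epsL_rk rz; lia.
have [pbz ebz] : phiL i (lbar z) = 1 /\ epsL i (lbar z) = 0.
  by rewrite phiL_rk epsL_rk rbz; lia.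
have [cu cv ct] : [/\ count (fun a => lv a == i.+1) u = 0, count (fun a => lv a == i.+1) v = 0
   & count (fun a => lv a == i.+1) t = 0].
  by move: cx; rewrite /x count_cat /= count_cat /= lv_lbar lz eqxx; split; lia.
have nu := count0_notin cu; have nv := count0_notin cv; have nt := count0_notin ct.
have hu c : c \in u -> rk c <= i.
  by move=> cin; have := h1 c cin; have := nu c cin; have := lv_rkP c; rewrite /colR_weak; lia.
have ht c : c \in t -> 2 * n - i < rk c.
  by move=> cin; have := h4 c cin; have := nt c cin; have := lv_rkP c; rewrite /colR_weak rbz; lia.
have iv : all inert v.
  apply: all_inert => c cin; have := nv c cin => ncv; split=> //.
  have := h2 c; have := h3 c; rewrite !(mem_cat, inE) cin !orbT => /(_ isT) + /(_ isT).
  by have := lv_rkP c; rewrite /colR_weak rbz; lia.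
have [ev pv] := inert_eps iv.
have uP : all inert u \/ exists u1 a, [/\ u = u1 ++ [:: a], rk a = i & all inert u1].
  case: (boolP (all inert u)) => [|/allPn[a au ia]]; [by left|right].
  have ra : rk a = i.
    by move: ia; rewrite inert_lv; have := hu a au; have := nu a au; have := lv_rkP a; have := rk_bounds a; lia.
  case/mem_split: au => u1 [u2 eu].
  have [h5 h6] : (forall b, b \in u1 -> colR_weak n (rk b) (rk a)) /\
    (forall b, b \in u2 ++ z :: v ++ lbar z :: t -> colR_weak n (rk a) (rk b)).
    by apply: (col_split hn); move: hx; rewrite /x eu -catA.
  exists u1, a; split=> //.
    case: u2 eu h6 => [//|d u2] eu /(_ d); rewrite inE eqxx => /(_ isT).
    by have := hu d; rewrite eu !(mem_cat, inE) eqxx !orbT => /(_ isT); rewrite /colR_weak; lia.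
  apply: all_inert => c cin; have := h5 c cin; have := lv_rkP c; rewrite /colR_weak.
  by have := rk_bounds c; lia.
have tP : all inert t \/ exists t1 a, [/\ t = a :: t1, rk a = (2 * n - i).+1 & all inert t1].
  case: (boolP (all inert t)) => [|/allPn[a au ia]]; [by left|right].
  have ra : rk a = (2 * n - i).+1.
    by move: ia; rewrite inert_lv; have := ht a au; have := nt a au; have := lv_rkP a; have := rk_bounds a; lia.
  case/mem_split: au => t2 [t1 et].
  have [h5 h6] : (forall b, b \in u ++ z :: v ++ lbar z :: t2 -> colR_weak n (rk b) (rk a)) /\
    (forall b, b \in t1 -> colR_weak n (rk a) (rk b)).
    by apply: (col_split hn); move: hx; rewrite /x et -!catA /= -!catA.
  exists t1, a; split=> //.
    case: t2 et h5 => [//|d t2] et /(_ d); rewrite !(mem_cat, inE) eqxx !orbT => /(_ isT).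
    by have := ht d; rewrite et !(mem_cat, inE) eqxx => /(_ isT); rewrite /colR_weak; lia.
  apply: all_inert => c cin; have := h6 c cin; have := lv_rkP c; rewrite /colR_weak.
  by have := rk_bounds c; lia.
have c2 : count (fun a => lv a == i.+1) x = 2.
  by rewrite /x count_cat /= count_cat /= cu cv ct lv_lbar lz eqxx.
have Ni : lvcount i x = i by have := lvcountS i x; rewrite hN c2; lia.
have ci : 0 < count (fun a => lv a == i) x.
  have := lvcountS i.-1 x; rewrite prednK; last by lia.
  by have := hb i.-1; rewrite Ni; lia.
case: uP => [iu|[u1 [a [eu ra iu1]]]].
  have [eu pu] := inert_eps iu.
  case: tP => [it|[t1 [b [et rb it1]]]].
    case/negP: (ltnn 0); apply: leq_trans ci _.
    rewrite /x !(count_cat, count_cat) /= count_cat /= lv_lbar lz.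
    have co s : all inert s -> count (fun a => lv a == i) s = 0.
      move=> /allP is_; apply/eqP; rewrite -leqn0 leqNgt -has_count.
      by apply/hasPn => c /is_; rewrite inert_lv => /andP[].
    by rewrite !co //; lia.
  have [et1 pt1] := inert_eps it1.
  have [pb eb] : phiL i b = 0 /\ epsL i b = 1 by rewrite phiL_rk epsL_rk rb; lia.
  by apply: contracts_ok0; rewrite /x et; crys; rewrite ?(pz, ez, pbz, ebz, pb, eb, eu, pu, ev, pv, et1, pt1).
have [eu1 pu1] := inert_eps iu1.
have [pa ea] : phiL i a = 1 /\ epsL i a = 0 by rewrite phiL_rk epsL_rk ra; lia.
case: tP => [it|[t1 [b [et rb it1]]]]; last first.
  have [et1 pt1] := inert_eps it1.
  have [pb eb] : phiL i b = 0 /\ epsL i b = 1 by rewrite phiL_rk epsL_rk rb; lia.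
  by apply: contracts_ok0; rewrite /x et eu; crys; rewrite ?(pz, ez, pbz, ebz, pb, eb, pa, ea, eu1, pu1, ev, pv, et1, pt1).
have [et pt] := inert_eps it.
split; try by rewrite /x eu; crys; rewrite ?(pz, ez, pbz, ebz, pa, ea, eu1, pu1, ev, pv, et, pt).
move=> x' y' fx fy.
have fa : fL i a = Some z by rewrite fLE arrow_rk // ra rz !eqxx.
have fbz : fL i (lbar z) = Some (lbar a) by rewrite fL_lbar.
have la : lv a = i by have := lv_rkP a; lia.
have ex' : x' = u1 ++ a :: (z :: v) ++ lbar a :: t.
  have : fW i x = Some (u1 ++ a :: (z :: v) ++ lbar a :: t).
    apply/fW_pivot; exists (u ++ z :: v), (lbar z), (lbar a), t.
    by rewrite /x eu -!catA; split=> //; crys; rewrite ?(pz, ez, pa, ea, eu1, pu1, ev, pv).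
  by rewrite fx => -[].
have ey' : y' = u1 ++ (z :: v) ++ t.
  have : fW i (u ++ v ++ t) = Some (u1 ++ (z :: v) ++ t).
    apply/fW_pivot; exists u1, a, z, (v ++ t).
    by rewrite eu -!catA; split=> //; crys; rewrite ?(ev, pv, et, pt).
  by rewrite fy => -[].
have [hm _] := lvcount_f fx.
have Ni' : lvcount i x' = i.+1.
  by move: Ni; rewrite ex' /x eu -!catA /= !(lvcount_cat, lvcount_cons) !lv_lbar la lz; lia.
exists u1, (z :: v), t, a; rewrite la; split=> //.
- exact: col_fW fx.
- move=> m; case: (eqVneq m i) => [->|hmi]; first by rewrite Ni' leqnn addn1.
  by rewrite hm //; have := hb m; lia.
- by lia.
Qed.

(** In the order \bar n, n the phi of the first letter cancels the epsilon of the second, so the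
    pair is invisible to the color n-1. *)
Lemma contracts_mid u t z : i.+1 = n -> rk z = n.+1 ->
  let x := u ++ z :: lbar z :: t in
  is_col x -> (forall m, lvcount m x <= m + (n <= m)) -> lvcount n x = n.+1 ->
  contracts_ok x (u ++ t).
Proof.
move=> en rz x hx hb hN.
have lz : lv z = n by have := lv_rkP z; lia.
have rbz : rk (lbar z) = n by rewrite rk_lbar rz; lia.
have [pz ez] : phiL i z = 1 /\ epsL i z = 0 by rewrite phiL_rk epsL_rk rz; lia.
have [pbz ebz] : phiL i (lbar z) = 0 /\ epsL i (lbar z) = 1.
  by rewrite phiL_rk epsL_rk rbz; lia.
have e1 : epsW i (z :: lbar z :: t) = epsW i t by rewrite /= ?(pz, ez, pbz, ebz); lia.
have p1 : phiW i (z :: lbar z :: t) = phiW i t by rewrite /= ?(pz, ez, pbz, ebz); lia.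
split; [by rewrite /x !epsW_cat e1| by rewrite /x !phiW_cat e1 p1|].
move=> x' y' fx fy; have hx' := col_fW hx fx; have [hm _] := lvcount_f fx.
suff [[u' [t' [ex' ey']]] Ni'] : (exists u' t', x' = u' ++ z :: lbar z :: t' /\ y' = u' ++ t') /\
    lvcount i x' <= i.
  exists u', [::], t', z; rewrite lz; split=> //.
    by move=> m; case: (eqVneq m i) => [->|hmi]; [lia|rewrite hm].
  by rewrite hm //; lia.
have cx : lvcount i x + count (fun a => lv a == i.+1) x = n.+1 by rewrite -lvcountS en.
have cx' : count (fun a => lv a == i.+1) x =
    (count (fun a => lv a == i.+1) u + count (fun a => lv a == i.+1) t).+2.
  by rewrite /x count_cat /= lv_lbar lz en eqxx; lia.
have Ni := hb i.
move: (fx) (fy); rewrite /x !fW_cat e1; case: ifP => _.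
  case Eu: (fW i u) => [u'|] //= [ex'] [ey']; split; first by exists u', t.
  (* A third letter of level n gives N(n-1) <= n-2, which leaves room for one unit; without it there
     is no \bar n outside the pair to turn into \overline{n-1}, and N(n-1) does not grow. *)
  case: (posnP (count (fun a => lv a == i.+1) x - 2)) => c0; last first.
    by case/lvcount_f: fx => _ [? [? [? [? [_ _ _ _ ?]]]]]; lia.
  have := lvcount_f_no_next Eu; move: Ni.
  by rewrite -ex' /x !(lvcount_cat, lvcount_cons); lia.
have -> : fW i (z :: lbar z :: t) = omap (fun t' => z :: lbar z :: t') (fW i t).
  by rewrite /= ?(pz, ez, pbz, ebz) /=; case: (fW i t).
case Et: (fW i t) => [t'|] //= [ex'] [ey']; split; first by exists u, t'.
case: (posnP (count (fun a => lv a == i.+1) x - 2)) => c0; last first.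
  by case/lvcount_f: fx => _ [? [? [? [? [_ _ _ _ ?]]]]]; lia.
have := lvcount_f_no_next Et; move: Ni.
by rewrite -ex' /x !(lvcount_cat, lvcount_cons); lia.
Qed.

Lemma contracts_compat x y : contracts x y -> contracts_ok x y.
Proof.
move=> [u [v [t [z [[ex ey] hx hb hN hv]]]]]; have lzn := lv_bounds z.
rewrite {y}ey; case: (eqVneq (lv z) i) => [zi|zi].
  by move: hx hb hN; rewrite ex; apply: contracts_at.
case: (eqVneq (lv z) i.+1) => [zi1|zi1]; last first.
  by move: hx hb hN; rewrite ex => hx hb hN; apply: contracts_far.
case: (ltnP (lv z) n) => [lzn1|lzn1].
  have [rz h1 h2 _] : [/\ rk z = lv z, forall b, b \in v -> lv z < lv b,
      (forall b, b \in u ++ t -> lv b < lv z) & True].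
    by have [] := @col_pair_count _ hn u v t z; rewrite -?ex.
  move: hx hb hN; rewrite ex => hx hb hN; apply: contracts_next => //; first by rewrite rz.
  have c0 s : (forall b, b \in s -> lv b != i.+1) -> count (fun a => lv a == i.+1) s = 0.
    by move=> h; apply/eqP; rewrite -leqn0 leqNgt -has_count; apply/hasPn => b /h.
  rewrite count_cat /= count_cat /= !c0; first by rewrite lv_lbar zi1 eqxx.
  - by move=> b bt; have := h2 b; rewrite mem_cat bt orbT => /(_ isT); lia.
  - by move=> b /h1; lia.
  - by move=> b bt; have := h2 b; rewrite mem_cat bt => /(_ isT); lia.
have ln : lv z = n by lia.
have en : i.+1 = n by lia.
move: ex; rewrite (hv ln) /= => ex {hv v}.
rewrite ln in hb hN.
have [rz|rz] : rk z = n.+1 \/ rk z = n by have := lv_rkP z; lia.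
  by move: hx hb hN; rewrite ex; apply: contracts_mid.
case: (leqP (count (fun a => lv a == i.+1) x) 2) => cx.
  move: hx hb hN cx; rewrite ex => hx hb hN cx.
  by apply: (@contracts_next u [::] t z) => //; rewrite ?ln ?en.
(* The pair is n, \bar n in this order, and a third letter of level n is adjacent to it. The
   alternating block thus also contains \bar n, n, whose removal gives the same word, and
   [contracts_mid] applies to that pair. *)
have rbz : rk (lbar z) = n.+1 by rewrite rk_lbar rz; lia.
have [h1 h2] : (forall b, b \in u -> colR_weak n (rk b) (rk z)) /\
    (forall b, b \in lbar z :: t -> colR_weak n (rk z) (rk b)).
  by apply: (col_split hn); rewrite -ex.
have : has (fun a => lv a == i.+1) u || has (fun a => lv a == i.+1) t.
  move: cx; rewrite ex count_cat /= lv_lbar ln en eqxx !has_count; lia.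
case/orP => /hasP[c cin /eqP lc].
  case: (lastP u) ex cin => [//|u1 d] ex cin.
  have rd : rk d = n.+1.
    have : colR n (rk d) (rk z).
      have := hx; rewrite ex (is_col_rk hn) map_cat map_rcons /= sorted_cat_cons.
      case/andP => + _; case: (map rk u1) => [|k s] /=; first by rewrite andbT.
      by rewrite !rcons_path last_rcons => /andP[].
    suff : n <= rk d by rewrite /colR; lia.
    move: cin; rewrite mem_rcons inE => /orP[/eqP <-|cin].
      by have := lv_rkP c; lia.
    have [/(_ c cin) + _] : (forall b, b \in u1 -> colR_weak n (rk b) (rk d)) /\
       (forall b, b \in z :: lbar z :: t -> colR_weak n (rk d) (rk b)).
      by apply: (col_split hn); rewrite -cat_rcons -ex.
    by have := lv_rkP c; rewrite /colR_weak; lia.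
  have ez : z = lbar d by apply: rk_inj; rewrite rk_lbar rd rz; lia.
  have ed : lbar z = d by rewrite ez lbarK.
  have ex2 : x = u1 ++ d :: lbar d :: (lbar z :: t) by rewrite ex -ez cat_rcons.
  have -> : rcons u1 d ++ [::] ++ t = u1 ++ lbar z :: t by rewrite ed cat_rcons.
  by move: hx hb hN; rewrite ex2; apply: contracts_mid.
case: t ex cin h2 => [//|d t] ex cin h2.
have rd : rk d = n.
  have : colR n (rk (lbar z)) (rk d).
    by have := hx; rewrite ex (is_col_rk hn) map_cat /= sorted_cat_cons => /andP[_ /= /and3P[]].
  suff : rk d <= n.+1 by rewrite /colR; lia.
  move: cin; rewrite inE => /orP[/eqP <-|cin]; first by have := lv_rkP c; lia.
  have [_ /(_ c cin)] : (forall b, b \in u ++ [:: z; lbar z] -> colR_weak n (rk b) (rk d)) /\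
       (forall b, b \in t -> colR_weak n (rk d) (rk b)).
    by apply: (col_split hn); rewrite -catA -ex.
  by have := lv_rkP c; rewrite /colR_weak; lia.
have ed : d = z by apply: rk_inj; rewrite rd rz.
have ex2 : x = (u ++ [:: z]) ++ lbar z :: lbar (lbar z) :: t by rewrite lbarK ex ed -catA.
have -> : u ++ [::] ++ d :: t = (u ++ [:: z]) ++ t by rewrite ed -catA.
by move: hx hb hN; rewrite ex2; apply: contracts_mid.
Qed.

End ColumnCrystal.

(** * Passage to the color n and to e_i by symmetry *)

Section Compat.
Variable n : nat.
Hypothesis hn : 1 < n.
Implicit Types (a b c z : letter n) (u v w t : word n) (i m : nat).
Local Notation rk := (@rk n).

Lemma elemD_cases (x y : word n) : elemD x y <-> R14 x y \/ contracts x y.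
Proof.
split.
  by rewrite /elemD /R14 => -[|[|[|[|/(R5_contracts hn)]]]]; auto 6.
rewrite /elemD /R14 => -[[|[|[|]]]|/(contracts_R5 hn)]; auto 6.
Qed.

(** Reversal with bars turns every relation into one of the list with its sides exchanged: the two
    forms of (R1) and of (R2) are swapped, those of (R3) and (R4) in pairs. This spares a second
    case analysis for e_i. *)
Lemma rel3_star (x1 x2 x3 y1 y2 y3 : letter n) :
  rel3 n (rk x1) (rk x2) (rk x3) (rk y1) (rk y2) (rk y3) ->
  rel3 n (rk (lbar y3)) (rk (lbar y2)) (rk (lbar y1)) (rk (lbar x3)) (rk (lbar x2)) (rk (lbar x1)).
Proof.
rewrite !rk_lbar.
have b1 := rk_bounds x1; have b2 := rk_bounds x2; have b3 := rk_bounds x3.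
have c1 := rk_bounds y1; have c2 := rk_bounds y2; have c3 := rk_bounds y3.
rewrite {1}/rel3.
case/orP => [h|].
  have : r1b n ((2 * n).+1 - rk y3) ((2 * n).+1 - rk y2) ((2 * n).+1 - rk y1)
    ((2 * n).+1 - rk x3) ((2 * n).+1 - rk x2) ((2 * n).+1 - rk x1).
    by move: h; rewrite /r1a /r1b /leR /ltR; lia.
  by rewrite /rel3 => ->; rewrite ?orbT.
case/orP => [h|].
  have : r1a n ((2 * n).+1 - rk y3) ((2 * n).+1 - rk y2) ((2 * n).+1 - rk y1)
    ((2 * n).+1 - rk x3) ((2 * n).+1 - rk x2) ((2 * n).+1 - rk x1).
    by move: h; rewrite /r1b /r1a /leR /ltR; lia.
  by rewrite /rel3 => ->; rewrite ?orbT.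
case/orP => [h|].
  have : r2b n ((2 * n).+1 - rk y3) ((2 * n).+1 - rk y2) ((2 * n).+1 - rk y1)
    ((2 * n).+1 - rk x3) ((2 * n).+1 - rk x2) ((2 * n).+1 - rk x1).
    by move: h; rewrite /r2a /r2b /leR /ltR; lia.
  by rewrite /rel3 => ->; rewrite ?orbT.
case/orP => [h|].
  have : r2a n ((2 * n).+1 - rk y3) ((2 * n).+1 - rk y2) ((2 * n).+1 - rk y1)
    ((2 * n).+1 - rk x3) ((2 * n).+1 - rk x2) ((2 * n).+1 - rk x1).
    by move: h; rewrite /r2b /r2a /leR /ltR; lia.
  by rewrite /rel3 => ->; rewrite ?orbT.
case/orP => [h|].
  have : r3c n ((2 * n).+1 - rk y3) ((2 * n).+1 - rk y2) ((2 * n).+1 - rk y1)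
    ((2 * n).+1 - rk x3) ((2 * n).+1 - rk x2) ((2 * n).+1 - rk x1).
    by move: h; rewrite /r3a /r3c /leR /ltR; lia.
  by rewrite /rel3 => ->; rewrite ?orbT.
case/orP => [h|].
  have : r3d n ((2 * n).+1 - rk y3) ((2 * n).+1 - rk y2) ((2 * n).+1 - rk y1)
    ((2 * n).+1 - rk x3) ((2 * n).+1 - rk x2) ((2 * n).+1 - rk x1).
    by move: h; rewrite /r3b /r3d /leR /ltR; lia.
  by rewrite /rel3 => ->; rewrite ?orbT.
case/orP => [h|].
  have : r3a n ((2 * n).+1 - rk y3) ((2 * n).+1 - rk y2) ((2 * n).+1 - rk y1)
    ((2 * n).+1 - rk x3) ((2 * n).+1 - rk x2) ((2 * n).+1 - rk x1).
    by move: h; rewrite /r3c /r3a /leR /ltR; lia.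
  by rewrite /rel3 => ->; rewrite ?orbT.
case/orP => [h|].
  have : r3b n ((2 * n).+1 - rk y3) ((2 * n).+1 - rk y2) ((2 * n).+1 - rk y1)
    ((2 * n).+1 - rk x3) ((2 * n).+1 - rk x2) ((2 * n).+1 - rk x1).
    by move: h; rewrite /r3d /r3b /leR /ltR; lia.
  by rewrite /rel3 => ->; rewrite ?orbT.
case/orP => [h|].
  have : r4d n ((2 * n).+1 - rk y3) ((2 * n).+1 - rk y2) ((2 * n).+1 - rk y1)
    ((2 * n).+1 - rk x3) ((2 * n).+1 - rk x2) ((2 * n).+1 - rk x1).
    by move: h; rewrite /r4a /r4d /leR /ltR; lia.
  by rewrite /rel3 => ->; rewrite ?orbT.
case/orP => [h|].
  have : r4c n ((2 * n).+1 - rk y3) ((2 * n).+1 - rk y2) ((2 * n).+1 - rk y1)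
    ((2 * n).+1 - rk x3) ((2 * n).+1 - rk x2) ((2 * n).+1 - rk x1).
    by move: h; rewrite /r4b /r4c /leR /ltR; lia.
  by rewrite /rel3 => ->; rewrite ?orbT.
case/orP => [h|].
  have : r4b n ((2 * n).+1 - rk y3) ((2 * n).+1 - rk y2) ((2 * n).+1 - rk y1)
    ((2 * n).+1 - rk x3) ((2 * n).+1 - rk x2) ((2 * n).+1 - rk x1).
    by move: h; rewrite /r4c /r4b /leR /ltR; lia.
  by rewrite /rel3 => ->; rewrite ?orbT.
move=> h.
have : r4a n ((2 * n).+1 - rk y3) ((2 * n).+1 - rk y2) ((2 * n).+1 - rk y1)
    ((2 * n).+1 - rk x3) ((2 * n).+1 - rk x2) ((2 * n).+1 - rk x1).
    by move: h; rewrite /r4d /r4a /leR /ltR; lia.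
by rewrite /rel3 => ->; rewrite ?orbT.
Qed.

Lemma rk_swL a : rk a = n /\ rk (swL a) = n.+1 \/ rk a = n.+1 /\ rk (swL a) = n \/
  (rk a <> n /\ rk a <> n.+1 /\ rk (swL a) = rk a).
Proof.
rewrite /swL; have := lv_rkP a; have := rk_bounds a.
case: eqP => h; rewrite ?rk_lbar; lia.
Qed.

Lemma leR_swL a b : leR n (rk (swL a)) (rk (swL b)) = leR n (rk a) (rk b).
Proof. by rewrite /leR; have := rk_swL a; have := rk_swL b; lia. Qed.

Lemma leD_swL a b : leD (swL a) (swL b) = leD a b.
Proof. by rewrite !leD_rk leR_swL. Qed.

Lemma swL_inj : injective (@swL n).
Proof. exact: can_inj (@swLK n). Qed.

Lemma ltD_swL a b : ltD (swL a) (swL b) = ltD a b.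
Proof.
have E c d : ltD c d = leD c d && (c != d).
  by rewrite ltD_rk leD_rk rk_eq /ltR /leR; lia.
by rewrite !E leD_swL (inj_eq swL_inj).
Qed.

Lemma swL_lbar a : swL (lbar a) = lbar (swL a).
Proof. by rewrite /swL lv_lbar; case: ifP. Qed.

Lemma swL_id a : lv a != n -> swL a = a.
Proof. by rewrite /swL => /negbTE ->. Qed.

Lemma isU_swL a : isU n (swL a) = isB n a.
Proof. by rewrite !isUE isBE sg_swL lv_swL //; case: eqP; case: (a.2). Qed.

Lemma isB_swL a : isB n (swL a) = isU n a.
Proof. by rewrite -isU_swL swLK. Qed.

Lemma R14_sw (x y : word n) : R14 x y -> R14 (sw x) (sw y).
Proof.
case=> [[a [b [c H]]]|[[a [b [p [q [h H]]]]]|[[c [a [b [/and4P[h1 h2 h3 h4] H]]]]|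
  [a [b [c [d [/and4P[h1 h2 h3 h4] H]]]]]]]].
- left; exists (swL a), (swL b), (swL c).
  rewrite !leD_swL !ltD_swL -swL_lbar !(inj_eq swL_inj).
  by case: H => [[h [-> ->]]|[h [-> ->]]]; [left|right].
- right; left; exists a, (swL b), p, q.
  have [_ h2 h3 h4 /and3P[h5 h6 h7]] := and5P h.
  have ea : swL a = a by apply: swL_id; lia.
  have eba : swL (lbar a) = lbar a by rewrite swL_lbar ea.
  have ep : swL p = p by apply: swL_id; case/andP: h6 => _ /eqP ->; lia.
  have eq : swL q = q by apply: swL_id; case/andP: h7 => _ /eqP ->; lia.
  have f1 : leD a (swL b) = leD a b by rewrite -{1}ea leD_swL.
  have f2 : leD (swL b) (lbar a) = leD b (lbar a) by rewrite -{1}eba leD_swL.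
  split; first by rewrite f1 f2.
  by case: H => [] [-> ->]; [left|right]; rewrite /= ?ea ?eba ?ep ?eq.
- right; right; left; exists c, (swL b), (swL a).
  rewrite isU_swL isB_swL h1 h2 h3 h4; split=> //.
  have ec : swL c = c by apply: swL_id; lia.
  have ebc : swL (lbar c) = lbar c by rewrite swL_lbar ec.
  case: H => [|[|[|]]] [-> ->]; rewrite /= ?ec ?ebc.
  + by right; left. 
  + by left.
  + by right; right; right.
  + by right; right; left.
right; right; right; exists (swL b), (swL a), c, d.
have ec : swL c = c by apply: swL_id; case/andP: h3 => _ /eqP ->; lia.
have ed : swL d = d by apply: swL_id; case/andP: h4 => _ /eqP ->; lia.
rewrite isU_swL isB_swL h1 h2 h3 h4; split=> //.
case: H => [|[|[|]]] [-> ->]; rewrite /= ?ec ?ed.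
+ by right; left. 
+ by left.
+ by right; right; right.
+ by right; right; left.
Qed.

Lemma R14_star (x y : word n) : R14 x y -> R14 (star y) (star x).
Proof.
move=> /(R14_rel3 hn)[x1 [x2 [x3 [y1 [y2 [y3 [-> -> /rel3_star h]]]]]]].
exact: rel3_R14.
Qed.

Lemma lvcount_map (f : letter n -> letter n) m w : (forall a, lv (f a) = lv a) ->
  lvcount m (map f w) = lvcount m w.
Proof. by move=> h; rewrite /lvcount count_map; apply: eq_count => a /=; rewrite h. Qed.

Lemma lvcount_star m w : lvcount m (star w) = lvcount m w.
Proof. by rewrite /star /lvcount count_rev; apply: lvcount_map. Qed.

Lemma leD_lbar a b : leD (lbar a) (lbar b) = leD b a.
Proof.
by rewrite !leD_rk !rk_lbar /leR; have := rk_bounds a; have := rk_bounds b; lia.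
Qed.

Lemma is_col_star w : is_col (star w) = is_col w.
Proof.
rewrite /is_col /star rev_sorted sorted_map; apply: eq_sorted => a b /=.
by rewrite leD_lbar.
Qed.

Lemma is_col_sw w : is_col (sw w) = is_col w.
Proof.
by rewrite /is_col /sw sorted_map; apply: eq_sorted => a b /=; rewrite leD_swL.
Qed.

Lemma contracts_star (x y : word n) : contracts x y -> contracts (star x) (star y).
Proof.
move=> [u [v [t [z [[ex ey] hx hb hN hv]]]]].
exists (star t), (star v), (star u), z; split=> //.
- by rewrite ex ey !(star_cat, star_cons) lbarK -!catA.
- by rewrite is_col_star.
- by move=> m; rewrite lvcount_star.
- by rewrite lvcount_star.
- by move/hv => ->.
Qed.

Lemma contracts_sw (x y : word n) : contracts x y -> contracts (sw x) (sw y).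
Proof.
move=> [u [v [t [z [[ex ey] hx hb hN hv]]]]].
have E m w : lvcount m (sw w) = lvcount m w by apply: lvcount_map => a; rewrite lv_swL.
exists (sw u), (sw v), (sw t), (swL z); rewrite lv_swL //; split=> //.
- by rewrite ex ey !sw_cat /= !sw_cat /= swL_lbar.
- by rewrite is_col_sw.
- by move=> m; rewrite E.
- by rewrite E.
- by move/hv => ->.
Qed.

Lemma congD_star (x y : word n) : congD x y -> congD (star x) (star y).
Proof.
elim=> {x y} [u v x y xy|w|x y _|x y z _ h1 _ h2].
- rewrite !star_cat -!catA; apply: congD_ctx.
  case/elemD_cases: xy => [/R14_star|/contracts_star] h.
    by apply: congD_sym; apply: congD_elem; apply/elemD_cases; left.
  by apply: congD_elem; apply/elemD_cases; right.
- exact: congD_refl.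
- exact: congD_sym.
- exact: congD_trans h1 h2.
Qed.

Lemma congD_sw (x y : word n) : congD x y -> congD (sw x) (sw y).
Proof.
elim=> {x y} [u v x y xy|w|x y _|x y z _ h1 _ h2].
- rewrite !sw_cat; apply: congD_ctx; apply: congD_elem; apply/elemD_cases.
  by case/elemD_cases: xy => [/R14_sw|/contracts_sw]; [left|right].
- exact: congD_refl.
- exact: congD_sym.
- exact: congD_trans h1 h2.
Qed.

Definition f_compat i (x y : word n) := [/\ epsW i x = epsW i y, phiW i x = phiW i y &
  forall x' y', fW i x = Some x' -> fW i y = Some y' -> congD x' y'].

Lemma f_compat_sym i x y : f_compat i x y -> f_compat i y x.
Proof. by move=> [e p f]; split=> // x' y' h1 h2; apply: congD_sym; apply: f. Qed.

Lemma f_compat_trans i (x y z : word n) : f_compat i x y -> f_compat i y z -> f_compat i x z.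
Proof.
move=> [e1 p1 f1] [e2 p2 f2]; split; rewrite ?e1 ?p1 // => x' z' hx hz.
have [|y' hy] := @fW_ex n i y; first by rewrite -p1 (fW_phi hx).
exact: congD_trans (f1 _ _ hx hy) (f2 _ _ hy hz).
Qed.

Lemma f_compat_ctx i u v x y : congD x y -> f_compat i x y -> f_compat i (u ++ x ++ v) (u ++ y ++ v).
Proof.
move=> xy [e p f].
have e1 : epsW i (x ++ v) = epsW i (y ++ v) by rewrite !epsW_cat e p.
have p1 : phiW i (x ++ v) = phiW i (y ++ v) by rewrite !phiW_cat p.
split; [by rewrite !(epsW_cat _ u) e1|by rewrite !(phiW_cat _ u) e1 p1|].
move=> x' y'; rewrite !fW_cat e1 p; case: ifP => _.
  by case: (fW i u) => //= u' [<-] [<-]; apply/congD_ctx.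
case: ifP => _.
  case Ex: (fW i x) => [x1|] //=; case Ey: (fW i y) => [y1|] //= [<-] [<-].
  by apply: congD_ctx; apply: f.
by case: (fW i v) => //= v' [<-] [<-]; apply/congD_ctx.
Qed.

Lemma f_compat_low i x y : 0 < i < n -> congD x y -> f_compat i x y.
Proof.
move=> hi; elim=> {x y} [u v x y xy|w|x y _|x y z _ h1 _ h2].
- apply: f_compat_ctx; first exact: congD_elem.
  case/elemD_cases: xy => [/(R14_compat hn hi)//|/(contracts_compat hn hi)[e p f]].
  split=> // x' y' h1 h2; apply: congD_elem; apply/elemD_cases; right; exact: f.
- by split=> // x' y' -> [->]; apply: congD_refl.
- exact: f_compat_sym.
- exact: f_compat_trans h1 h2.
Qed.

Lemma f_compat_all i x y : color n i -> congD x y -> f_compat i x y.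
Proof.
rewrite /color => hi xy; case: (ltnP i n) => hin; first by apply: f_compat_low => //; lia.
have ei : i = n by lia.
have [|e p f] := @f_compat_low n.-1 _ _ _ (congD_sw xy); first by lia.
have es : n.-1 = swc n i by rewrite /swc ei eqxx.
rewrite es in e p f.
split; [by move: e; rewrite !epsW_sw | by move: p; rewrite !phiW_sw|].
move=> x' y' /(fW_sw hn) h1 /(fW_sw hn) h2.
by have := congD_sw (f _ _ h1 h2); rewrite !swK.
Qed.

Lemma congD_eps i (x y : word n) : color n i -> congD x y -> epsW i x = epsW i y.
Proof. by move=> hi /(f_compat_all hi)[]. Qed.

Lemma congD_phi i (x y : word n) : color n i -> congD x y -> phiW i x = phiW i y.
Proof. by move=> hi /(f_compat_all hi)[]. Qed.

Lemma congD_fW i (x y x' : word n) : color n i -> congD x y -> fW i x = Some x' ->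
  exists2 y', fW i y = Some y' & congD x' y'.
Proof.
move=> hi xy hx; have [_ p f] := f_compat_all hi xy.
have [|y' hy] := @fW_ex n i y; first by rewrite -p (fW_phi hx).
by exists y' => //; apply: f.
Qed.

Lemma congD_eW i (x y x' : word n) : color n i -> congD x y -> eW i x = Some x' ->
  exists2 y', eW i y = Some y' & congD x' y'.
Proof.
move=> hi /congD_star xy /eW_fW/fW_star /(congD_fW hi xy)[y' /[dup] hy].
rewrite -[y']starK => /fW_star /eW_fW h /congD_star; rewrite !starK => h2.
by exists (star y').
Qed.

End Compat.

(* A semistandard tableau with entries in {1,2,3}: first row 1^a 2^b 3^c,
   second row 2^d 3^e, third row 3^g. *)
Record ssyt3 := Ssyt3 { sa : nat; sb : nat; sc : nat; sd : nat; se : nat; sg : nat }.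

(** Row insertion in terms of multiplicities: the inserted letter takes the place of one copy of the
    next larger letter present in the row, and that copy goes to the row below. *)
Definition ins2 (s : ssyt3) : ssyt3 :=
  let: Ssyt3 a b c d e g := s in
  if 0 < c then Ssyt3 a b.+1 c.-1 d e.+1 g else Ssyt3 a b.+1 c d e g.

Definition ins1 (s : ssyt3) : ssyt3 :=
  let: Ssyt3 a b c d e g := s in
  if 0 < b then
    if 0 < e then Ssyt3 a.+1 b.-1 c d.+1 e.-1 g.+1 else Ssyt3 a.+1 b.-1 c d.+1 e g
  else if 0 < c then Ssyt3 a.+1 b c.-1 d e.+1 g else Ssyt3 a.+1 b c d e g.

Definition ins3 (s : ssyt3) : ssyt3 :=
  let: Ssyt3 a b c d e g := s in Ssyt3 a b c.+1 d e g.

Definition ins (r : nat) (s : ssyt3) : ssyt3 :=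
  if r == 1 then ins1 s else if r == 2 then ins2 s else ins3 s.

(** The operator e_k on tableaux. For k = 1 the 2s of the second row are cancelled by 1s of the
    first; for k = 2 the 2s of the first row cancel 3s of the second, and a surviving 3 of the
    second row is changed before those of the first. *)
Definition raise (k : nat) (s : ssyt3) : ssyt3 :=
  let: Ssyt3 a b c d e g := s in
  if k == 1 then Ssyt3 a.+1 b.-1 c d e g
  else if b < e then Ssyt3 a b c d.+1 e.-1 g else Ssyt3 a b.+1 c.-1 d e g.

Definition seps (k : nat) (s : ssyt3) : nat :=
  if k == 1 then sb s else sc s + (se s - sb s).
Definition sphi (k : nat) (s : ssyt3) : nat :=
  if k == 1 then sa s - sd s else sd s - sg s + (sb s - se s).
(** Column strictness: the 2s of the second row lie below 1s, its 3s below letters at most 2, and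
    the third row below 2s. *)
Definition swf (s : ssyt3) : bool :=
  [&& sd s <= sa s, sd s + se s <= sa s + sb s & sg s <= sd s].

Definition rows (s : ssyt3) : nat * nat * nat := (sa s + sb s + sc s, sd s + se s, sg s).

(* The insertion tableau of a word in the letters 1, 2, 3 of D_4, on which the
   colors 1 and 2 form a crystal of type A_2. *)
Definition tab (w : word 4) : ssyt3 := foldr (fun x s => ins (rk x) s) (Ssyt3 0 0 0 0 0 0) w.
Definition le3 (w : word 4) : bool := all (fun x => rk x <= 3) w.

Lemma tab_cons x w : tab (x :: w) = ins (rk x) (tab w). Proof. by []. Qed.

Lemma phiL4 k (x : letter 4) : 0 < k <= 2 -> rk x <= 3 -> phiL k x = (rk x == k).
Proof.
move=> hk hx; have h4 : 0 < k < 4 by lia.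
by case: (colorP x h4) => *; lia.
Qed.

Lemma epsL4 k (x : letter 4) : 0 < k <= 2 -> rk x <= 3 -> epsL k x = (rk x == k.+1).
Proof.
move=> hk hx; have h4 : 0 < k < 4 by lia.
by case: (colorP x h4) => *; lia.
Qed.

Lemma k12 k : 0 < k <= 2 -> k = 1 \/ k = 2. Proof. lia. Qed.

Lemma rk3 (x : letter 4) : rk x <= 3 -> [\/ rk x = 1, rk x = 2 | rk x = 3].
Proof.
by move=> h; have := rk_bounds x; case: (rk x) h => [|[|[|[|]]]] // *;
  [constructor 1|constructor 2|constructor 3].
Qed.

(** The right-hand sides are the tensor rule for a letter r put in front of a word, so the tableau
    keeps the epsilon and phi of the word it comes from. *)
Lemma ins_spec r k s : 0 < r <= 3 -> 0 < k <= 2 -> swf s ->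
  [/\ swf (ins r s), seps k (ins r s) = (r == k.+1) + (seps k s - (r == k)) &
      sphi k (ins r s) = sphi k s + ((r == k) - seps k s)].
Proof.
case: s => a b c d e g hr /k12 hk; have {hr} : r = 1 \/ r = 2 \/ r = 3 by lia.
rewrite /swf /seps /sphi /ins /=.
case=> [|[]] -> /=; case: hk => -> /= hwf; rewrite /ins1 /ins2 /ins3; do ?case: ifP => ?;
  split => /=; lia.
Qed.

Lemma tab_spec w : le3 w ->
  swf (tab w) /\ forall k, 0 < k <= 2 ->
    epsW k w = seps k (tab w) /\ phiW k w = sphi k (tab w).
Proof.
elim: w => [_|x w IH /= /andP[hx /IH[hwf H]]].
  by split=> // k /k12[] ->.
have hr : 0 < rk x <= 3 by have := rk_bounds x; lia.
split=> [|k hk]; first by have [] := @ins_spec (rk x) 1 (tab w) hr isT hwf.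
have [_ -> ->] := ins_spec hr hk hwf.
by have [e p] := H k hk; rewrite e p epsL4 // phiL4.
Qed.

Lemma tab_eW k w w' : 0 < k <= 2 -> le3 w -> eW k w = Some w' ->
  le3 w' /\ tab w' = raise k (tab w).
Proof.
move=> hk; elim: w w' => [//|x w IH] w' /= /andP[hx hw].
have [hwf /(_ k hk)[he hp]] := tab_spec hw.
rewrite phiL4 // he; case: ifP => hc.
  case Ew: (eW k w) => [w1|] //= -[<-].
  have [h1 e1] := IH _ hw Ew; rewrite !tab_cons e1; split; first by rewrite /= hx.
  move: hc hwf {he hp}; rewrite /seps /swf /ins; case: (tab w) => a b c d e g /=.
  case/k12: hk => ->; case: (rk3 hx) => -> /= hc hwf; rewrite /ins1 /ins2 /ins3 /=;
    do ?[case: ifP => ? //=]; try lia; congr Ssyt3; lia.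
case El: (eL k x) => [y|] //= -[<-].
have [ry rx] : rk x = k.+1 /\ rk y = k.
  have := El; rewrite eLE arrow_rk; last by lia.
  by have := rk_bounds x; lia.
rewrite !tab_cons; split; first by rewrite /= hw; lia.
move: hc hwf {he hp}; rewrite ry rx /seps /swf /ins; case: (tab w) => a b c d e g /=.
case/k12: hk => -> /= hc hwf; rewrite /ins1 /ins2 /ins3 /=;
    do ?[case: ifP => ? //=]; try lia; congr Ssyt3; lia.
Qed.

Lemma tab_rows k w w' : 0 < k <= 2 -> le3 w -> eW k w = Some w' ->
  rows (tab w') = rows (tab w).
Proof.
move=> hk hw he; have [_ ->] := tab_eW hk hw he.
have [_ /(_ k hk)[e _]] := tab_spec hw.
have : 0 < seps k (tab w) by rewrite -e; move/eW_fW/fW_eps: he; lia.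
rewrite /rows /seps; case: (tab w) => a b c d f g /=.
by case/k12: hk => -> /=; do ?case: ifP => ? /=; move=> ?; congr (_, _, _); lia.
Qed.

Definition cnt r (w : word 4) := count (fun x => rk x == r) w.

Lemma tab_content w : le3 w ->
  [/\ cnt 1 w = sa (tab w), cnt 2 w = sb (tab w) + sd (tab w) &
      cnt 3 w = sc (tab w) + se (tab w) + sg (tab w)].
Proof.
elim: w => [//|x w IH /= /andP[hx /IH[h1 h2 h3]]].
rewrite /cnt /= -!/(cnt _ w) h1 h2 h3 /ins; case: (tab w) => a b c d e g /=.
by case: (rk3 hx) => -> /=; rewrite /ins1 /ins2 /ins3 /=; do ?case: ifP => ? /=; split; lia.
Qed.

(* The shape of the insertion tableau is constant on components, and for a
   highest weight word it is the weight: so two highest weight words of the same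
   component have prefixes of the same weights and coincide. *)
Lemma highest_content w : le3 w -> epsW 1 w = 0 -> epsW 2 w = 0 ->
  (cnt 1 w, cnt 2 w, cnt 3 w) = rows (tab w).
Proof.
move=> hw; have [_ H] := tab_spec hw; have [/= -> _] := H 1 isT; have [/= -> _] := H 2 isT.
have [-> -> ->] := tab_content hw; rewrite /seps /rows /= => h1 h2.
by congr (_, _, _); lia.
Qed.

Inductive conn3 : word 4 -> word 4 -> Prop :=
| conn3_refl w : conn3 w w
| conn3_e k w1 w2 w3 : 0 < k <= 2 -> eW k w1 = Some w2 -> conn3 w2 w3 -> conn3 w1 w3
| conn3_f k w1 w2 w3 : 0 < k <= 2 -> eW k w2 = Some w1 -> conn3 w2 w3 -> conn3 w1 w3.

Lemma take_cat_same (T : Type) k (w u v : seq T) :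
  size u = size (take k w) -> size v = size (drop k w) -> take k (u ++ v) = u.
Proof.
rewrite size_take_min size_drop => eu ev; rewrite take_cat.
case: ltnP => hk; first by lia.
case: v ev => [|x v] /= ev; first by rewrite cats0.
have -> : k - size u = 0 by lia.
by rewrite take0 cats0.
Qed.

(** A prefix is a left tensor factor, which f_i either fixes or moves by f_i. So prefixes stay in
    their components, and the shapes of all their insertion tableaux, that is the recording tableau,
    are invariants. *)
Lemma fW_take n i k (w w' : word n) : fW i w = Some w' ->
  take k w' = take k w \/ fW i (take k w) = Some (take k w').
Proof.
move=> h; have := h; rewrite -{1}[w](cat_take_drop k) fW_cat; case: ifP => _.
  case E: (fW i (take k w)) => [u|] //= -[<-]; right.
  by rewrite (@take_cat_same _ k w) // (fW_size E).
case E: (fW i (drop k w)) => [v|] //= -[<-]; left.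
by rewrite (@take_cat_same _ k w) // (fW_size E).
Qed.

Lemma le3_take k w : le3 w -> le3 (take k w).
Proof. by rewrite -{1}[w](cat_take_drop k) /le3 all_cat => /andP[]. Qed.

Lemma conn3_rows x y : conn3 x y -> le3 x -> le3 y /\ size x = size y /\
  forall k, rows (tab (take k x)) = rows (tab (take k y)).
Proof.
have step k w w' : 0 < k <= 2 -> eW k w = Some w' -> le3 w -> le3 w' ->
    size w = size w' /\ forall m, rows (tab (take m w)) = rows (tab (take m w')).
  move=> hk /eW_fW he hw hw'; split; first by rewrite (fW_size he).
  move=> m; case: (fW_take m he) => [->//|/eW_fW h].
  by rewrite (tab_rows hk _ h) // le3_take.
elim=> {x y} [//|k w1 w2 w3 hk he _ IH h1|k w1 w2 w3 hk he _ IH h1].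
  have [h2 _] := tab_eW hk h1 he.
  have [h3 [s3 H3]] := IH h2; have [s2 H2] := step k _ _ hk he h1 h2.
  by split=> //; rewrite s2 s3; split=> // m; rewrite H2.
have h2 : le3 w2.
  move/eW_fW/fW_pivot: he h1 => [u [a [b [v [-> -> fab _ _]]]]].
  rewrite /le3 !all_cat /= => /and3P[-> hb ->]; rewrite andbT /=.
  by move: fab; rewrite fLE arrow_rk; lia.
have [h3 [s3 H3]] := IH h2; have [s2 H2] := step k _ _ hk he h2 h1.
by split=> //; rewrite -s2 s3; split=> // m; rewrite -H2.
Qed.

Lemma cnt_take_inj x y : le3 x -> le3 y -> size x = size y ->
  (forall k, cnt 1 (take k x) = cnt 1 (take k y) /\ cnt 2 (take k x) = cnt 2 (take k y)) -> x = y.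
Proof.
elim/last_ind: x y => [|x a IH] y; first by case: y.
case/lastP: y => [|y b]; first by rewrite size_rcons.
rewrite /le3 !all_rcons !size_rcons => /andP[ha hx] /andP[hb hy] [hs] H.
have exy : x = y.
  apply: IH => // k; case: (ltnP k (size x)) => hk.
    by have := H k; rewrite -!cats1 !take_cat -hs hk.
  have := H (size x); rewrite -!cats1 take_size_cat // hs take_size_cat //.
  by rewrite !take_oversize // -hs.
have [] := H (size x).+1; rewrite !take_oversize ?size_rcons ?hs // /cnt -!cats1 !count_cat exy /=.
move=> h1 h2; congr (_ ++ [:: _]); apply: rk_inj.
by have := rk_bounds a; have := rk_bounds b; lia.
Qed.

Lemma highest_take n i k (w : word n) : epsW i w = 0 -> epsW i (take k w) = 0.
Proof. by rewrite -{1}[w](cat_take_drop k) epsW_cat; lia. Qed.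

Lemma conn3_highest_unique x y : le3 x -> conn3 x y ->
  epsW 1 x = 0 -> epsW 2 x = 0 -> epsW 1 y = 0 -> epsW 2 y = 0 -> x = y.
Proof.
move=> hx xy x1 x2 y1 y2; have [hy [sxy H]] := conn3_rows xy hx.
apply: cnt_take_inj => // k; have := H k.
by rewrite -!highest_content ?le3_take ?highest_take // => -[-> ->].
Qed.

Definition l3 (k : nat) : letter 4 := (inord k.-1, false).

Lemma rk_l3 k : 0 < k <= 3 -> rk (l3 k) = k.
Proof. by move=> hk; rewrite /rk /l3 /lv /= inordK; lia. Qed.

Lemma phi_l3 c k : 0 < c <= 2 -> 0 < k <= 3 -> phiL c (l3 k) = (k == c).
Proof. by move=> hc hk; rewrite phiL4 ?rk_l3 //; lia. Qed.

Lemma eps_l3 c k : 0 < c <= 2 -> 0 < k <= 3 -> epsL c (l3 k) = (k == c.+1).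
Proof. by move=> hc hk; rewrite epsL4 ?rk_l3 //; lia. Qed.

Lemma f_l3 c : 0 < c <= 2 -> fL c (l3 c) = Some (l3 c.+1).
Proof. by move=> hc; rewrite fLE arrow_rk ?rk_l3; lia. Qed.

Lemma fW_1 : fW 1 [:: l3 1] = Some [:: l3 2].
Proof. by apply/fW_pivot; exists [::], (l3 1), (l3 2), [::]; rewrite f_l3. Qed.
Lemma fW_2 : fW 2 [:: l3 2] = Some [:: l3 3].
Proof. by apply/fW_pivot; exists [::], (l3 2), (l3 3), [::]; rewrite f_l3. Qed.
Lemma fW_12 : fW 2 [:: l3 1; l3 2] = Some [:: l3 1; l3 3].
Proof. by apply/fW_pivot; exists [:: l3 1], (l3 2), (l3 3), [::]; rewrite f_l3 //= phi_l3. Qed.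
Lemma fW_13 : fW 1 [:: l3 1; l3 3] = Some [:: l3 2; l3 3].
Proof. by apply/fW_pivot; exists [::], (l3 1), (l3 2), [:: l3 3]; rewrite f_l3 //= phi_l3 // eps_l3. Qed.

(** * Highest weight vertices *)

Section ConnS.
Variable n : nat.
Variable S : pred nat.

(** Relative to a set S of colors, so that components for two adjacent colors and for all colors are
    treated alike. *)
Inductive connS : word n -> word n -> Prop :=
| connS_refl w : connS w w
| connS_f i w1 w2 w3 : S i -> fW i w1 = Some w2 -> connS w2 w3 -> connS w1 w3
| connS_e i w1 w2 w3 : S i -> fW i w2 = Some w1 -> connS w2 w3 -> connS w1 w3.

Lemma connS_trans x y z : connS x y -> connS y z -> connS x z.
Proof.
elim=> {x y} // [i w1 w2 w3 hi h _ IH /IH|i w1 w2 w3 hi h _ IH /IH].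
  exact: connS_f hi h.
exact: connS_e hi h.
Qed.

Lemma connS_sym x y : connS x y -> connS y x.
Proof.
elim=> {x y} [w|i w1 w2 w3 hi h _ IH|i w1 w2 w3 hi h _ IH]; first exact: connS_refl.
  by apply: connS_trans IH (connS_e hi h (connS_refl _)).
by apply: connS_trans IH (connS_f hi h (connS_refl _)).
Qed.

Inductive up : word n -> word n -> Prop :=
| up_refl w : up w w
| up_step i w1 w2 w3 : S i -> fW i w2 = Some w1 -> up w2 w3 -> up w1 w3.

Lemma up_trans x y z : up x y -> up y z -> up x z.
Proof. by elim=> {x y} // i w1 w2 w3 hi h _ IH /IH; apply: up_step hi h. Qed.

Lemma up_conn x y : up x y -> connS x y.
Proof.
elim=> {x y} [w|i w1 w2 w3 hi h _]; first exact: connS_refl.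
exact: connS_e hi h.
Qed.

Definition top (w : word n) := forall i, S i -> epsW i w = 0.

Definition rksum (w : word n) := sumn (map (@rk n) w).

Lemma fW_rksum i (w w' : word n) : fW i w = Some w' -> rksum w < rksum w'.
Proof.
move/fW_pivot => [u [a [b [v [-> -> fab _ _]]]]].
rewrite /rksum !map_cat !sumn_cat /= ltn_add2l ltn_add2r.
move: fab; rewrite fLE /arrow !isUE !isBE /rk.
by have := lv_bounds a; have := lv_bounds b; case: (a.2) (b.2) => [] []; lia.
Qed.

End ConnS.

Lemma up_sub n (S S' : pred nat) (x y : word n) : {subset S <= S'} -> up S x y -> up S' x y.
Proof.
move=> sub; elim=> {x y} [w|i w1 w2 w3 hi h _]; first exact: up_refl.
by apply: up_step h; apply: sub.
Qed.

Lemma up_top n (S : pred nat) (w : word n) : (forall i, S i -> i <= n) ->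
  exists2 t, up S w t & top S t.
Proof.
move=> hS; elim: {w}(rksum w) {-2}w (leqnn (rksum w)) => [|m IH] w hm.
  exists w; first exact: up_refl.
  move=> i hi; case: (posnP (epsW i w)) => // /eW_ex[w' /eW_fW/fW_rksum]; lia.
case: (boolP (has (fun i => S i && (0 < epsW i w)) (iota 0 n.+1))) => [/hasP|/hasPn] H.
  have [i _ /andP[hi /eW_ex[w' /eW_fW he]]] := H.
  have [|t ut tt] := IH w'; first by have := fW_rksum he; lia.
  by exists t => //; apply: up_step hi he ut.
exists w; first exact: up_refl.
move=> i hi; have := H i; rewrite mem_iota hi /= lt0n negbK => h.
by apply/eqP/h; have := hS i hi; lia.
Qed.

Lemma up_inv n (S : pred nat) (x y : word n) : up S x y ->
  x = y \/ exists i x', [/\ S i, fW i x' = Some x & up S x' y].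
Proof.
case=> {x y} [w|i w1 w2 w3 hi h u]; first by left.
by right; exists i, w2.
Qed.

(** Induction on [rksum] gives a unique top above each vertex: two first steps are joined, and both
    start from vertices of smaller sum. A zigzag then carries the top from one of its ends to the
    other. *)
Lemma newman n (S : pred nat) : (forall i, S i -> i <= n) ->
  (forall i j (x y z : word n), S i -> S j -> fW i y = Some x -> fW j z = Some x ->
    exists t, up S y t /\ up S z t) ->
  forall x y : word n, connS S x y -> top S x -> top S y -> x = y.
Proof.
move=> hS loc.
have uniq m : forall x y z : word n, rksum x <= m -> up S x y -> up S x z -> top S y -> top S z -> y = z.
  elim: m => [|m IH] x y z hm /up_inv[<-|[i [x1 [hi h1 u1]]]] /up_inv[<-|[j [x2 [hj h2 u2]]]] ty tz //.
  - by have := ty j hj; rewrite (fW_eps h2).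
  - by have := tz i hi; rewrite (fW_eps h1).
  - by have := fW_rksum h1; lia.
  - by have := ty j hj; rewrite (fW_eps h2).
  - by have := tz i hi; rewrite (fW_eps h1).
  have [t [ut1 ut2]] := loc i j _ _ _ hi hj h1 h2.
  have [s us ts] := up_top t hS.
  have l1 : rksum x1 <= m by have := fW_rksum h1; lia.
  have l2 : rksum x2 <= m by have := fW_rksum h2; lia.
  have -> : y = s by apply: (IH x1) => //; apply: up_trans ut1 us.
  by apply/esym; apply: (IH x2) => //; apply: up_trans ut2 us.
have key (x y : word n) : connS S x y -> forall s t, up S x s -> up S y t -> top S s -> top S t -> s = t.
  elim=> {x y} [w s t us ut ts tt|i w1 w2 w3 hi h _ IH s t us ut ts tt|i w1 w2 w3 hi h _ IH s t us ut ts tt].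
  - exact: (uniq (rksum w) w s t (leqnn _) us ut ts tt).
  - by apply: IH => //; apply: up_step hi h us.
  - have [r ur tr] := up_top w2 hS.
    rewrite (uniq (rksum w1) w1 s r) //; first exact: IH.
    exact: up_step hi h ur.
by move=> x y xy tx ty; apply: key xy _ _ _ _ tx ty; apply: up_refl.
Qed.

(** * Two adjacent colors: reduction to words in 1, 2, 3 *)

Section Enc.
Variables (n i : nat).
Hypothesis hi : 0 < i.
Hypothesis hin : i.+1 < n.
Local Notation rk := (@rk n).

(* For the colors i, i+1 the letters i, i+1, i+2 form the vector crystal of A_2
   and their bars the dual one, which is encoded by the columns 12, 13, 23. *)
Definition enc (a : letter n) : word 4 :=
  if rk a == i then [:: l3 1] else if rk a == i.+1 then [:: l3 2]
  else if rk a == i.+2 then [:: l3 3]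
  else if rk a == (2 * n - i).-1 then [:: l3 1; l3 2]
  else if rk a == 2 * n - i then [:: l3 1; l3 3]
  else if rk a == (2 * n - i).+1 then [:: l3 2; l3 3] else [::].

(** What the colors i, i+1 never change: the kind of the letter, and the letter itself if they
    ignore it. It restores what [enc] loses; [.+2] keeps the ignored letters apart from the values 0
    and 1. *)
Definition cls (a : letter n) : nat :=
  if i <= rk a <= i.+2 then 0 else if (2 * n - i).-1 <= rk a <= (2 * n - i).+1 then 1 else (rk a).+2.

Variant enc_case (a : letter n) : word 4 -> nat -> Prop :=
| Enc1 of rk a = i : enc_case a [:: l3 1] 0
| Enc2 of rk a = i.+1 : enc_case a [:: l3 2] 0
| Enc3 of rk a = i.+2 : enc_case a [:: l3 3] 0
| Enc12 of rk a = (2 * n - i).-1 : enc_case a [:: l3 1; l3 2] 1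
| Enc13 of rk a = 2 * n - i : enc_case a [:: l3 1; l3 3] 1
| Enc23 of rk a = (2 * n - i).+1 : enc_case a [:: l3 2; l3 3] 1
| Enc0 of rk a != i & rk a != i.+1 & rk a != i.+2 & rk a != (2 * n - i).-1 &
    rk a != 2 * n - i & rk a != (2 * n - i).+1 : enc_case a [::] (rk a).+2.

Lemma encP a : enc_case a (enc a) (cls a).
Proof.
have ha := rk_bounds a.
have c0 : i <= rk a <= i.+2 -> cls a = 0 by rewrite /cls => ->.
have c1 : (2 * n - i).-1 <= rk a <= (2 * n - i).+1 -> cls a = 1.
  by rewrite /cls => h; rewrite h ifF //; lia.
have c2 : ~~ (i <= rk a <= i.+2) -> ~~ ((2 * n - i).-1 <= rk a <= (2 * n - i).+1) ->
  cls a = (rk a).+2 by rewrite /cls => /negbTE -> /negbTE ->.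
rewrite /enc; case: eqVneq => h1; first by rewrite c0; [constructor|lia].
case: eqVneq => h2; first by rewrite c0; [constructor|lia].
case: eqVneq => h3; first by rewrite c0; [constructor|lia].
case: eqVneq => h4; first by rewrite c1; [constructor|lia].
case: eqVneq => h5; first by rewrite c1; [constructor|lia].
case: eqVneq => h6; first by rewrite c1; [constructor|lia].
by rewrite c2; [constructor|lia|lia].
Qed.

Lemma enc_eps k a : 0 < k <= 2 -> epsW k (enc a) = epsL (i + k).-1 a /\
  phiW k (enc a) = phiL (i + k).-1 a.
Proof.
move=> hk; have hc : 0 < (i + k).-1 < n by lia.
case: (encP a) => *; rewrite /= ?eps_l3 ?phi_l3 //; case/k12: hk hc => -> hc /=;
 case: (colorP a hc) => *; lia.
Qed.

Lemma enc_fL k a b : 0 < k <= 2 -> fL (i + k).-1 a = Some b -> fW k (enc a) = Some (enc b).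
Proof.
move=> hk; have hc : 0 < (i + k).-1 < n by lia.
rewrite fLE arrow_rk //.
case/k12: hk hc => -> hc; case: (encP a) => *; case: (encP b) => *; try lia;
  rewrite ?fW_1 ?fW_2 ?fW_12 ?fW_13 //.
Qed.

End Enc.

Section Adjacent.
Variables (n i : nat).
Hypothesis hi : 0 < i.
Hypothesis hin : i.+1 < n.
Local Notation rk := (@rk n).
Implicit Types (u v w x y : word n).

Definition encW w : word 4 := flatten (map (enc i) w).

Lemma encW_cat u v : encW (u ++ v) = encW u ++ encW v.
Proof. by rewrite /encW map_cat flatten_cat. Qed.

Lemma encW_eps k w : 0 < k <= 2 -> epsW k (encW w) = epsW (i + k).-1 w /\
  phiW k (encW w) = phiW (i + k).-1 w.
Proof.
move=> hk; elim: w => [//|a w [e p]].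
rewrite /encW /= -/(encW w) epsW_cat phiW_cat e p.
by have [-> ->] := enc_eps hi hin a hk.
Qed.

Lemma encW_fW k w w' : 0 < k <= 2 -> fW (i + k).-1 w = Some w' -> fW k (encW w) = Some (encW w').
Proof.
move=> hk /fW_pivot[u [a [b [v [-> -> fab pu ev]]]]].
have [p [x [q [r [ea eb fxq pp er]]]]] := (fW_pivot _ _ _).1 (enc_fL hi hin hk fab).
apply/fW_pivot; exists (encW u ++ p), x, q, (r ++ encW v).
have [eu pu'] := encW_eps u hk; have [ev' pv'] := encW_eps v hk.
rewrite !encW_cat /encW /= -!/(encW _) ea eb -!catA; split=> //.
  by rewrite phiW_cat pu' pu pp.
by rewrite epsW_cat er ev' ev.
Qed.

Lemma le3_encW w : le3 (encW w).
Proof.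
elim: w => [//|a w IH]; rewrite /encW /= /le3 all_cat; apply/andP; split=> //.
by case: (encP hi hin a) => *; rewrite /= ?rk_l3.
Qed.

Definition adjS : pred nat := fun k => (k == i) || (k == i.+1).

Lemma adjS_k k : adjS k -> exists2 m, 0 < m <= 2 & k = (i + m).-1.
Proof. by case/orP => /eqP ->; [exists 1|exists 2]; lia. Qed.

Lemma adj_conn x y : connS adjS x y ->
  conn3 (encW x) (encW y) /\ map (cls i) x = map (cls i) y.
Proof.
have step k w w' : adjS k -> fW k w = Some w' -> map (cls i) w = map (cls i) w'.
  move=> /adjS_k[m hm ->] /fW_pivot[u [a [b [v [-> -> fab _ _]]]]].
  rewrite !map_cat /=; congr (_ ++ _ :: _).
  have hc : 0 < (i + m).-1 < n by lia.
  move: fab; rewrite fLE arrow_rk // => h.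
  by case/k12: hm h {hc} => -> h; case: (encP hi hin a) => *; case: (encP hi hin b) => *; lia.
elim=> {x y} [w|k w1 w2 w3 hk h _ [c e]|k w1 w2 w3 hk h _ [c e]].
- by split=> //; apply: conn3_refl.
- split; last by rewrite (step _ _ _ hk h).
  have [m hm ek] := adjS_k hk; rewrite ek in h.
  by apply: conn3_f c => //; [exact: hm|apply/eW_fW/encW_fW].
split; last by rewrite -(step _ _ _ hk h).
have [m hm ek] := adjS_k hk; rewrite ek in h.
by apply: conn3_e c => //; [exact: hm|apply/eW_fW/encW_fW].
Qed.

Lemma enc_inj (a b : letter n) : cls i a = cls i b -> size (enc i a) = size (enc i b) /\
  (enc i a = enc i b -> a = b).
Proof.
have ha := rk_bounds a; have hb := rk_bounds b.
by case: (encP hi hin a); case: (encP hi hin b) => *; (try lia); split=> //;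
  move/(congr1 (map (@Defs.rk 4))); rewrite /= ?rk_l3 // => *; apply: rk_inj; lia.
Qed.

Lemma encW_inj x y : map (cls i) x = map (cls i) y -> encW x = encW y -> x = y.
Proof.
elim: x y => [|a x IH] [|b y] //= [/enc_inj[hs hab] /IH{}IH] /eqP.
by rewrite /encW /= eqseq_cat // => /andP[/eqP/hab -> /eqP/IH ->].
Qed.

(** Once [cls] is fixed, [encW] is an injective morphism for the colors i, i+1, so uniqueness is
    pulled back from words in 1, 2, 3. *)
Lemma adj_unique x y : connS adjS x y -> top adjS x -> top adjS y -> x = y.
Proof.
move=> /adj_conn[c e] tx ty; apply: encW_inj e _.
have E k w : 0 < k <= 2 -> top adjS w -> epsW k (encW w) = 0.
  move=> hk tw; have [-> _] := encW_eps w hk; apply: tw.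
  by rewrite /adjS; lia.
by apply: conn3_highest_unique c _ _ _ _ => //; rewrite ?le3_encW ?E.
Qed.

End Adjacent.

(** * Commuting colors and uniqueness of the highest weight vertex *)

Section Commuting.
Variable n : nat.
Hypothesis hn : 1 < n.
Implicit Types (a b c d : letter n) (u v w x y z : word n) (i j : nat).
Local Notation rk := (@rk n).

Definition joined i j := 
  forall x y z, fW i y = Some x -> fW j z = Some x ->
    exists t, up (pred2 i j) y t /\ up (pred2 i j) z t.

Lemma joined_sym i j : joined i j -> joined j i.
Proof.
move=> h x y z hy hz; have [t [u1 u2]] := h x z y hz hy.
by exists t; split; [apply: up_sub u2|apply: up_sub u1] => k; rewrite !inE orbC.
Qed.

(** The last clause closes a square of arrows; it is what is needed when both operators act at the
    same position of a word. *)
Definition fL_commute i j := forall a b, fL i a = Some b ->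
  [/\ phiL j a = phiL j b, epsL j a = epsL j b &
    forall c, fL j c = Some b -> exists2 d, fL i d = Some c & fL j d = Some a].

Lemma fL_commuteW i j u a b v : fL_commute i j -> fL i a = Some b ->
  epsW j (u ++ a :: v) = epsW j (u ++ b :: v) /\ phiW j (u ++ a :: v) = phiW j (u ++ b :: v).
Proof. by move=> C /C[p e _]; rewrite !epsW_cat !phiW_cat /= p e. Qed.

Lemma cat_cons_cases (T : Type) (u1 v1 u2 v2 : seq T) (a b : T) :
  u1 ++ a :: v1 = u2 ++ b :: v2 ->
  [\/ [/\ u1 = u2, a = b & v1 = v2],
      exists m, u2 = u1 ++ a :: m /\ v1 = m ++ b :: v2 |
      exists m, u1 = u2 ++ b :: m /\ v2 = m ++ a :: v1].
Proof.
elim: u1 u2 => [|c u1 IH] [|d u2] /= [].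
- by move=> -> ->; constructor 1.
- by move=> -> ->; constructor 2; exists u2.
- by move=> -> <-; constructor 3; exists u1.
move=> -> /IH[[-> -> ->]|[m [-> ->]]|[m [-> ->]]].
- by constructor 1.
- by constructor 2; exists m.
- by constructor 3; exists m.
Qed.

Lemma commute_joined i j : fL_commute i j -> fL_commute j i -> joined i j.
Proof.
move=> C1 C2 x y z /fW_pivot[u1 [a1 [b1 [v1 [ey ex f1 p1 e1]]]]].
move=> /fW_pivot[u2 [a2 [b2 [v2 [ez ex' f2 p2 e2]]]]].
suff [t [t1 t2]] : exists t, fW j t = Some y /\ fW i t = Some z.
  exists t; split; [apply: up_step t1 (up_refl _ _) | apply: up_step t2 (up_refl _ _)];
  by rewrite /= eqxx ?orbT.
rewrite ex' in ex; case: (cat_cons_cases ex) => [[eu eb ev]|[m [eu ev]]|[m [eu ev]]].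
- subst u2 v2 b2; have [_ _ /(_ _ f2)[d fd1 fd2]] := C1 _ _ f1.
  exists (u1 ++ d :: v1); rewrite ey ez; split; apply/fW_pivot.
    by exists u1, d, a1, v1.
  by exists u1, d, a2, v1.
- exists (u2 ++ a2 :: m ++ a1 :: v1); split; apply/fW_pivot.
    exists u2, a2, b2, (m ++ a1 :: v1); rewrite ey eu -catA; split=> //.
    have [-> _] := fL_commuteW m v1 C1 f1; by rewrite -ev.
  exists (u2 ++ a2 :: m), a1, b1, v1; rewrite ez ev -!catA; split=> //.
  have [_ ->] := fL_commuteW u2 m C2 f2; by rewrite -eu.
exists (u1 ++ a1 :: m ++ a2 :: v2); split; apply/fW_pivot.
  exists (u1 ++ a1 :: m), a2, b2, v2; rewrite ey ev -!catA; split=> //.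
  have [_ ->] := fL_commuteW u1 m C1 f1; by rewrite -eu.
exists u1, a1, b1, (m ++ a2 :: v2); rewrite ez eu -catA; split=> //.
have [-> _] := fL_commuteW m v2 C2 f2; by rewrite -ev.
Qed.

Lemma arrow_rk_n a b : arrow n a b =
  (rk b == (rk a).+2) && ((rk a == n.-1) || (rk a == n)).
Proof.
rewrite /arrow !isUE !isBE /rk; have := lv_bounds a; have := lv_bounds b.
by case: (a.2) (b.2) => [] [] ? ?; lia.
Qed.

(* Pairs of distinct colors that are not joined in the Dynkin diagram. *)
Definition far i j := [&& 0 < i, i.+1 < j & j < n] || (0 < i) && (i.+2 < n) && (j == n) ||
  (i == n.-1) && (j == n).

Definition arr i a b := if i == n then (rk b == (rk a).+2) && ((rk a == n.-1) || (rk a == n))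
  else (rk b == (rk a).+1) && ((rk a == i) || (rk a == 2 * n - i)).

Lemma fL_arr i a b : color n i -> fL i a = Some b <-> arr i a b.
Proof.
rewrite /color => hi; rewrite fLE /arr; case: eqVneq => [->|ne]; first by rewrite arrow_rk_n.
by rewrite arrow_rk //; lia.
Qed.

Lemma phiL_arr i a : color n i -> phiL i a =
  if i == n then (rk a == n.-1) || (rk a == n) else (rk a == i) || (rk a == 2 * n - i).
Proof.
move=> hi; have ha := rk_bounds a; rewrite /color in hi.
set B := (if i == n then _ else _).
rewrite /phiL; case E: (fL i a) => [b|].
  by move/fL_arr: E => /(_ hi); rewrite /arr /B; case: ifP => _ /andP[_ ->].
case: (boolP B) => // hB; move: hB; rewrite /B; case: ifP => hin hB.
  have [|b hb] := @rk_exists n (rk a).+2; first by lia.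
  have : fL i a = Some b by apply/fL_arr => //; rewrite /arr hin hb eqxx hB.
  by rewrite E.
have [|b hb] := @rk_exists n (rk a).+1; first by lia.
have : fL i a = Some b by apply/fL_arr => //; rewrite /arr hin hb eqxx hB.
by rewrite E.
Qed.

Lemma far_commute i j : far i j || far j i -> fL_commute i j.
Proof.
move=> hf; have [hi hj] : color n i /\ color n j by rewrite /far /color in hf *; lia.
move=> a b fab; have ha := rk_bounds a; have hb := rk_bounds b.
have hab := (fL_arr a b hi).1 fab.
have phi0 c : phiL j c = if j == n then (rk c == n.-1) || (rk c == n) else (rk c == j) || (rk c == 2 * n - j).
  exact: phiL_arr.
rewrite -!phiL_lbar !phi0 !rk_lbar.
(* An arrow of a given color shifts the rank by a fixed amount, so the fourth corner of the square
   must have rank [rk a + rk c - rk b]. *)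
suff [[e1 e2] E3] : (phiL j a = phiL j b /\ phiL j (lbar a) = phiL j (lbar b)) /\
    forall c, 0 < rk c <= 2 * n -> arr j c b ->
      (0 < rk a + rk c - rk b <= 2 * n) /\ (forall d, rk d = rk a + rk c - rk b -> arr i d c /\ arr j d a).
  rewrite !phi0 !rk_lbar in e1 e2; split=> // c /(fL_arr _ _ hj) h.
  have [/rk_exists[d hd] /(_ d hd)[h1 h2]] := E3 c (rk_bounds c) h.
  by exists d; apply/fL_arr.
rewrite !phi0 !rk_lbar {phi0 fab} /arr; rewrite /far in hf; rewrite /arr in hab.
rewrite /color in hi hj.
case: (eqVneq i n) hab hf => [->|hin] /andP[/eqP eb hab] hf; case: (eqVneq j n) hf => [->|hjn] hf.
- by exfalso; lia.
- have {}hf : j.+2 < n \/ j = n.-1 by lia.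
  by case: hf => hf; case/orP: hab => /eqP ea; rewrite ea in eb;
    (split; [split; lia|]) => c hc /andP[/eqP ec ecb]; (split; [lia|]) => d hd; split; lia.
- have {}hf : i.+2 < n \/ i = n.-1 by lia.
  by case: hf => hf; case/orP: hab => /eqP ea; rewrite ea in eb;
    (split; [split; lia|]) => c hc /andP[/eqP ec ecb]; (split; [lia|]) => d hd; split; lia.
have {}hf : i.+1 < j < n \/ j.+1 < i < n by lia.
by case: hf => hf; case/orP: hab => /eqP ea; rewrite ea in eb;
  (split; [split; lia|]) => c hc /andP[/eqP ec ecb]; (split; [lia|]) => d hd; split; lia.
Qed.

(** Both words are neighbors of x, hence lie in one component for the colors i, i+1, and the common
    top given by [adj_unique] joins them. *)
Lemma adj_joined i : 0 < i -> i.+1 < n -> joined i i.+1.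
Proof.
move=> hi hin x y z hy hz.
have hS k : adjS i k -> k <= n by rewrite /adjS; lia.
have [s us ts] := up_top y hS; have [t ut tt] := up_top z hS.
exists s; split=> //.
rewrite (@adj_unique n i hi hin s t) //.
apply: connS_trans (connS_sym (up_conn us)) _.
apply: connS_f hy _; first by rewrite /adjS eqxx.
apply: connS_e hz _; first by rewrite /adjS eqxx orbT.
exact: up_conn ut.
Qed.

Lemma joined_sw i j : joined i j -> joined (swc n i) (swc n j).
Proof.
move=> h x y z hy hz.
have aux k u v : fW (swc n k) u = Some v -> fW k (sw u) = Some (sw v).
  by move=> e; apply/(fW_sw hn); rewrite !swK.
have [t [u1 u2]] := h _ _ _ (aux _ _ _ hy) (aux _ _ _ hz).
exists (sw t).
have tr w w' : up (pred2 i j) w w' -> up (pred2 (swc n i) (swc n j)) (sw w) (sw w').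
  elim=> {w w'} [w|k w1 w2 w3 hk h1 _]; first exact: up_refl.
  apply: (@up_step _ _ (swc n k)); last by apply/(fW_sw hn).
  by move: hk => /= /orP[] /eqP ->; rewrite eqxx ?orbT.
by rewrite -[y]swK -[z]swK; split; apply: tr.
Qed.

Lemma all_joined i j : color n i -> color n j -> joined i j.
Proof.
wlog lij : i j / i <= j.
  move=> H hi hj; case: (leqP i j) => [|/ltnW] h; first exact: H.
  by apply: joined_sym; apply: H.
rewrite /color => hi hj.
case: (eqVneq i j) => [<-|nij].
  move=> x y z /eW_fW hy /eW_fW; rewrite hy => -[<-].
  by exists y; split; apply: up_refl.
case: (boolP (far i j)) => [hf|nf].
  by apply: commute_joined; apply: far_commute; rewrite hf ?orbT.
case: (ltnP j n) => hjn.
  have -> : j = i.+1 by rewrite /far in nf; lia.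
  by apply: adj_joined; rewrite /far in nf; lia.
(* What remains is the pair n-2, n, the image of the adjacent pair n-2, n-1 under the diagram
   automorphism. *)
have e1 : swc n i = i by rewrite /swc; rewrite /far in nf; do ?case: eqP => ?; lia.
have e2 : swc n i.+1 = j by rewrite /swc; rewrite /far in nf; do ?case: eqP => ?; lia.
by rewrite -e1 -e2; apply: joined_sw; apply: adj_joined; rewrite /far in nf; lia.
Qed.

Lemma conn_connS x y : conn x y <-> connS (color n) x y.
Proof.
split.
  elim=> {x y} [w|w1 w2 w3 i hi h _ IH|w1 w2 w3 i hi h _ IH].
  - exact: connS_refl.
  - exact: connS_f hi h IH.
  - exact: connS_e hi h IH.
elim=> {x y} [w|i w1 w2 w3 hi h _ IH|i w1 w2 w3 hi h _ IH].
- exact: conn_refl.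
- exact: conn_f hi h IH.
- exact: conn_e hi h IH.
Qed.

Lemma highest_eps w : highest w <-> top (color n) w.
Proof. by split=> h i hi; have := h i hi; rewrite eW_None. Qed.

Theorem highest_unique x y : conn x y -> highest x -> highest y -> x = y.
Proof.
move=> /conn_connS c /highest_eps hx /highest_eps hy; apply: newman c hx hy.
  by move=> i; rewrite /color => /andP[].
move=> i j u v w hi hj hv hw; have [t [u1 u2]] := all_joined hi hj hv hw.
by exists t; split; [apply: up_sub u1|apply: up_sub u2] => k; rewrite !inE => /orP[] /eqP ->.
Qed.

Lemma highest_ex w : exists2 t, up (color n) w t & highest t.
Proof.
have [|t ut tt] := @up_top n (color n) w; first by move=> i; rewrite /color => /andP[].
by exists t => //; apply/highest_eps.
Qed.

End Commuting.

(** * Highest weight words *)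

Section Canonical.
Variable n : nat.
Hypothesis hn : 1 < n.
Implicit Types (a b : letter n) (u v w : word n) (i j k m : nat) (P : seq nat).
Local Notation rk := (@rk n).
Local Notation colY := (colY n).

(* The unbarred letter k (for k = 0 or k > n, the letter 1). *)
Definition U k : letter n := odflt (Ordinal (ltnW hn), false) (mkl n k false).

Lemma mklU k : 0 < k <= n -> mkl n k false = Some (U k).
Proof.
move=> /(@letter_exists n k false)[a [la sa]].
by rewrite /U (_ : mkl n k false = Some a) //; apply/mklE.
Qed.

Lemma lvU k : 0 < k <= n -> lv (U k) = k.
Proof. by move=> /mklU/mklE[]. Qed.

Lemma rkU k : 0 < k <= n -> rk (U k) = k.
Proof. by move=> /mklU/mklE[l s]; rewrite /rk s l. Qed.

Definition seg i k : word n := map U (iota i k).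

Lemma colY_seg k : k <= n -> colY k = seg 1 k.
Proof.
move=> hk; rewrite /Defs.colY /seg.
have : forall j, j \in iota 1 k -> 0 < j <= n by move=> j; rewrite mem_iota; lia.
elim: (iota 1 k) => //= j s IH H; rewrite mklU; last by apply: H; rewrite inE eqxx.
by rewrite /= IH // => j' hj'; apply: H; rewrite inE hj' orbT.
Qed.

Lemma seg_cat i j k : seg i (j + k) = seg i j ++ seg (i + j) k.
Proof. by rewrite /seg iotaD map_cat. Qed.

Lemma seg_rcons i k : seg i k.+1 = rcons (seg i k) (U (i + k)).
Proof. by rewrite -addn1 seg_cat cats1. Qed.

Lemma mem_seg i k a : a \in seg i k -> exists2 j, i <= j < i + k & a = U j.
Proof. by case/mapP => j; rewrite mem_iota => hj ->; exists j. Qed.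

Definition asc w := sorted ltn (map rk w) && all (fun a => rk a <= n) w.

Lemma seg_asc i k : 0 < i -> (i + k).-1 <= n -> asc (seg i k).
Proof.
move=> hi; rewrite /asc; elim: k => [//|k IH] hk.
rewrite seg_rcons map_rcons all_rcons -cats1 rkU; last by lia.
have /andP[h1 ->] := IH ltac:(lia).
rewrite andbT; apply/andP; split; last by lia.
rewrite sorted_cat_cons andbT.
case: k hk h1 {IH} => [//|k] hk h1.
move: h1; rewrite seg_rcons map_rcons; case: (map rk (seg i k)) => [|x s] /=.
  by rewrite !rkU; lia.
by rewrite !rcons_path last_rcons rkU; [move=> ->|]; lia.
Qed.

Lemma R1_cong_left a b c u v : rk a <= rk b < rk c -> rk c <= n ->
  congD (u ++ [:: b; c; a] ++ v) (u ++ [:: b; a; c] ++ v).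
Proof.
move=> h1 h2; apply: congD_base; left; exists a, b, c; left; split=> //.
by rewrite leD_rk ltD_rk rk_eq rk_lbar /leR /ltR; have := rk_bounds a; lia.
Qed.

Lemma R1_cong_right a b c u v : rk a < rk b <= rk c -> rk c <= n ->
  congD (u ++ [:: a; c; b] ++ v) (u ++ [:: c; a; b] ++ v).
Proof.
move=> h1 h2; apply: congD_base; left; exists a, b, c; right; split=> //.
by rewrite leD_rk ltD_rk rk_eq rk_lbar /leR /ltR; have := rk_bounds a; lia.
Qed.

Lemma asc_rcons w a : asc (rcons w a) -> [/\ asc w, rk a <= n & forall b, b \in w -> rk b < rk a].
Proof.
rewrite /asc map_rcons all_rcons => /and3P[h1 h2 h3].
move: h1; rewrite (sorted_pairwise ltn_trans) pairwise_rcons => /andP[h4 h5].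
rewrite (sorted_pairwise ltn_trans) h5 h3; split=> // b hb.
by move/allP: h4; apply; rewrite map_f.
Qed.

(** The letter [a] passes each letter of [s] by the first form of (R1), with the preceding letter in
    the role of y; [b] is the last to play it and is not passed. *)
Lemma slide_left s b a : asc (b :: s) -> rk a <= rk b ->
  congD ((b :: s) ++ [:: a]) (b :: a :: s).
Proof.
elim/last_ind: s => [|s c IH] hs hab; first exact: congD_refl.
rewrite -rcons_cons in hs; have [h1 h2 h3] := asc_rcons hs.
have -> : b :: a :: rcons s c = (b :: a :: s) ++ [:: c] by rewrite /= cats1.
apply: congD_trans (congD_catr [:: c] (IH h1 hab)).
have bin : b \in b :: s by rewrite inE eqxx.
rewrite -rcons_cons; case: (lastP (b :: s)) h3 h1 bin => [//|u d] h3 h4 bin.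
have [_ _ hd] := asc_rcons h4; rewrite -!cats1 -!catA.
apply: (@R1_cong_left a d c u [::]) => //; rewrite (h3 d) ?mem_rcons ?inE ?eqxx // andbT.
apply: leq_trans hab _; move: bin; rewrite mem_rcons inE => /orP[/eqP -> //|/hd].
exact: ltnW.
Qed.

(** Here [c] moves left by the second form of (R1), in which y is the letter on its right. *)
Lemma slide_front s a c : asc (rcons s a) -> rk a <= rk c <= n ->
  congD (s ++ [:: c; a]) (c :: rcons s a).
Proof.
elim/last_ind: s a => [|s d IH] a hs hac; first exact: congD_refl.
have [h1 h2 h3] := asc_rcons hs.
have hd : rk d < rk a by apply: h3; rewrite mem_rcons inE eqxx.
have -> : c :: rcons (rcons s d) a = (c :: rcons s d) ++ [:: a] by rewrite /= cats1.
apply: congD_trans (congD_catr [:: a] (IH d h1 _)); last by lia.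
rewrite -cats1 -!catA; apply: (@R1_cong_right d a c s [::]); lia.
Qed.

(** The new j slides left to the j of the column. Of the two adjacent copies the first can then move
    to the front, the second being the letter on its right. *)
Lemma colY_commL j k : 0 < j <= k -> k <= n -> congD (colY k ++ [:: U j]) (U j :: colY k).
Proof.
move=> hj hk; rewrite colY_seg //.
have -> : k = j.-1 + (k - j).+1 by lia.
rewrite seg_cat; have -> : seg (1 + j.-1) (k - j).+1 = U j :: seg j.+1 (k - j).
  by have -> : 1 + j.-1 = j by lia.
apply: (@congD_trans _ _ (seg 1 j.-1 ++ U j :: U j :: seg j.+1 (k - j))).
  rewrite -catA; apply: congD_catl; apply: slide_left => //.
  by have := @seg_asc j (k - j).+1; apply; lia.
have h1 : asc (rcons (seg 1 j.-1) (U j)).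
  have -> : U j = U (1 + j.-1) by congr U; lia.
  by rewrite -seg_rcons; apply: seg_asc; lia.
have h2 : rk (U j) <= rk (U j) <= n by rewrite rkU; lia.
have := congD_catr (seg j.+1 (k - j)) (slide_front h1 h2).
by rewrite /= cat_rcons -catA.
Qed.

Lemma colY_comm k v : k <= n -> (forall a, a \in v -> exists2 j, 0 < j <= k & a = U j) ->
  congD (colY k ++ v) (v ++ colY k).
Proof.
move=> hk; elim: v => [|a v IH] hv; first by rewrite cats0; apply: congD_refl.
have [|j hj ->] := hv a; first by rewrite inE eqxx.
apply: (@congD_trans _ _ (U j :: colY k ++ v)).
  have := congD_catr v (colY_commL hj hk); by rewrite -catA.
apply: (congD_catl [:: U j]); apply: IH => b hb; apply: hv; by rewrite inE hb orbT.
Qed.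

Lemma lvcount_seg m k : k <= n -> lvcount m (seg 1 k) = minn k m.
Proof.
elim: k => [|k IH] hk; first by rewrite min0n.
rewrite seg_rcons -cats1 lvcount_cat lvcount_cons IH; last by lia.
by rewrite lvU; rewrite /lvcount /=; lia.
Qed.

Lemma is_col_seg k : k <= n -> is_col (seg 1 k).
Proof.
move=> hk; rewrite (is_col_rk hn).
have /andP[h _] := @seg_asc 1 k isT ltac:(lia).
by apply: sub_sorted h => x y /= h; rewrite /colR h.
Qed.

Definition hole j k : word n := seg 1 j.-1 ++ seg j.+1 (k - j).

(** The word 1 ... k \bar j is a column in which N first exceeds its bound at level j, with N(j) =
    j+1; so (R5) erases the pair j, \bar j. *)
Lemma colY_barL j k : 0 < j <= k -> k <= n -> congD (colY k ++ [:: lbar (U j)]) (hole j k).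
Proof.
move=> hj hk; rewrite colY_seg //; apply: congD_elem; apply/(elemD_cases hn); right.
have ek : seg 1 k = seg 1 j.-1 ++ U j :: seg j.+1 (k - j).
  have {1}-> : k = j.-1 + (k - j).+1 by lia.
  by rewrite seg_cat; have -> : 1 + j.-1 = j by lia.
have lj : lv (U j) = j by rewrite lvU; lia.
have cnt m : lvcount m (seg 1 k ++ [:: lbar (U j)]) = minn k m + (j <= m).
  by rewrite lvcount_cat lvcount_cons lvcount_seg // lv_lbar lj /lvcount /= addn0.
exists (seg 1 j.-1), (seg j.+1 (k - j)), [::], (U j); rewrite lj; split=> //.
- by rewrite ek -catA /= cats0.
- have := is_col_seg hk; rewrite !(is_col_rk hn) map_cat /= sorted_cat_cons andbT => h.
  have hr : rk (lbar (U j)) = (2 * n).+1 - j by rewrite rk_lbar rkU //; lia.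
  case: k hj hk h {ek cnt} => [|k]; first by lia.
  rewrite seg_rcons map_rcons => hj hk h; move: h; case: (map rk (seg 1 k)) => [|x s] /= h.
    by rewrite /colR hr rkU; lia.
  rewrite rcons_path h last_rcons /= /colR hr rkU; lia.
- by move=> m; rewrite cnt; lia.
- by rewrite cnt; lia.
- by move=> ej; have -> : k - j = 0 by lia.
Qed.

(* The column heights are listed in reading order, that is increasingly. *)
Definition cw P : word n := flatten (map colY P).

Lemma cw_cat P P' : cw (P ++ P') = cw P ++ cw P'.
Proof. by rewrite /cw map_cat flatten_cat. Qed.

Lemma cw_commL j P : 0 < j -> all (fun k => j <= k <= n) P ->
  congD (cw P ++ [:: U j]) (U j :: cw P).
Proof.
move=> hj; elim: P => [|k P IH] /=; first by move=> _; exact: congD_refl.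
case/andP=> hk /IH h; rewrite /cw /= -/(cw P) -catA.
apply: congD_trans (congD_catl _ h) _.
have jk : 0 < j <= k by lia.
by have := congD_catr (cw P) (colY_commL jk ltac:(lia)); rewrite -catA.
Qed.

(** The bar is absorbed by the last, tallest column, and the hole travels to the left: the part k+1,
    ..., k1 of the punctured column completes the column of height k to height k1, while the rest,
    with letters at most k, commutes with that column. *)
Lemma cw_barL j k P : 0 < j <= k -> sorted leq (k :: P) -> all (fun k => k <= n) (k :: P) ->
  congD (cw (k :: P) ++ [:: lbar (U j)]) (hole j k ++ cw P).
Proof.
elim: P k => [|k1 P IH] k hj.
  by move=> _ /= /andP[hk _]; rewrite /cw /= !cats0; apply: colY_barL.
move=> /= /andP[hk1 hs] /and3P[hk hk1n hP].
have {}IH := IH k1 ltac:(lia) hs ltac:(by rewrite /= hk1n).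
rewrite [cw (k :: _)]/cw /= -/(cw P) -catA; apply: congD_trans (congD_catl _ IH) _.
have -> : hole j k1 = hole j k ++ seg k.+1 (k1 - k).
  rewrite /hole -catA; congr (_ ++ _).
  have -> : k1 - j = (k - j) + (k1 - k) by lia.
  by rewrite seg_cat; congr (_ ++ seg _ _); lia.
rewrite [cw (k1 :: P)]/cw /= -/(cw P).
have -> : colY k1 = colY k ++ seg k.+1 (k1 - k).
  by rewrite !colY_seg // -{1}(subnKC hk1) seg_cat.
have c : congD (colY k ++ hole j k) (hole j k ++ colY k).
  apply: colY_comm => // a; rewrite /hole mem_cat => /orP[] /mem_seg[i hi ->];
    by exists i => //; lia.
by have := congD_catr (seg k.+1 (k1 - k) ++ cw P) c; rewrite -!catA.
Qed.

Lemma phiL_U i j : 0 < i < n -> 0 < j <= n -> phiL i (U j) = (j == i) /\ epsL i (U j) = (j == i.+1).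
Proof.
by move=> hi hj; have := @rkU j hj; case: (colorP (U j) hi) => *; lia.
Qed.

Lemma phi_n_U j : 0 < j <= n -> phiL n (U j) = (j == n) + (j == n.-1) /\ epsL n (U j) = 0.
Proof.
move=> hj; have cn : color n n by rewrite /color; lia.
rewrite -phiL_lbar !phiL_arr // eqxx rk_lbar rkU //; lia.
Qed.

Lemma phi_colY i k : 0 < i < n -> k <= n -> phiW i (colY k) = (k == i) /\ epsW i (colY k) = 0.
Proof.
move=> hi hk; rewrite colY_seg //; elim: k hk => [|k IH] hk.
  by split=> //; case: i hi.
have [p e] := IH ltac:(lia); rewrite seg_rcons -cats1 phiW_cat epsW_cat p e /=.
by have [-> ->] := @phiL_U i (1 + k) hi ltac:(lia); lia.
Qed.

(** Both n-1 and n are sources of arrows of color n, hence the value 2 at height n and 1 at height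
    n-1. *)
Lemma phi_n_colY k : k <= n -> phiW n (colY k) = (k == n).*2 + (k == n.-1) /\ epsW n (colY k) = 0.
Proof.
move=> hk; rewrite colY_seg //; elim: k hk => [|k IH] hk; first by split=> //; rewrite /= ; lia.
have [p e] := IH ltac:(lia); rewrite seg_rcons -cats1 phiW_cat epsW_cat p e /=.
by have [-> ->] := @phi_n_U (1 + k) ltac:(lia); lia.
Qed.

Lemma phi_cw i P : 0 < i < n -> all (fun k => k <= n) P ->
  phiW i (cw P) = count_mem i P /\ epsW i (cw P) = 0.
Proof.
move=> hi; elim: P => [//|k P IH] /= /andP[hk /IH[p e]].
have [pk ek] := phi_colY hi hk.
by rewrite [cw _]/cw /= -/(cw P) phiW_cat epsW_cat p e pk ek subn0 addnC.
Qed.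

Lemma phi_n_cw P : all (fun k => k <= n) P ->
  phiW n (cw P) = (count_mem n P).*2 + count_mem n.-1 P /\ epsW n (cw P) = 0.
Proof.
elim: P => [//|k P IH] /= /andP[hk /IH[p e]].
have [pk ek] := phi_n_colY hk.
rewrite [cw _]/cw /= -/(cw P) phiW_cat epsW_cat p e pk ek.
by rewrite subn0 doubleD; split=> //; rewrite addnC addnACA.
Qed.

Lemma colYS k : k < n -> colY k.+1 = colY k ++ [:: U k.+1].
Proof. by move=> hk; rewrite !colY_seg; [rewrite seg_rcons cats1|lia|lia]. Qed.

Lemma epsL_n a : epsL n a = (rk a == n.+1) || (rk a == n.+2).
Proof.
have cn : color n n by rewrite /color; lia.
have := rk_bounds a; rewrite -phiL_lbar !phiL_arr // eqxx rk_lbar; lia.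
Qed.

Definition valid P := sorted leq P && all (fun k => 0 < k <= n) P.

Lemma valid_le P : valid P -> all (fun k => k <= n) P.
Proof. by case/andP=> _; apply: sub_all => k /andP[]. Qed.

Lemma color_lt_or_n i : color n i -> 0 < i < n \/ i = n.
Proof. rewrite /color; lia. Qed.

Lemma cw_highest P : all (fun k => k <= n) P -> highest (cw P).
Proof.
move=> hP i /color_lt_or_n[hi|->]; apply/eW_None.
  by have [_ ->] := phi_cw hi hP.
by have [_ ->] := phi_n_cw hP.
Qed.

Lemma sorted_split j P : sorted leq P -> exists P1 P2, 
  [/\ P = P1 ++ P2, all (fun k => k < j) P1 & all (leq j) P2].
Proof.
elim: P => [|k P IH] hs; first by exists [::], [::].
have [P1 [P2 [eP h1 h2]]] := IH (path_sorted hs).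
case: (ltnP k j) => hk.
  by exists (k :: P1), P2; rewrite eP /= hk h1.
exists [::], (k :: P); split=> //=; rewrite hk /=.
apply/allP => m mP; apply: leq_trans hk _.
by have := order_path_min leq_trans hs; move/allP/(_ m mP).
Qed.

(** The letter j moves left through the columns of height at least j and meets the last shorter one,
    which has height j-1 and grows to height j; for j = 1 it forms a new column. *)
Lemma cw_rcons_U j P : valid P -> 0 < j <= n -> (1 < j -> j.-1 \in P) ->
  exists2 P', valid P' & congD (cw P ++ [:: U j]) (cw P').
Proof.
move=> /andP[hs hP] hj mem; have [P1 [P2 [eP h1 h2]]] := sorted_split j hs.
have hP2 : all (fun k => j <= k <= n) P2.
  apply/allP => k kP2; rewrite (allP h2 _ kP2) /=.
  by have := allP hP k; rewrite eP mem_cat kP2 orbT => /(_ isT) /andP[].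
have jpos : 0 < j by lia.
have c := congD_catl (cw P1) (cw_commL jpos hP2).
rewrite eP cw_cat -catA.
case: (leqP j 1) => j1.
  have ej : j = 1 by lia.
  have P10 : P1 = [::].
    case: P1 eP h1 {c} => [//|k P1] eP /= /andP[hk _].
    by have := allP hP k; rewrite eP inE eqxx => /(_ isT); lia.
  rewrite P10 /= in c eP *; rewrite -eP in c *; exists (1 :: P).
    rewrite /valid /= hP andbT; apply/andP; split; last by lia.
    rewrite path_min_sorted //; apply/allP => k kP; have := allP hP k kP; lia.
  by move: c; rewrite [cw (1 :: _)]/cw /= -/(cw P) (colY_seg (ltnW hn)) ej.
have jm : j.-1 \in P1.
  by have := mem j1; rewrite eP mem_cat => /orP[//|/(allP h2)]; lia.
have {jm} [P3 eP1] : exists P3, P1 = rcons P3 j.-1.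
  case: (lastP P1) jm eP h1 => [//|P3 k] jm eP h1; exists P3; congr rcons.
  have hk : k < j by move: h1; rewrite all_rcons => /andP[].
  move: jm; rewrite mem_rcons inE => /orP[/eqP //|jm].
  move: hs; rewrite eP (sorted_pairwise leq_trans) pairwise_cat pairwise_rcons.
  by case/and3P => _ /andP[/allP/(_ _ jm) /=]; lia.
exists (P3 ++ j :: P2).
  rewrite /valid; apply/andP; split.
    have := hs; rewrite eP eP1 !(sorted_pairwise leq_trans) !pairwise_cat pairwise_rcons /=.
    move=> /and3P[_ /andP[h3 ->] ->]; rewrite h2 !andbT.
    have P3j : all (fun k => k <= j.-1) P3 by [].
    rewrite -[j :: P2]cat1s; apply/allrelP => x y xP3; rewrite inE => /orP[/eqP ->|yP2].
      by have := allP P3j x xP3; lia.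
    by have := allP P3j x xP3; have := allP h2 y yP2; rewrite /=; lia.
  move: hP; rewrite eP eP1 !all_cat all_rcons /= => /andP[/andP[_ ->] ->].
  by rewrite hj.
apply: congD_trans c _; rewrite eP1 -cats1 !cw_cat [cw [:: _]]/cw /= cats0 -!catA.
apply: congD_catl; rewrite -cat1s catA [cw (j :: P2)]/cw /= -/(cw P2).
have ej : j = j.-1.+1 by lia.
have -> : colY j = colY j.-1 ++ [:: U j] by rewrite {1}ej colYS -?ej //; lia.
exact: congD_refl.
Qed.

(** The first column of height at least j has height exactly j, and punctured at j it is the column
    of height j-1. *)
Lemma cw_rcons_B j P : valid P -> j \in P ->
  exists2 P', valid P' & congD (cw P ++ [:: lbar (U j)]) (cw P').
Proof.
move=> /andP[hs hP] jP; have [P1 [P2 [eP h1 h2]]] := sorted_split j hs.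
have hj := allP hP j jP; have jpos : 0 < j by lia.
have jP2 : j \in P2.
  by move: jP; rewrite eP mem_cat => /orP[/(allP h1)|//]; rewrite ltnn.
have hs2 : sorted leq P2 by move: hs; rewrite eP => /cat_sorted2[].
have [P3 eP2] : exists P3, P2 = j :: P3.
  case: P2 {eP} h2 jP2 hs2 => [//|k P3] /= /andP[hk _]; rewrite inE => /orP[/eqP ->|jP3 hs2].
    by exists P3.
  have := order_path_min leq_trans hs2 => /allP/(_ _ jP3) kj.
  by exists P3; congr cons; lia.
have c : congD (cw P ++ [:: lbar (U j)]) (cw P1 ++ colY j.-1 ++ cw P3).
  rewrite eP cw_cat -catA; apply: congD_catl; rewrite eP2.
  have -> : colY j.-1 = hole j j by rewrite /hole subnn cats0 colY_seg //; lia.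
  apply: cw_barL; rewrite -?eP2 //; first by lia.
  by have := valid_le (_ : valid P); rewrite eP all_cat /valid -eP hs hP => /(_ isT) /andP[].
case: (leqP j 1) => j1.
  exists (P1 ++ P3).
    apply/andP; split.
      have := hs; rewrite eP eP2; apply: subseq_sorted; first exact: leq_trans.
      by rewrite subseq_cat2l subseq_cons.
    by move: hP; rewrite eP eP2 !all_cat /= => /and3P[-> _ ->].
  by move: c; rewrite cw_cat; have -> : j.-1 = 0 by lia.
exists (P1 ++ j.-1 :: P3); last by move: c; rewrite cw_cat [cw (_ :: _)]/cw.
apply/andP; split.
  have := hs; rewrite eP eP2 !(sorted_pairwise leq_trans) !pairwise_cat /=.
  move=> /and3P[h3 -> /andP[h4 ->]]; rewrite andbT /=; apply/andP; split.
    apply/allrelP => x y xP1; rewrite inE => /orP[/eqP ->|yP3].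
      by have := allP h1 x xP1; lia.
    by move/allrelP: h3; apply; rewrite // inE yP3 orbT.
  by apply: sub_all h4 => x /=; lia.
by move: hP; rewrite eP eP2 !all_cat /= => /and3P[-> hj' ->]; rewrite andbT /=; lia.
Qed.

(* The readings of T_Y and of T_Y^-, see [reading_TY]. *)
Definition cs (s : bool) P := if s then sw (cw P) else cw P.

Lemma sw_colY k : k < n -> sw (colY k) = colY k.
Proof.
move=> hk; rewrite colY_seg; last exact: ltnW.
rewrite /sw map_id_in // => a /mem_seg[j hj ->]; apply: swL_id.
by rewrite lvU; lia.
Qed.

Lemma sw_cw P : valid P -> n \notin P -> sw (cw P) = cw P.
Proof.
move=> /valid_le; elim: P => [//|k P IH] /= /andP[hk hP]; rewrite inE negb_or => /andP[nk nP].
rewrite [cw _]/cw /= -/(cw P) sw_cat IH // sw_colY //; lia.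
Qed.

Lemma letter_U a : rk a <= n -> a = U (lv a).
Proof.
move=> ha; have hb := rk_bounds a; apply: rk_inj.
by rewrite lv_unbar // rkU //; lia.
Qed.

Lemma highest_cat u v : highest (u ++ v) -> highest u.
Proof. by move=> h i hi; have := h i hi; rewrite !eW_None epsW_cat; lia. Qed.

Lemma cw_rcons P a : valid P -> highest (cw P ++ [:: a]) ->
  exists s P', valid P' /\ congD (cw P ++ [:: a]) (cs s P').
Proof.
move=> hv hh; have hP := valid_le hv; have ha := rk_bounds a.
(* In a highest weight word the epsilon of the new letter is cancelled by a phi of [cw P], which
   comes from a column of height i. *)
have eps0 i : 0 < i < n -> epsL i a = 1 -> i \in P.
  move=> hi ea; have := hh i; rewrite eW_None epsW_cat /= sub0n addn0 ea.
  have [-> ->] := phi_cw hi hP; rewrite /color -has_pred1 has_count.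
  by move=> /(_ ltac:(lia)); lia.
case: (leqP (rk a) n) => hra.
  rewrite (letter_U hra) (lv_unbar hra).
  have [||P' v' c] := @cw_rcons_U (rk a) P hv; [lia| |by exists false, P'].
  by move=> h1; apply: eps0; [lia|rewrite (epsL_rk hn); lia].
have ea : a = lbar (U ((2 * n).+1 - rk a)).
  by apply: rk_inj; rewrite rk_lbar rkU; lia.
case: (boolP (((2 * n).+1 - rk a) \in P)) => hin.
  have [P' v' c] := cw_rcons_B hv hin; rewrite -ea in c.
  by exists false, P'.
(* Only \bar n in the absence of columns of height n remains. Its epsilon_n requires a column of
   height n-1. The diagram automorphism fixes [cw P] and makes it the letter n, whence the sign
   [true]. *)
have ran : rk a = n.+1.
  case: (eqVneq (rk a) n.+1) => // ne; case/negP: hin; apply: eps0; first by lia.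
  by rewrite (epsL_rk hn); lia.
have nP : n \notin P by move: hin; rewrite ran; have -> : (2 * n).+1 - n.+1 = n by lia.
have swa : swL a = U n.
  by apply: rk_inj; rewrite rkU; [have := rk_swL hn a; lia | lia].
have [||P' v' c] := @cw_rcons_U n P hv; first by lia.
  move=> _; have := hh n; rewrite /color leqnn andbT => /(_ ltac:(lia)).
  rewrite eW_None epsW_cat /= sub0n addn0; have [-> ->] := phi_n_cw hP.
  have -> : epsL n a = 1 by rewrite epsL_n; lia.
  by move/count_memPn: nP => ->; rewrite -has_pred1 has_count; lia.
exists true, P'; split=> //.
by have := congD_sw hn c; rewrite sw_cat sw_cw //= -swa swLK.
Qed.

Lemma highest_canon w : highest w -> exists s P, valid P /\ congD w (cs s P).
Proof.
elim/last_ind: w => [_|w a IH]; first by exists false, [::]; split=> //; exact: congD_refl.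
rewrite -cats1 => hh; have [s [P [vP c]]] := IH (highest_cat hh).
have {}c := congD_catr [:: a] c.
have {}hh : highest (cs s P ++ [:: a]).
  by move=> i hi; have := hh i hi; rewrite !eW_None (congD_eps hn hi c).
case: s c hh => /= c hh; last first.
  have [s [P' [vP' c']]] := cw_rcons vP hh.
  by exists s, P'; split=> //; apply: congD_trans c c'.
have e : sw (cw P) ++ [:: a] = sw (cw P ++ [:: swL a]) by rewrite sw_cat /= swLK.
rewrite e in c hh.
have {}hh : highest (cw P ++ [:: swL a]).
  move=> i hi; have := hh (swc n i); rewrite swc_color // => /(_ hi).
  by rewrite !eW_None epsW_sw.
have [s [P' [vP' /(congD_sw hn) c']]] := cw_rcons vP hh.
exists (~~ s), P'; split=> //; apply: congD_trans c _.
by case: s c' => //=; rewrite swK.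
Qed.

Lemma valid_eq P P' : valid P -> valid P' ->
  (forall i, 0 < i <= n -> count_mem i P = count_mem i P') -> P = P'.
Proof.
move=> /andP[s1 h1] /andP[s2 h2] H.
apply: (sorted_eq leq_trans anti_leq) => //; apply/allP => k; rewrite mem_cat => hk /=.
by apply/eqP; apply: H; case/orP: hk => [/(allP h1)|/(allP h2)].
Qed.

(** For i < n-1, phi_i counts the columns of height i. Of phi_{n-1} and phi_n one counts the columns
    of height n-1 and the other exceeds it by twice the number of columns of height n. The sign
    tells which is which, and without columns of height n the two words are the same. *)
Lemma cs_phi_eq s s' P P' : valid P -> valid P' ->
  (forall i, color n i -> phiW i (cs s P) = phiW i (cs s' P')) -> cs s P = cs s' P' /\ P = P'.
Proof.
move=> v1 v2 H; have l1 := valid_le v1; have l2 := valid_le v2.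
have phi t Q i : valid Q -> 0 < i < n.-1 -> phiW i (cs t Q) = count_mem i Q.
  move=> /valid_le hQ hi; case: t => /=.
    have e : swc n i = i by rewrite /swc; do ?case: eqP => ?; lia.
    rewrite -{1}e phiW_sw //.
    by have [|-> //] := @phi_cw i Q _ hQ; lia.
  by have [|-> //] := @phi_cw i Q _ hQ; lia.
have phi1 t Q : valid Q -> phiW n.-1 (cs t Q) = (if t then (count_mem n Q).*2 else 0) + count_mem n.-1 Q /\
    phiW n (cs t Q) = (if t then 0 else (count_mem n Q).*2) + count_mem n.-1 Q.
  move=> /valid_le hQ; have [pn _] := phi_n_cw hQ; have [|p1 _] := @phi_cw n.-1 Q _ hQ; first by lia.
  case: t => /=; last by rewrite pn p1.
  have e1 : swc n n.-1 = n by rewrite /swc; do ?case: eqP => ?; lia.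
  have e2 : swc n n = n.-1 by rewrite /swc eqxx.
  have := phiW_sw hn n (cw Q); have := phiW_sw hn n.-1 (cw Q).
  by rewrite e1 e2 => -> ->; rewrite pn p1.
have c1 := H n.-1; have c2 := H n; have [q1 q2] := phi1 s P v1; have [q3 q4] := phi1 s' P' v2.
rewrite q1 q3 /color in c1; rewrite q2 q4 /color in c2.
have {}c1 := c1 ltac:(lia); have {}c2 := c2 ltac:(lia).
have e1 : count_mem n.-1 P = count_mem n.-1 P' /\ count_mem n P = count_mem n P'.
  by case: (s) (s') c1 c2 => [] []; lia.
have eP : P = P'.
  apply: valid_eq => // i hi; case: (ltnP i n.-1) => hin.
    by rewrite -(phi s) // -1?(phi s' P') // ?H /color; lia.
  case: e1 => e1 e2; have [->|->] : i = n.-1 \/ i = n by lia.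
    exact: e1.
  exact: e2.
split=> //; rewrite -eP in c1 c2 *.
have [->//|ns] := eqVneq s s'.
have nP : n \notin P by apply/count_memPn; case: (s) (s') ns c1 c2 => [] []; lia.
by case: (s) (s') => [] []; rewrite /cs ?sw_cw.
Qed.

End Canonical.

(** * Congruence and isomorphism of components *)

Section Assembly.
Variable n : nat.
Hypothesis hn : 1 < n.
Implicit Types (u v w x y t : word n) (i j k m : nat) (P s : seq nat).

Local Notation cs := (cs n).
Local Notation cw := (cw n).

Lemma conn_trans x y t : conn x y -> conn y t -> conn x t.
Proof. by rewrite !conn_connS; apply: connS_trans. Qed.

Lemma conn_sym x y : conn x y -> conn y x.
Proof. by rewrite !conn_connS; apply: connS_sym. Qed.

Lemma fseq_conn s x y : all (color n) s -> fseq s x = Some y -> conn x y.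
Proof.
elim: s y => [|i s IH] y /=; first by move=> _ [->]; exact: conn_refl.
case/andP=> hi hs; case E: (fseq s x) => [t|] //= ft.
by apply: conn_trans (IH _ hs E) _; apply: conn_f hi ft (conn_refl _).
Qed.

Lemma fseq_cong s x x' y : all (color n) s -> congD x y -> fseq s x = Some x' ->
  exists2 y', fseq s y = Some y' & congD x' y'.
Proof.
move=> + xy; elim: s x' => [|i s IH] x' /=; first by move=> _ [<-]; exists y.
case/andP=> hi hs; case E: (fseq s x) => [t|] //= ft.
have [t' -> tt'] := IH _ hs E.
by have [y' fy xy'] := congD_fW hn hi tt' ft; exists y'.
Qed.

Lemma up_fseq x y t : up (color n) x t -> congD x y ->
  exists s t', [/\ all (color n) s, fseq s t = Some x, fseq s t' = Some y & congD t t'].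
Proof.
move=> u; elim: u y => {x t} [w|i w1 w2 w3 hi h _ IH] y xy.
  by exists [::], y.
have [y2 ey c] := congD_eW hn hi xy ((eW_fW _ _ _).2 h).
have [s [t' [hs h1 h2 ct]]] := IH _ c.
exists (i :: s), t'; split=> //=; first by rewrite hi hs.
  by rewrite h1.
by rewrite h2 /=; apply/eW_fW.
Qed.

Lemma highest_cong x y : congD x y -> highest x -> highest y.
Proof. by move=> c h i hi; have := h i hi; rewrite !eW_None (congD_eps hn hi c). Qed.

Lemma raise_cong x y : congD x y -> exists s t t', [/\ all (color n) s, fseq s t = Some x,
  fseq s t' = Some y, congD t t' & highest t /\ highest t'].
Proof.
move=> c; have [t u ht] := highest_ex x.
have [s [t' [hs h1 h2 ct]]] := up_fseq u c.
by exists s, t, t'; split=> //; split=> //; apply: highest_cong ct ht.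
Qed.

(** One path raises both words to highest weight vertices; these coincide, and lowering along the
    path is deterministic. *)
Lemma cong_conn_eq x y : congD x y -> conn x y -> x = y.
Proof.
move=> c xy; have [s [t [t' [hs h1 h2 _ [ht ht']]]]] := raise_cong c.
have tt' : t = t'.
  apply: (highest_unique hn) ht ht'; apply: conn_trans (fseq_conn hs h1) _.
  by apply: conn_trans xy _; apply/conn_sym/(fseq_conn hs h2).
by move: h1; rewrite tt' h2 => -[].
Qed.

(** A path to the top fixed by taking the smallest color with positive epsilon, so that transport
    along it is a function of the vertex. The number m is fuel, for which [rksum w] suffices; the
    default of [odflt] is never taken. *)
Fixpoint raise_path m w : seq nat :=
  if m is m'.+1 then
    if [seq i <- iota 1 n | 0 < epsW i w] is i :: _
    then i :: raise_path m' (odflt w (eW i w)) else [::]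
  else [::].

Lemma raise_pathP m w : rksum w <= m -> exists t,
  [/\ all (color n) (raise_path m w), fseq (raise_path m w) t = Some w & highest t].
Proof.
elim: m w => [|m IH] w hm /=.
  exists w; split=> // i hi; case E: (eW i w) => [w'|] //.
  by move/eW_fW/fW_rksum: E; lia.
case E: [seq i <- iota 1 n | 0 < epsW i w] => [|i s].
  exists w; split=> // i hi; apply/eW_None.
  have : i \notin [seq i <- iota 1 n | 0 < epsW i w] by rewrite E.
  by rewrite mem_filter mem_iota; rewrite /color in hi; lia.
have : i \in [seq i <- iota 1 n | 0 < epsW i w] by rewrite E inE eqxx.
rewrite mem_filter mem_iota => /andP[/eW_ex[w' ew] hi].
have fw := (eW_fW _ _ _).1 ew; rewrite ew /=.
have [|t [h1 h2 h3]] := IH w'; first by have := fW_rksum fw; lia.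
by exists t; rewrite h1 h2 /= andbT; split=> //; rewrite /color; lia.
Qed.

Definition transport w0 x : word n := odflt x (fseq (raise_path (rksum x) x) w0).

Lemma transportP w1 w2 x : highest w1 -> congD w1 w2 -> conn w1 x ->
  congD x (transport w2 x) /\ conn w2 (transport w2 x).
Proof.
move=> h1 c cx; have [t [hs ft ht]] := raise_pathP (leqnn (rksum x)).
have et : w1 = t.
  apply: (highest_unique hn) h1 ht; apply: conn_trans cx _.
  exact/conn_sym/(fseq_conn hs ft).
rewrite -et in ft; have [y' fy cy] := fseq_cong hs c ft.
by rewrite /transport fy /=; split=> //; apply: fseq_conn hs fy.
Qed.

(** Transport sends a vertex to a congruent word of the other component. By [cong_conn_eq] there is
    only one such word, so the two transports are inverse to each other and commute with f_i. *)
Lemma cong_sim x y : congD x y -> sim x y.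
Proof.
move=> c; have [s [w1 [w2 [hs f1 f2 c12 [h1 h2]]]]] := raise_cong c.
have k1 := fseq_conn hs f1; have k2 := fseq_conn hs f2.
split; last first.
  by exists s, w1, w2; split=> //; split; [exact: conn_sym|split=> //; split; first exact: conn_sym].
have T1 t : conn x t -> congD t (transport w2 t) /\ conn w2 (transport w2 t).
  by move=> ct; apply: transportP h1 c12 _; apply: conn_trans k1 ct.
have T2 t : conn y t -> congD t (transport w1 t) /\ conn w1 (transport w1 t).
  by move=> ct; apply: transportP h2 (congD_sym c12) _; apply: conn_trans k2 ct.
exists (transport w2), (transport w1); split; [|split].
- move=> t ct; have [c1 d1] := T1 _ ct.
  have d1' : conn y (transport w2 t) by apply: conn_trans (conn_sym k2) d1.
  have [c2 d2] := T2 _ d1'; split=> //; apply/esym; apply: cong_conn_eq (congD_trans c1 c2) _.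
  by apply: conn_trans (conn_sym ct) _; apply: conn_trans (conn_sym k1) d2.
- move=> t ct; have [c1 d1] := T2 _ ct.
  have d1' : conn x (transport w1 t) by apply: conn_trans (conn_sym k1) d1.
  have [c2 d2] := T1 _ d1'; split=> //; apply/esym; apply: cong_conn_eq (congD_trans c1 c2) _.
  by apply: conn_trans (conn_sym ct) _; apply: conn_trans (conn_sym k2) d2.
move=> t i ct hi; have [c1 d1] := T1 _ ct.
case E: (fW i t) => [t'|] /=; last first.
  by move/fW_None: E => E; apply/fW_None; rewrite -(congD_phi hn hi c1).
have [t2 f2' c2] := congD_fW hn hi c1 E; rewrite f2'; congr Some.
have ct' : conn x t' by apply: conn_trans ct _; apply: conn_f hi E (conn_refl _).
have [c3 d3] := T1 _ ct'.
apply: cong_conn_eq; first exact: congD_trans (congD_sym c2) c3.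
apply: conn_trans d3; apply: conn_sym; apply: conn_trans d1 _.
exact: conn_f hi f2' (conn_refl _).
Qed.

(** The hypotheses mention f_i only. An arrow into [g t] starts in the component of y, hence in the
    image of [g], and pulls back to an arrow into [t]. *)
Lemma iso_highest x y g h : 
  (forall t, conn x t -> conn y (g t) /\ h (g t) = t) ->
  (forall t, conn y t -> conn x (h t) /\ g (h t) = t) ->
  (forall t i, conn x t -> color n i -> fW i (g t) = omap g (fW i t)) ->
  forall t, conn x t -> highest t -> highest (g t).
Proof.
move=> hg hh hf t ct ht i hi; case E: (eW i (g t)) => [u|] //; exfalso.
have [cg gt] := hg _ ct; move/eW_fW: E => E.
have cu : conn y u by apply: conn_trans cg _; apply: conn_e hi E (conn_refl _).
have [chu ghu] := hh _ cu.
have := hf _ _ chu hi; rewrite ghu E; case F: (fW i (h u)) => [v|] //= -[egv].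
have cv : conn x v by apply: conn_trans chu _; apply: conn_f hi F (conn_refl _).
have [_ hgv] := hg _ cv; have etv : t = v by rewrite -gt egv hgv.
by move: F; rewrite -etv => /eW_fW; rewrite (ht i hi).
Qed.

(** phi_i is the length of the f_i-string that starts at the vertex, hence visible in the colored
    graph. *)
Lemma iso_phi x y g h i : color n i ->
  (forall t, conn x t -> conn y (g t) /\ h (g t) = t) ->
  (forall t i, conn x t -> color n i -> fW i (g t) = omap g (fW i t)) ->
  forall t, conn x t -> phiW i t = phiW i (g t).
Proof.
move=> hi hg hf t; move: {2}(phiW i t) (erefl (phiW i t)) => m.
elim: m t => [|m IH] t et ct.
  by rewrite et; apply/esym/fW_None; rewrite hf //; move/fW_None: et => ->.
have [|t' ft] := @fW_ex n i t; first by rewrite et.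
have := hf _ _ ct hi; rewrite ft /= => /fW_phi ->.
have ct' : conn x t' by apply: conn_trans ct _; apply: conn_f hi ft (conn_refl _).
by rewrite (fW_phi ft); congr _.+1; apply: IH => //; have := fW_phi ft; rewrite et => -[].
Qed.

(** The two highest weight vertices have equal phi_i, so their canonical forms coincide and they are
    congruent; the common path [s] carries the congruence down. *)
Lemma sim_cong x y : sim x y -> congD x y.
Proof.
move=> [[g [h [hg [hh hf]]]] [s [w1 [w2 [hs [c1 [h1 [c2 [h2 [f1 f2]]]]]]]]]].
have hg1 := iso_highest hg hh hf c1 h1; have [cg1 _] := hg _ c1.
have eg : g w1 = w2.
  by apply: (highest_unique hn) hg1 h2; apply: conn_trans (conn_sym cg1) c2.
have [s1 [P1 [v1 k1]]] := highest_canon hn h1.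
have [s2 [P2 [v2 k2]]] := highest_canon hn h2.
have [e _] : cs s1 P1 = cs s2 P2 /\ P1 = P2.
  apply: (cs_phi_eq hn v1 v2) => i hi.
  rewrite -(congD_phi hn hi k1) -(congD_phi hn hi k2) -eg.
  exact: (iso_phi hi hg hf).
have k : congD w1 w2 by apply: congD_trans k1 _; rewrite e; apply: congD_sym.
have [y' fy c] := fseq_cong hs k f1.
by move: fy c; rewrite f2 => -[<-].
Qed.

Lemma col_fW_all i w w' : color n i -> is_col w -> fW i w = Some w' -> is_col w'.
Proof.
case/(color_lt_or_n hn) => [hi|->]; first exact: (col_fW hn hi).
rewrite -[is_col w](is_col_sw hn) -[is_col w'](is_col_sw hn) => hw hf.
apply: (@col_fW n hn n.-1 _ (sw w)) => //; first by lia.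
have -> : n.-1 = swc n n by rewrite /swc eqxx.
exact/(fW_sw hn).
Qed.

Lemma fW_flatten i (L : seq (word n)) r : color n i -> all (@is_col n) L ->
  fW i (flatten L) = Some r ->
  exists L', [/\ r = flatten L', map size L' = map size L & all (@is_col n) L'].
Proof.
move=> hi; elim: L r => [//|C L IH] r /= /andP[hC hL]; rewrite fW_cat; case: ifP => _.
  case E: (fW i C) => [C'|] //= -[<-]; exists (C' :: L).
  by rewrite /= (fW_size E) (col_fW_all hi hC E) hL.
case E: (fW i (flatten L)) => [r'|] //= -[<-].
have [L' [-> sL hL']] := IH _ hL E.
by exists (C :: L'); rewrite /= sL hC hL'.
Qed.

Lemma fseq_flatten s (L : seq (word n)) r : all (color n) s -> all (@is_col n) L ->
  fseq s (flatten L) = Some r ->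
  exists L', [/\ r = flatten L', map size L' = map size L & all (@is_col n) L'].
Proof.
move=> + hL; elim: s r => [|i s IH] r /=; first by move=> _ [<-]; exists L.
case/andP=> hi hs; case E: (fseq s (flatten L)) => [t|] //= ft.
have [L1 [et sL1 hL1]] := IH _ hs E; rewrite et in ft.
have [L2 [-> sL2 hL2]] := fW_flatten hi hL1 ft.
by exists L2; rewrite sL2 sL1.
Qed.

Lemma size_colY k : k <= n -> size (colY n k) = k.
Proof. by move=> hk; rewrite (colY_seg hn) // size_map size_iota. Qed.

Lemma is_col_colY k : k <= n -> is_col (colY n k).
Proof. by move=> hk; rewrite (colY_seg hn) //; apply: is_col_seg. Qed.

Lemma colYm_sw k : k <= n -> colYm n k = sw (colY n k).
Proof.
move=> hk; rewrite /colYm; case: eqP => [ek|nk]; last first.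
  by rewrite (sw_colY hn) //; lia.
rewrite ek /colY.
have : forall j, j \in iota 1 n -> 0 < j <= n by move=> j; rewrite mem_iota; lia.
elim: (iota 1 n) => //= j l IH H.
have hj : 0 < j <= n by apply: H; rewrite inE eqxx.
have [a [la sga]] := letter_exists (j == n) hj.
rewrite (mklU hn hj) (_ : mkl n j (j == n) = Some a) /=; last exact/mklE.
rewrite IH; last by move=> j' hj'; apply: H; rewrite inE hj' orbT.
congr (_ :: _); apply: letter_eq; first by rewrite lv_swL // (lvU hn hj).
rewrite sg_swL // (lvU hn hj) sga.
by have [_ ->] := (mklE j false (U hn j)).1 (mklU hn hj); rewrite addbF.
Qed.

Definition cs_cols (s : bool) P : seq (word n) :=
  if s then map (@sw n) (map (colY n) P) else map (colY n) P.

Lemma flatten_cs_cols (s : bool) P : flatten (cs_cols s P) = cs s P.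
Proof. by case: s => //=; rewrite /cs /cw /sw map_flatten. Qed.

Lemma reading_TY (s : bool) P : all (fun k => k <= n) P ->
  reading (if s then TYm n (rev P) else TY n (rev P)) = cs s P.
Proof.
move=> hP; rewrite -flatten_cs_cols /reading /TYm /TY /cs_cols.
case: s; rewrite map_rev revK // -map_comp; congr flatten.
by apply/eq_in_map => k kP /=; rewrite colYm_sw //; apply: (allP hP).
Qed.

Lemma cs_cols_col (s : bool) P : all (fun k => k <= n) P -> all (@is_col n) (cs_cols s P).
Proof.
move=> hP; apply/allP => C; rewrite /cs_cols; case: s => [/mapP[C' /mapP[k kP ->] ->]|/mapP[k kP ->]].
  by rewrite is_col_sw // is_col_colY //; apply: (allP hP).
by rewrite is_col_colY //; apply: (allP hP).
Qed.

Lemma cs_cols_size (s : bool) P : all (fun k => k <= n) P -> map size (cs_cols s P) = P.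
Proof.
move=> hP; rewrite /cs_cols; case: s; rewrite -!map_comp map_id_in // => k kP /=;
  by rewrite ?size_map size_colY //; apply: (allP hP).
Qed.

(** The highest weight vertex above w is congruent to a product of columns. Lowering this product
    along the path from the top to w acts inside single columns, so the result is congruent to w and
    still cut into columns of the same heights. *)
Lemma PD_exists w : exists T, ortho T /\ congD (reading T) w.
Proof.
have [s [t [_ [hs ft _ _ [ht _]]]]] := raise_cong (congD_refl w).
have [b [P [vP c]]] := highest_canon hn ht; have hP := valid_le vP.
have [r fr cr] := fseq_cong hs c ft.
have fr' := fr; rewrite -flatten_cs_cols in fr'.
have [L [er sL hL]] := fseq_flatten hs (cs_cols_col b hP) fr'.
rewrite cs_cols_size // in sL.
have rd : reading (rev L) = r by rewrite /reading revK.
exists (rev L); rewrite rd; split; last exact: congD_sym.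
case/andP: vP => sP aP.
have sz C : C \in L -> 0 < size C <= n.
  by move=> CL; apply: (allP aP); rewrite -sL map_f.
split; last split.
- apply/and3P; split.
  + by rewrite all_rev.
  + by rewrite all_rev; apply/allP => C /sz /andP[].
  by rewrite map_rev sL rev_sorted.
- by rewrite all_rev; apply/allP => C /sz /andP[].
rewrite rd map_rev sL; have := reading_TY b hP.
by case: (b) fr => fr e; [right|left]; rewrite e; apply: fseq_conn hs fr.
Qed.

Lemma ortho_cs (T : seq (word n)) : ortho T -> exists s : bool, let P := rev (map size T) in
  valid n P /\ conn (cs s P) (reading T).
Proof.
move=> [/and3P[_ h1 h2] [h3 h4]].
have vP : valid n (rev (map size T)).
  rewrite /valid rev_sorted all_rev all_map h2 /=; apply/allP => C CT /=.
  by rewrite (allP h1 C CT) (allP h3 C CT).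
have R b := reading_TY b (valid_le vP); rewrite !revK in R.
by case: h4 => h4; [exists false|exists true]; split=> //; rewrite -R.
Qed.

Lemma cs_highest (s : bool) P : all (fun k => k <= n) P -> highest (cs s P).
Proof.
move=> /(cw_highest hn) h; case: s => //= i hi.
rewrite eW_None -(swcK hn i) epsW_sw //; apply/eW_None.
by apply: h => //; rewrite swc_color.
Qed.

(** The canonical words above the two readings are congruent, so they and their heights agree by
    [cs_phi_eq]. The readings are then congruent within one component, hence equal, and equal
    heights cut a word into equal columns. *)
Lemma ortho_unique (T T' : seq (word n)) : ortho T -> ortho T' -> congD (reading T) (reading T') -> T = T'.
Proof.
move=> /ortho_cs[s [vP k]] /ortho_cs[s' [vP' k']] c.
have [q [t [t' [hq ft ft' ct [ht ht']]]]] := raise_cong c.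
have top r (b : bool) Q z : valid n Q -> conn (cs b Q) z -> all (color n) q ->
    fseq q r = Some z -> highest r -> cs b Q = r.
  move=> vQ kz hq' fz hr; apply: (highest_unique hn) (cs_highest _ (valid_le vQ)) hr.
  by apply: conn_trans kz _; apply/conn_sym/(fseq_conn hq' fz).
have et := top _ _ _ _ vP k hq ft ht; have et' := top _ _ _ _ vP' k' hq ft' ht'.
have [e eP] : cs s (rev (map size T)) = cs s' (rev (map size T')) /\
    rev (map size T) = rev (map size T').
  by apply: (cs_phi_eq hn vP vP') => i hi; rewrite et et' (congD_phi hn hi ct).
have er : reading T = reading T'.
  apply: cong_conn_eq c _; apply: conn_trans (conn_sym k) _; by rewrite e.
apply: (can_inj revK); apply: eq_from_flatten_shape => //.
by rewrite /shape !map_rev.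
Qed.

End Assembly.

Theorem mainTheorem9 (n : nat) (hn : 2 <= n) :
  (forall w : word n, exists! T : seq (word n), is_PD w T) /\
  (forall w1 w2 : word n,
     (sim w1 w2 <-> congD w1 w2) /\
     (congD w1 w2 <->
        (forall T1 T2 : seq (word n), is_PD w1 T1 -> is_PD w2 T2 -> T1 = T2))).
Proof.
split=> [w|w1 w2].
  have [T [oT cT]] := PD_exists hn w.
  exists T; split; first by split=> //; apply: cong_sim.
  move=> T' [oT' /(sim_cong hn) cT'].
  by apply: (ortho_unique hn) oT oT' _; apply: congD_trans cT (congD_sym cT').
split; first by split; [apply: sim_cong|apply: cong_sim].
split=> [c T1 T2 [o1 /(sim_cong hn) c1] [o2 /(sim_cong hn) c2]|H].
  by apply: (ortho_unique hn) o1 o2 _; apply: congD_trans c1 (congD_trans c (congD_sym c2)).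
have [T1 [o1 c1]] := PD_exists hn w1; have [T2 [o2 c2]] := PD_exists hn w2.
have e : T1 = T2 by apply: H; split=> //; apply: cong_sim.
by apply: congD_trans (congD_sym c1) _; rewrite e.
Qed.
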